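(* Let $\alpha\ge0$ and $\mu_\alpha(z)=|z-1|^{2\alpha}$. For any $p\in(1,\infty)$ and $q$ with $\frac1p+\frac1q=1$, the dual space of $\mathcal{H}^p(\mathbb{T},|z-1|^{\alpha p})$ can be identified with $\mathcal{H}^q(\mathbb{T},|z-1|^{\alpha q})$ under the pairing $\langle f,h\rangle=\int_{\mathbb{T}}f(z)\overline{h(z)}|z-1|^{2\alpha}d\theta$; that is, every $h\in\mathcal{H}^q(\mathbb{T},|z-1|^{\alpha q})$ defines a bounded linear functional $f\mapsto\langle f,h\rangle$ on $\mathcal{H}^p(\mathbb{T},|z-1|^{\alpha p})$, and every bounded linear functional on $\mathcal{H}^p(\mathbb{T},|z-1|^{\alpha p})$ is of this form for some $h\in\mathcal{H}^q(\mathbb{T},|z-1|^{\alpha q})$.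
   Context: $\mathbb{D}$ is the unit disc, $\mathbb{T}$ the unit circle with measure $d\theta$. For $1\le p<\infty$ and $\beta\ge0$, $\mathcal{H}^p(\mathbb{T},|z-1|^\beta)$ is the space of holomorphic $f$ on $\mathbb{D}$ with $\sup_{0\le r<1}\int_0^{2\pi}|f(re^{i\theta})|^p|re^{i\theta}-1|^{\beta}d\theta<\infty$, identified with its a.e. boundary values on $\mathbb{T}$, with norm $\left(\int_{\mathbb{T}}|f|^p|z-1|^\beta d\theta\right)^{1/p}$. *)

(* Defs.v *)
(* R : realType, complex numbers R[i] from
   mathcomp-real-closed, used through the regular copy (R[i])^o which carries
   the normed/topological structure of a numFieldType. *)
From HB Require Import structures.
From mathcomp Require Import all_boot all_order all_algebra.
From mathcomp Require Import all_classical all_reals all_analysis.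
From mathcomp Require Import complex.
Import Order.TTheory GRing.Theory Num.Theory.
Import numFieldNormedType.Exports.
Set Implicit Arguments.
Unset Strict Implicit.
Unset Printing Implicit Defensive.
Local Open Scope classical_set_scope.
Local Open Scope ring_scope.
Local Open Scope complex_scope.

Section WeightedHardy.
Variable R : realType.
Local Notation C := ((R[i])^o).

Definition cabs (z : C) : R := Normc.normc (z : R[i]).

Definition expi (t : R) : C := (cos t +i* sin t).

Definition wgt (beta : R) (z : C) : R := cabs (z - 1) `^ beta.

Definition holo_at (f : C -> C) (z : C) : Prop :=
  cvg ((fun h : C => (f (z + h) - f z) / h) @ 0^').

Definition holo_disc (f : C -> C) : Prop :=
  forall z : C, cabs z < 1 -> holo_at f z.

Definition circ : set R := `[0, 2 * pi].

Definition Tint (g : R -> R) : \bar R :=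
  (\int[lebesgue_measure]_(t in circ) (g t)%:E)%E.

Definition Hp (p beta : R) (f : C -> C) : Prop :=
  holo_disc f /\
  exists M : R, forall r : R, 0 <= r < 1 ->
    (Tint (fun t => cabs (f (r%:C * expi t)) `^ p * wgt beta (r%:C * expi t))%R
       <= M%:E)%E.

Definition bv (f : C -> C) (t : R) : C :=
  lim ((fun r : R => f (r%:C * expi t)) @ 1^'-).

Definition Hnorm (p beta : R) (f : C -> C) : R :=
  fine (Tint (fun t => cabs (bv f t) `^ p * wgt beta (expi t))) `^ p^-1.

Definition cint (g : R -> C) : C :=
  (Rintegral lebesgue_measure circ (fun t => complex.Re (g t : R[i])))%:C
  + 'i * (Rintegral lebesgue_measure circ
            (fun t => complex.Im (g t : R[i])))%:C.

Definition pairing (alpha : R) (f h : C -> C) : C :=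
  cint (fun t => bv f t * conjc (bv h t : R[i]) * (wgt (2 * alpha) (expi t))%:C).

Definition linear_on (S : (C -> C) -> Prop) (L : (C -> C) -> C) : Prop :=
  forall (f g : C -> C) (a b : C), S f -> S g ->
    L (fun z => a * f z + b * g z) = a * L f + b * L g.

Definition bounded_on (S : (C -> C) -> Prop) (N : (C -> C) -> R)
  (L : (C -> C) -> C) : Prop :=
  exists K : R, forall f, S f -> cabs (L f) <= K * N f.

End WeightedHardy.

(* Main.v *)
(* Multiplication by the holomorphic function (1 - z)^alpha, of modulus |1 - z|^alpha, maps
   H^p(|z - 1|^(alpha p)) isometrically onto the unweighted H^p and turns the pairing into the
   plain L^2 pairing on the circle. For F in H^p the dilates F_r are Cauchy in L^p by uniform
   convexity, their limit F* is the a.e. radial limit since F is its Poisson integral, and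
   Hoelder's inequality bounds the pairing. Conversely, a bounded functional L determines
   c_n = L((1 - z)^(-alpha) z^n), and the candidate is H = sum_n conj(c_n) z^n / (2 pi). Testing L
   against the analytic projection of |H_r|^(q-2) H_r, which is bounded on L^p by M. Riesz's
   theorem, bounds H_r in L^q uniformly in r. Finally L and the pairing with H agree on
   monomials, hence everywhere, because polynomials are dense in H^p.

   Riesz's theorem for 1 < p <= 2 integrates the inequality |w|^p <= A (Re w)^p - B Re(w^p), valid
   for Re w > 0, along the Herglotz transform of a positive function; p > 2 follows by duality. *)
Require Import Defs.
From HB Require Import structures.
From mathcomp Require Import all_boot all_order all_algebra.
From mathcomp Require Import all_classical all_reals all_analysis.
From mathcomp Require Import complex measurable_realfun ring lra.
Import Order.TTheory GRing.Theory Num.Theory.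
Import numFieldNormedType.Exports.
Set Implicit Arguments.
Unset Strict Implicit.
Unset Printing Implicit Defensive.
Local Open Scope classical_set_scope.
Local Open Scope ring_scope.
Local Open Scope complex_scope.

(** [bv] is a bare [lim]: nothing makes it measurable, and where the radial limit fails its value
    means nothing. So a measurable [u] is built as the L^p limit of the dilates, identified with the
    radial limit almost everywhere, and put in place of [bv] inside integrals by [integral_ae_any].
    This is why Poisson integrals at Lebesgue points come before any norm or pairing is evaluated.

    The only holomorphic input is Goursat on a rectangle, pulled back by the exponential. It makes
    the circle means of F / z^n independent of the radius; the Taylor expansion then follows from
    the Poisson integral at points of continuity.

    Estimates stay at the level of integrals of p-th powers. Three inequalities do the work: (x +
    y)^p <= 2^p (x^p + y^p), Young with a free parameter, and x <= c + c^(1-p) x^p, which turns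
    smallness in L^p into smallness in L^1.

    [L] is defined on analytic functions only, whereas |H_r|^(q-2) H_r is not analytic. Projecting
    it leaves its pairing with H_r unchanged up to dilation, as H_r has no negative frequencies; the
    cost is the constant of Riesz's theorem. *)

Local Notation nm := Normc.normc.

(** * Complex numbers and complex derivatives *)

Section ComplexBasics.
Context {R : realType}.
Local Notation C := R[i].
Implicit Types (x y t : R) (z w : C).

Lemma nmE z : nm z = Num.sqrt (complex.Re z ^+ 2 + complex.Im z ^+ 2).
Proof. by case: z. Qed.

Lemma nm_ge0 z : 0 <= nm z.
Proof. by rewrite nmE sqrtr_ge0. Qed.

Lemma nm0 : nm (0 : C) = 0. Proof. exact: Normc.normc0. Qed.
Lemma nm1 : nm (1 : C) = 1. Proof. exact: Normc.normc1. Qed.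
Lemma nmM z w : nm (z * w) = nm z * nm w. Proof. exact: Normc.normcM. Qed.
Lemma nmV z : nm z^-1 = (nm z)^-1. Proof. exact: Normc.normcV. Qed.
Lemma nmD z w : nm (z + w) <= nm z + nm w. Proof. exact: le_normcD. Qed.
Lemma nmN z : nm (- z) = nm z. Proof. exact: normcN. Qed.
Lemma nmB z w : nm (z - w) <= nm z + nm w.
Proof. by rewrite -(nmN w) nmD. Qed.
Lemma nm_distC z w : nm (z - w) = nm (w - z).
Proof. by rewrite -nmN opprB. Qed.
Lemma nm_eq0 z : (nm z == 0) = (z == 0).
Proof.
by apply/eqP/eqP => [/Normc.eq0_normc //|->]; rewrite nm0.
Qed.
Lemma nm_gt0 z : (0 < nm z) = (z != 0).
Proof. by rewrite lt0r nm_eq0 nm_ge0 andbT. Qed.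
Lemma nmX z n : nm (z ^+ n) = nm z ^+ n.
Proof. by elim: n => [|n IH]; rewrite ?expr0 ?nm1// !exprS nmM IH. Qed.
Lemma nmR x : nm x%:C = `|x|.
Proof. by rewrite nmE /= expr0n addr0 sqrtr_sqr. Qed.
Lemma nm2 : nm (2 : C) = 2.
Proof. by have := nmR (2 : R); rewrite rmorph_nat => ->; rewrite normr_nat. Qed.
Lemma nm_conj z : nm (conjc z) = nm z.
Proof. by rewrite !nmE; case: z => a b /=; rewrite sqrrN. Qed.
Lemma nm_sqr z : nm z ^+ 2 = complex.Re z ^+ 2 + complex.Im z ^+ 2.
Proof. by rewrite nmE sqr_sqrtr// addr_ge0// sqr_ge0. Qed.
Lemma Re_le_nm z : `|complex.Re z| <= nm z.
Proof.
by rewrite -sqrtr_sqr nmE ler_sqrt ?addr_ge0 ?sqr_ge0// lerDl sqr_ge0.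
Qed.
Lemma Im_le_nm z : `|complex.Im z| <= nm z.
Proof.
by rewrite -sqrtr_sqr nmE ler_sqrt ?addr_ge0 ?sqr_ge0// lerDr sqr_ge0.
Qed.
Lemma nm_leD z : nm z <= `|complex.Re z| + `|complex.Im z|.
Proof.
rewrite {1}(complexE z); apply: le_trans (nmD _ _) _.
rewrite nmM !nmR lerD2l nmE /= expr0n expr1n add0r sqrtr1 mul1r.
by [].
Qed.
Lemma nm_i : nm ('i : C) = 1.
Proof. by rewrite nmE /= expr0n expr1n add0r sqrtr1. Qed.
Lemma nm_tri z w u : nm (z - u) <= nm (z - w) + nm (w - u).
Proof. by rewrite -[z - u](subrKA w) nmD. Qed.
Lemma nm_lerB z w : nm z - nm w <= nm (z - w).
Proof. by rewrite lerBlDr -{1}[z](subrK w) nmD. Qed.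
Lemma nm_dist z w : `|nm z - nm w| <= nm (z - w).
Proof.
by rewrite ler_norml nm_lerB andbT lerNl opprB nm_distC nm_lerB.
Qed.
Lemma nm_sum (I : Type) (r : seq I) (P : pred I) (F : I -> C) :
  nm (\sum_(i <- r | P i) F i) <= \sum_(i <- r | P i) nm (F i).
Proof.
elim/big_ind2 : _ => //; first by rewrite nm0.
by move=> a b c d ab cd; rewrite (le_trans (nmD _ _))// lerD.
Qed.

Lemma ReD z w : complex.Re (z + w) = complex.Re z + complex.Re w.
Proof. by case: z; case: w. Qed.
Lemma ImD z w : complex.Im (z + w) = complex.Im z + complex.Im w.
Proof. by case: z; case: w. Qed.
Lemma ReN z : complex.Re (- z) = - complex.Re z. Proof. by case: z. Qed.
Lemma ImN z : complex.Im (- z) = - complex.Im z. Proof. by case: z. Qed.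
Lemma ReM z w : complex.Re (z * w) =
  complex.Re z * complex.Re w - complex.Im z * complex.Im w.
Proof. by case: z; case: w. Qed.
Lemma ImM z w : complex.Im (z * w) =
  complex.Re z * complex.Im w + complex.Im z * complex.Re w.
Proof. by case: z; case: w. Qed.
Lemma Re_conj z : complex.Re (conjc z) = complex.Re z. Proof. by case: z. Qed.
Lemma Im_conj z : complex.Im (conjc z) = - complex.Im z. Proof. by case: z. Qed.
Lemma complex_eqP z w : complex.Re z = complex.Re w ->
  complex.Im z = complex.Im w -> z = w.
Proof. by case: z; case: w => a b c d /= -> ->. Qed.
Lemma mul_conj z : z * conjc z = (nm z ^+ 2)%:C.
Proof.
apply: complex_eqP; rewrite ?ReM ?ImM Re_conj Im_conj ?nm_sqr /=; ring.
Qed.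

Lemma expiD x y : expi (x + y) = expi x * expi y :> C.
Proof.
apply: complex_eqP; rewrite ?ReM ?ImM /= ?cosD ?sinD// addrC.
by [].
Qed.
Lemma expi0 : expi 0 = 1 :> C.
Proof. by apply: complex_eqP; rewrite /= ?cos0 ?sin0. Qed.
Lemma nm_expi x : nm (expi x) = 1.
Proof. by rewrite nmE /= cos2Dsin2 sqrtr1. Qed.
Lemma expi_neq0 x : expi x != 0 :> C.
Proof. by rewrite -nm_eq0 nm_expi oner_eq0. Qed.
Lemma conj_expi x : conjc (expi x) = expi (- x) :> C.
Proof. by apply: complex_eqP; rewrite /= ?cosN ?sinN. Qed.
Lemma expiN x : expi (- x) = (expi x)^-1 :> C.
Proof.
by apply: (mulfI (expi_neq0 x)); rewrite -expiD subrr expi0 mulfV ?expi_neq0.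
Qed.
Lemma expi2pi : expi (2 * pi) = 1 :> C.
Proof.
apply: complex_eqP; rewrite /= mulr_natl ?cos2pi ?sin2pi//.
Qed.
Lemma expiD2pi x : expi (x + 2 * pi) = expi x :> C.
Proof. by rewrite expiD expi2pi mulr1. Qed.

Definition cexp z : C := (expR (complex.Re z))%:C * expi (complex.Im z).
Lemma cexpD z w : cexp (z + w) = cexp z * cexp w.
Proof. by rewrite /cexp ReD ImD expRD expiD rmorphM; ring. Qed.
Lemma cexp0 : cexp 0 = 1.
Proof. by rewrite /cexp /= expR0 expi0 mulr1. Qed.
Lemma nm_cexp z : nm (cexp z) = expR (complex.Re z).
Proof. by rewrite nmM nmR nm_expi mulr1 ger0_norm// expR_ge0. Qed.
Lemma cexp_neq0 z : cexp z != 0.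
Proof. by rewrite -nm_gt0 nm_cexp expR_gt0. Qed.
Lemma cexpN z : cexp (- z) = (cexp z)^-1.
Proof.
by apply: (mulfI (cexp_neq0 z)); rewrite -cexpD subrr cexp0 mulfV ?cexp_neq0.
Qed.

(* The principal logarithm only for [0 < Re z], which covers [1 - z] on the disc. *)
Definition clog z : C := ln (nm z) +i* atan (complex.Im z / complex.Re z).

Lemma clogK z : 0 < complex.Re z -> cexp (clog z) = z.
Proof.
move=> z0; have nz : 0 < nm z.
  by rewrite nm_gt0; apply/eqP => z00; move: z0; rewrite z00 ltxx.
rewrite /cexp /= lnK ?posrE//.
set u := complex.Im z / complex.Re z.
have c0 : 0 < cos (atan u).
  by rewrite cos_gt0_pihalf// atan_gtNpi2 atan_ltpi2.
have su : sin (atan u) = cos (atan u) * u.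
  by rewrite -{3}[u]atanK /tan mulrC divfK// gt_eqF.
have n2 : (cos (atan u) * nm z) ^+ 2 = complex.Re z ^+ 2.
  rewrite exprMn nm_sqr.
  have -> : complex.Im z = u * complex.Re z by rewrite /u divfK// gt_eqF.
  have := cos2Dsin2 (atan u); rewrite su => h.
  rewrite -[RHS]mul1r -[in RHS]h; ring.
have e1 : cos (atan u) * nm z = complex.Re z.
  by apply/eqP; rewrite -(@eqrXn2 _ 2)// ?n2// ?mulr_ge0 ?ltW.
apply: complex_eqP; rewrite ?ReM ?ImM /= ?mul0r ?subr0 ?addr0 -?[X in _ = X]e1.
  by rewrite mulrC.
by rewrite su mulrCA mulrA e1 /u mulrC divfK// gt_eqF.
Qed.

End ComplexBasics.

Section ComplexDerivative.
Context {R : realType}.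
Local Notation C := R[i].
Implicit Types (x y t : R) (z w d : C) (f g : C -> C).

(** Differentiability without a quotient: [w = z] is no exception, and the chain rule needs no
    separate case [f w = f z]. *)
Definition cder f z d := forall e : R, 0 < e -> exists2 dl : R, 0 < dl &
  forall w, nm (w - z) < dl -> nm (f w - f z - d * (w - z)) <= e * nm (w - z).
Definition chol f z := exists d, cder f z d.

Lemma cder_lip f z d : cder f z d -> exists2 dl : R, 0 < dl &
  forall w, nm (w - z) < dl -> nm (f w - f z) <= (nm d + 1) * nm (w - z).
Proof.
move=> /(_ 1 ltr01)[dl dl0 h]; exists dl => // w wz.
have -> : f w - f z = (f w - f z - d * (w - z)) + d * (w - z) by rewrite subrK.
apply: le_trans (nmD _ _) _; rewrite nmM addrC mulrDl lerD2l.
exact: h.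
Qed.

Lemma cder_cont f z d : cder f z d -> forall e : R, 0 < e -> exists2 dl : R, 0 < dl &
  forall w, nm (w - z) < dl -> nm (f w - f z) < e.
Proof.
move=> /cder_lip[dl dl0 h] e e0.
have K0 : 0 < nm d + 1 by rewrite ltr_wpDl ?nm_ge0.
exists (Num.min dl (e / (nm d + 1))); first by rewrite lt_min dl0 divr_gt0.
move=> w; rewrite lt_min => /andP[w1 w2]; apply: le_lt_trans (h _ w1) _.
by rewrite mulrC -ltr_pdivlMr.
Qed.

Lemma cder_cst c z : cder (fun=> c) z 0.
Proof.
move=> e e0; exists 1 => // w _.
by rewrite subrr mul0r subr0 nm0 mulr_ge0 ?nm_ge0 ?ltW.
Qed.

Lemma cder_id z : cder id z 1.
Proof.
move=> e e0; exists 1 => // w _.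
by rewrite mul1r subrr nm0 mulr_ge0 ?nm_ge0 ?ltW.
Qed.

Lemma cderD f g z d1 d2 : cder f z d1 -> cder g z d2 ->
  cder (fun w => f w + g w) z (d1 + d2).
Proof.
move=> hf hg e e0.
have e20 : 0 < e / 2 by rewrite divr_gt0.
have [a a0 ha] := hf _ e20; have [b b0 hb] := hg _ e20.
exists (Num.min a b); first by rewrite lt_min a0.
move=> w; rewrite lt_min => /andP[wa wb].
have -> : f w + g w - (f z + g z) - (d1 + d2) * (w - z) =
  (f w - f z - d1 * (w - z)) + (g w - g z - d2 * (w - z)) by ring.
apply: le_trans (nmD _ _) _; rewrite [in leRHS](splitr e) mulrDl lerD ?ha ?hb//.
Qed.

Lemma cder_comp f g z d1 d2 : cder f z d1 -> cder g (f z) d2 ->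
  cder (fun w => g (f w)) z (d2 * d1).
Proof.
move=> hf hg e e0.
set K := nm d1 + 1; have K0 : 0 < K by rewrite ltr_wpDl ?nm_ge0.
set L := nm d2 + 1; have L0 : 0 < L by rewrite ltr_wpDl ?nm_ge0.
have [a a0 ha] := hf (e / 2 / L) ltac:(by rewrite !divr_gt0).
have [b b0 hb] := hg (e / 2 / K) ltac:(by rewrite !divr_gt0).
have [c c0 hc] := cder_lip hf.
exists (Num.min a (Num.min c (b / K))); first by rewrite !lt_min a0 c0 divr_gt0.
move=> w; rewrite !lt_min => /and3P[wa wc wb].
have fb : nm (f w - f z) < b.
  by apply: le_lt_trans (hc _ wc) _; rewrite mulrC -ltr_pdivlMr.
have -> : g (f w) - g (f z) - d2 * d1 * (w - z) =
  (g (f w) - g (f z) - d2 * (f w - f z)) + d2 * (f w - f z - d1 * (w - z)) by ring.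
apply: le_trans (nmD _ _) _; rewrite [in leRHS](splitr e) mulrDl nmM lerD//.
  apply: le_trans (hb _ fb) _.
  rewrite -mulrA ler_wpM2l ?divr_ge0 ?(ltW e0)// ler_pdivrMl//.
  exact: hc.
apply: (@le_trans _ _ (nm d2 * (e / 2 / L * nm (w - z)))).
  by rewrite ler_wpM2l ?nm_ge0 ?ha.
rewrite mulrA ler_wpM2r ?nm_ge0// mulrCA ler_piMr ?divr_ge0 ?ltW//.
by rewrite ltr_pdivrMr// mul1r ltrDl.
Qed.

Lemma cder_sqr z : cder (fun w => w * w) z (2 * z).
Proof.
move=> e e0; exists e => // w we.
have -> : w * w - z * z - 2 * z * (w - z) = (w - z) * (w - z) by ring.
by rewrite nmM ler_wpM2r ?nm_ge0 ?ltW.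
Qed.

Lemma cderZ c f z d : cder f z d -> cder (fun w => c * f w) z (c * d).
Proof.
move=> hf; apply: (@cder_comp f (fun w => c * w) z d c) => //.
move=> e e0; exists 1 => // w _.
by rewrite -mulrBr subrr nm0 mulr_ge0 ?nm_ge0 ?ltW.
Qed.

(* Polarization reduces products to squares. *)
Lemma cderM f g z d1 d2 : cder f z d1 -> cder g z d2 ->
  cder (fun w => f w * g w) z (d1 * g z + f z * d2).
Proof.
move=> hf hg.
have h1 := cder_comp (cderD hf hg) (cder_sqr (f z + g z)).
have h2 := cder_comp (cderD hf (cderZ (-1) hg)) (cder_sqr (f z + (-1) * g z)).
have := cderZ (4^-1) (cderD h1 (cderZ (-1) h2)).
have -> : (fun w => 4^-1 * ((f w + g w) * (f w + g w) +
   -1 * ((f w + -1 * g w) * (f w + -1 * g w)))) = (fun w => f w * g w).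
  by apply/funext => w; field.
set u := (X in cder _ z X); set v := (X in _ -> cder _ z X).
by have -> : u = v; rewrite // /u /v; field.
Qed.

Lemma cder_inv z : z != 0 -> cder (fun w => w^-1) z (- (z ^- 2)).
Proof.
move=> z0 e e0; have nz : 0 < nm z by rewrite nm_gt0.
exists (Num.min (nm z / 2) (e * (nm z ^+ 3) / 2)).
  by rewrite lt_min !divr_gt0 ?mulr_gt0 ?exprn_gt0.
move=> w; rewrite lt_min => /andP[w1 w2].
have nw : nm z / 2 < nm w.
  have := nm_lerB z w; rewrite nm_distC; lra.
have w0 : w != 0 by rewrite -nm_gt0 (lt_trans _ nw)// divr_gt0.
have -> : w^-1 - z^-1 - (- z ^- 2) * (w - z) = (w - z) / w / z ^+ 2 * (w - z).
  by field; rewrite ?w0 ?z0.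
rewrite nmM ler_wpM2r ?nm_ge0// !nmM !nmV nmX -mulrA -invfM ler_pdivrMr; last first.
  by rewrite mulr_gt0 ?exprn_gt0// nm_gt0.
apply: le_trans (ltW w2) _.
rewrite -!mulrA ler_wpM2l ?(ltW e0)//.
have -> : nm z * (nm z * (nm z / 2)) = nm z / 2 * nm z ^+ 2 by ring.
by rewrite ler_wpM2r ?exprn_ge0 ?nm_ge0 ?(ltW nw).
Qed.

Lemma cderX n z : cder (fun w => w ^+ n) z (n%:R * z ^+ n.-1).
Proof.
elim: n => [|n IH]; first by rewrite mul0r; exact: cder_cst.
have := cderM (cder_id z) IH.
have -> : (fun w => w * w ^+ n) = (fun w => w ^+ n.+1).
  by apply/funext => w; rewrite exprS.
have -> // : 1 * z ^+ n + z * (n%:R * z ^+ n.-1) = n.+1%:R * z ^+ n.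
case: n {IH} => [|n]; first by rewrite mul0r mulr0 addr0.
by rewrite /= mulrCA -exprS -mulrDl nat1r.
Qed.

Lemma is_derive_eps (f : R -> R) (d : R) : is_derive (0 : R) 1 f d ->
  forall e : R, 0 < e -> exists2 dl : R, 0 < dl &
    forall h, `|h| < dl -> `|f h - f 0 - d * h| <= e * `|h|.
Proof.
move=> [df <-] e e0.
have := df; rewrite /derivable => /cvgrPdist_le /(_ e e0).
rewrite -[lim _]/('D_1 f (0 : R)).
move=> /nbhs_ballP[dl /= dl0 h]; exists dl => // y yd.
have [->|y0] := eqVneq y 0; first by rewrite mulr0 subrr subr0 normr0 mulr0.
have := h y; rewrite /ball /= sub0r normrN => /(_ yd y0).
rewrite addr0 [_%:A]mulr1 => hh.
have -> : f y - f 0 - 'D_1 f 0 * y = - (('D_1 f 0 - y^-1 *: (f y - f 0)) * y).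
  rewrite mulrBl [_ *: _]mulrC divfK//; ring.
by rewrite normrN normrM ler_wpM2r.
Qed.

(** The real derivatives of [expR], [cos] and [sin] at 0 suffice; the functional equation moves the
    estimate to every point in [cder_cexp]. *)
Lemma cder_cexp0 : cder (@cexp R) 0 1.
Proof.
move=> e e0.
have e8 : 0 < e / 8 by rewrite divr_gt0.
have dexp : is_derive (0 : R) 1 (@expR R) 1.
  by have := @is_derive_expR R 0; rewrite expR0.
have dcos : is_derive (0 : R) 1 (@cos R) 0.
  by have := @is_derive_cos R 0; rewrite sin0 oppr0.
have dsin : is_derive (0 : R) 1 (@sin R) 1.
  by have := @is_derive_sin R 0; rewrite cos0.
have [a a0 ha] := is_derive_eps dexp e8.
have [b b0 hb] := is_derive_eps dcos e8.
have [c c0 hc] := is_derive_eps dsin e8.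
exists (Num.min (Num.min a b) (Num.min c (Num.min 1 (e / 8)))).
  by rewrite !lt_min a0 b0 c0 ltr01 e8.
move=> w; rewrite subr0 !lt_min => /andP[/andP[wa wb] /and3P[wc w1 we]].
have xw := Re_le_nm w; have yw := Im_le_nm w.
set x := complex.Re w in xw *; set y := complex.Im w in yw *.
have {}ha := ha x (le_lt_trans xw wa).
have {}hb := hb y (le_lt_trans yw wb).
have {}hc := hc y (le_lt_trans yw wc).
rewrite expR0 mul1r in ha; rewrite cos0 mul0r subr0 in hb.
rewrite sin0 subr0 mul1r in hc.
rewrite cexp0 mul1r.
have wE : w = x%:C + 'i * y%:C := complexE w.
(* Each summand is small for one reason: the derivative of [expR], that of [expi], and the
   second-order product [x y]. They cost e/8, 4e/8 and e/8 times [nm w]. *)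
have -> : cexp w - 1 - w = (expR x - 1 - x)%:C * expi y +
   ((1 + x)%:C * (expi y - 1 - 'i * y%:C) + x%:C * ('i * y%:C)).
  by rewrite {2}wE /cexp -/x -/y !rmorphB !rmorphD rmorph1; ring.
have nE : nm (expi y - 1 - 'i * y%:C) <= e / 8 * nm w + e / 8 * nm w.
  apply: le_trans (nm_leD _) _; rewrite !ReD !ImD !ReN !ImN /=.
  rewrite !mul0r !mul1r !subr0 add0r; apply: lerD.
    by apply: le_trans hb _; rewrite ler_wpM2l// ltW.
  by apply: le_trans hc _; rewrite ler_wpM2l// ltW.
apply: le_trans (nmD _ _) _.
rewrite nmM nmR nm_expi mulr1.
have t1 : `|expR x - 1 - x| <= e / 8 * nm w.
  by apply: le_trans ha _; rewrite ler_wpM2l// ltW.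
have t2 : nm ((1 + x)%:C * (expi y - 1 - 'i * y%:C)) <= 2 * (e / 8 * nm w + e / 8 * nm w).
  rewrite nmM nmR ler_pM// ?nm_ge0//.
  apply: le_trans (ler_normD _ _) _; rewrite normr1.
  by have : `|x| <= 1; [exact: le_trans xw (ltW w1)|lra].
have t3 : nm (x%:C * ('i * y%:C)) <= e / 8 * nm w.
  rewrite !nmM nm_i mul1r !nmR ler_pM//.
  exact: le_trans xw (ltW we).
have := nmD ((1 + x)%:C * (expi y - 1 - 'i * y%:C)) (x%:C * ('i * y%:C)).
have : 0 <= e * nm w by rewrite mulr_ge0 ?nm_ge0 ?ltW.
set P := nm (_ + _); move: t1 t2 t3; lra.
Qed.

Lemma cder_cexp z : cder (@cexp R) z (cexp z).
Proof.
have h1 : cder (fun w => w - z) z 1.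
  by have := cderD (cder_id z) (cder_cst (- z) z); rewrite addr0.
have h2 : cder (@cexp R) (z - z) 1 by rewrite subrr; exact: cder_cexp0.
have := cderZ (cexp z) (cder_comp h1 h2); rewrite !mulr1.
have -> // : (fun w => cexp z * cexp (w - z)) = @cexp R.
by apply/funext => w; rewrite -cexpD addrC subrK.
Qed.

End ComplexDerivative.

Section RealLemmas.
Context {R : realType}.
Implicit Types (x y : R) (f : R -> R).

Lemma continuous_eps f x : {for x, continuous f} -> forall e : R, 0 < e ->
  exists2 dl : R, 0 < dl & forall y, `|y - x| < dl -> `|f y - f x| < e.
Proof.
move=> /cvgrPdist_lt fx e /fx /nbhs_ballP[dl /= dl0 h].
by exists dl => // y yx; rewrite distrC; apply: h; rewrite /ball /= distrC.
Qed.

Lemma eps_continuous f x : (forall e : R, 0 < e ->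
  exists2 dl : R, 0 < dl & forall y, `|y - x| < dl -> `|f y - f x| <= e) ->
  {for x, continuous f}.
Proof.
move=> h; apply/cvgrPdist_le => e /h[dl dl0 hd].
apply/nbhs_ballP; exists dl => //= y; rewrite /ball /= distrC => yx.
by rewrite distrC; exact: hd.
Qed.

(** Each of the n terms of 1 + q + ... + q^(n-1) is at least q^n; the induction runs on this sum
    multiplied by 1 - q. *)
Lemma nat_geo (q : R) n : 0 <= q < 1 -> n%:R * q ^+ n <= (1 - q)^-1.
Proof.
move=> /andP[q0 q1]; have d0 : 0 < 1 - q by rewrite subr_gt0.
rewrite -[leRHS]mul1r ler_pdivlMr//.
suff : n%:R * q ^+ n * (1 - q) <= 1 - q ^+ n.
  by move=> /le_trans; apply; rewrite gerBl exprn_ge0.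
elim: n => [|n IH]; first by rewrite expr0 subrr !mul0r.
have := ler_wpM2r q0 IH; rewrite -natr1 exprSr.
have : q ^+ n <= 1 by rewrite exprn_ile1// ltW.
have : 0 <= q ^+ n by rewrite exprn_ge0.
move=> a0 a1 h.
have : 0 <= (1 - q) * (1 - q ^+ n * q).
  by rewrite mulr_ge0 ?(ltW d0)// subr_ge0 mulr_ile1// ltW.
move: h; move: (q ^+ n) (n%:R : R) => a b; lra.
Qed.

Lemma geo_series_tail (u : R^nat) (M q : R) : 0 <= q < 1 ->
  (forall k, `|u k| <= M * q ^+ k) ->
  forall n, `|lim (series u @ \oo) - series u n| <= M * q ^+ n / (1 - q).
Proof.
move=> /andP[q0 q1] hu n; have d0 : 0 < 1 - q by rewrite subr_gt0.
have M0 : 0 <= M.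
  by have := hu 0%N; rewrite expr0 mulr1; exact: le_trans.
have cu : cvgn (series u).
  apply: normed_cvg; apply: (@series_le_cvg _ _ (geometric M q)) => //.
  - by move=> k; rewrite normr_ge0.
  - by move=> k; rewrite mulr_ge0// exprn_ge0.
  - by apply: is_cvg_geometric_series; rewrite ger0_norm.
have tail m : (n <= m)%N -> `|series u m - series u n| <= M * q ^+ n / (1 - q).
  move=> nm; suff : `|series u m - series u n| <= M * (q ^+ n - q ^+ m) / (1 - q).
    move/le_trans; apply; rewrite ler_wpM2r ?invr_ge0 ?(ltW d0)//.
    by rewrite ler_wpM2l// gerBl exprn_ge0.
  rewrite -(subnK nm); elim: (m - n)%N => [|k IH].
    by rewrite add0n !subrr normr0 mulr0 mul0r.
  rewrite addSn seriesSr.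
  rewrite [_ + _ - _]addrAC; apply: le_trans (ler_normD _ _) _.
  apply: le_trans (lerD IH (hu _)) _.
  rewrite le_eqVlt; apply/orP; left; apply/eqP.
  rewrite [in RHS]exprSr; field; lra.
have h1 : (fun m => `|series u m - series u n|) @ \oo -->
   `|lim (series u @ \oo) - series u n|.
  apply: cvg_norm; apply: cvgB => //; exact: cvg_cst.
rewrite -(cvg_lim _ h1)//; apply: limr_le; first by apply/cvg_ex; eexists; exact: h1.
by near=> m; apply: tail; near: m; exact: nbhs_infty_ge.
Unshelve. all: by end_near. Qed.

End RealLemmas.

(** * Power series and complex powers *)

Section PowerSeries.
Context {R : realType}.
Local Notation C := R[i].
Implicit Types (z w : C) (a u : nat -> C).

Definition csum u : C := lim (series (fun n => complex.Re (u n)) @ \oo) +i*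
  lim (series (fun n => complex.Im (u n)) @ \oo).

Lemma Re_sum u n : complex.Re (\sum_(k < n) u k) = \sum_(k < n) complex.Re (u k).
Proof. by elim/big_ind2 : _ => // ? ? ? ? <- <-; rewrite ReD. Qed.
Lemma Im_sum u n : complex.Im (\sum_(k < n) u k) = \sum_(k < n) complex.Im (u k).
Proof. by elim/big_ind2 : _ => // ? ? ? ? <- <-; rewrite ImD. Qed.

Lemma csum_tail u (M q : R) : 0 <= q < 1 ->
  (forall k, nm (u k) <= M * q ^+ k) ->
  forall n, nm (csum u - \sum_(k < n) u k) <= 2 * M * q ^+ n / (1 - q).
Proof.
move=> q01 hu n; apply: le_trans (nm_leD _) _.
rewrite ReD ImD ReN ImN Re_sum Im_sum /=.
have h1 := geo_series_tail q01 (fun k => le_trans (Re_le_nm _) (hu k)) n.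
have h2 := geo_series_tail q01 (fun k => le_trans (Im_le_nm _) (hu k)) n.
move: h1 h2; rewrite /series /= !big_mkord => h1 h2.
apply: le_trans (lerD h1 h2) _.
by rewrite -!mulrA mulr_natl mulr2n.
Qed.

(** Equalities of complex numbers are mostly proved by this, with [x] the modulus of a difference.
    The free constant [K] spares the normalisation of error terms. *)
Lemma le0_eps (x K : R) : (forall e, 0 < e -> x <= K * e) -> x <= 0.
Proof.
move=> h; rewrite leNgt; apply/negP => x0.
have [K0|K0] := leP K 0.
  by have := h 1 ltr01; rewrite mulr1; lra.
have := h (x / 2 / K) ltac:(by rewrite !divr_gt0).
rewrite mulrC divfK ?gt_eqF//; lra.
Qed.

Lemma geo_small (K q e : R) : 0 <= q < 1 -> 0 < e ->
  exists N, forall n, (N <= n)%N -> K * q ^+ n < e.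
Proof.
move=> /andP[q0 q1] e0.
have : (fun n => K * q ^+ n) @ \oo --> (0 : R).
  rewrite -[0](mulr0 K); apply: cvgM; first exact: cvg_cst.
  by apply: cvg_expr; rewrite ger0_norm.
move=> /cvgrPdist_lt /(_ e e0)[N _ h]; exists N => n Nn.
by have := h n Nn; rewrite /= sub0r normrN => /ltr_normlW.
Qed.

Lemma csum_unique u (M q : R) (l : C) : 0 <= q < 1 ->
  (forall k, nm (u k) <= M * q ^+ k) ->
  (forall e : R, 0 < e -> exists N, forall n, (N <= n)%N ->
    nm (l - \sum_(k < n) u k) <= e) -> csum u = l.
Proof.
move=> q01 hu hl; apply/eqP; rewrite -subr_eq0 -nm_eq0 eq_le nm_ge0 andbT.
apply: (@le0_eps _ 2) => e e0.
have [N hN] := hl _ e0; have [N' hN'] := geo_small (2 * M / (1 - q)) q01 e0.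
pose n := maxn N N'.
have h1 := hN n (leq_maxl _ _); have h2 := hN' n (leq_maxr _ _).
have h3 := csum_tail q01 hu n.
apply: le_trans (nm_tri _ (\sum_(k < n) u k) _) _.
rewrite (nm_distC _ l) mulr_natl mulr2n lerD//.
apply: le_trans h3 _; apply: le_trans (ltW h2).
by rewrite le_eqVlt; apply/orP; left; apply/eqP; ring.
Qed.

(** Abel's form of a radius of convergence at least 1: bounded terms at every smaller radius, which
    [pbd_geo] upgrades to geometric decay. *)
Definition pbd a := forall r : R, 0 <= r < 1 ->
  exists M : R, forall n, nm (a n) * r ^+ n <= M.
Definition psum a z := csum (fun n => a n * z ^+ n).

Lemma pbd_geo a (r : R) : pbd a -> 0 <= r < 1 -> exists M q : R,
  [/\ 0 <= M, 0 <= q < 1 & forall z, nm z <= r -> forall n, nm (a n * z ^+ n) <= M * q ^+ n].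
Proof.
move=> ha /andP[r0 r1].
pose s := (1 + r) / 2; have s1 : 0 <= s < 1 by rewrite /s; apply/andP; split; lra.
have s0 : 0 < s by rewrite /s; lra.
have [M hM] := ha s s1; exists M, (r / s); split.
- by apply: le_trans (hM 0%N); rewrite expr0 mulr1 nm_ge0.
- by rewrite divr_ge0 ?(ltW s0)//= ltr_pdivrMr// mul1r /s; lra.
move=> z zr n; rewrite nmM nmX exprMn exprVn mulrA.
rewrite mulrAC ler_pM ?mulr_ge0 ?exprn_ge0 ?nm_ge0//; last first.
  by rewrite lerXn2r ?nnegrE ?nm_ge0.
by rewrite ler_pdivlMr ?exprn_gt0.
Qed.

Lemma psum_tail a (r : R) : pbd a -> 0 <= r < 1 -> forall e : R, 0 < e ->
  exists N, forall n, (N <= n)%N -> forall z, nm z <= r ->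
   nm (psum a z - \sum_(k < n) a k * z ^+ k) <= e.
Proof.
move=> ha r01 e e0; have [M [q [M0 q01 h]]] := pbd_geo ha r01.
have [N hN] := geo_small (2 * M / (1 - q)) q01 e0.
exists N => n Nn z zr; apply: le_trans (csum_tail q01 (h z zr) n) _.
by apply: le_trans (ltW (hN n Nn)); rewrite le_eqVlt; apply/orP; left; apply/eqP; ring.
Qed.

Lemma psum0 a : pbd a -> psum a 0 = a 0%N.
Proof.
move=> ha.
have r01 : 0 <= (0 : R) < 1 by rewrite lexx ltr01.
have [M [q [M0 q01 h]]] := pbd_geo ha r01.
apply: (csum_unique q01 (h 0 ltac:(by rewrite nm0))) => e e0.
exists 1%N => -[//|n] _; rewrite big_ord_recl expr0 mulr1 big1 ?addr0 ?subrr ?nm0 ?ltW//.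
by move=> i _; rewrite exprS mul0r mulr0.
Qed.

(* Division-free second-order Taylor bound, uniform in [n], for termwise differentiation. *)
Lemma powdiff_bound z w (r : R) n : nm z <= r -> nm w <= r ->
  nm (w ^+ n - z ^+ n - n%:R * z ^+ n.-1 * (w - z)) * r ^+ 2
   <= n%:R ^+ 2 * r ^+ n * nm (w - z) ^+ 2.
Proof.
move=> zr wr; have r0 : 0 <= r by exact: le_trans (nm_ge0 _) zr.
elim: n => [|n IH].
  by rewrite !expr0 subrr !mul0r subr0 nm0 expr0n /= !mul0r.
have E : w ^+ n.+1 - z ^+ n.+1 - n.+1%:R * z ^+ n * (w - z) =
   w * (w ^+ n - z ^+ n - n%:R * z ^+ n.-1 * (w - z)) +
   n%:R * z ^+ n.-1 * (w - z) ^+ 2.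
  case: n {IH} => [|n]; first by rewrite !expr1 !expr0; ring.
  by rewrite /= -!natr1 !exprS; ring.
rewrite /= E; apply: le_trans (ler_wpM2r (exprn_ge0 2 r0) (nmD _ _)) _.
rewrite mulrDl nmM -[nm w * _ * _]mulrA.
set D := nm (w ^+ n - _ - _) in IH *; set d := nm (w - z) ^+ 2 in IH *.
have h1 : nm w * (D * r ^+ 2) <= r * (n%:R ^+ 2 * r ^+ n * d).
  by rewrite ler_pM ?nm_ge0// mulr_ge0 ?nm_ge0// exprn_ge0.
have d0 : 0 <= d by rewrite exprn_ge0 ?nm_ge0.
have h2 : nm (n%:R * z ^+ n.-1 * (w - z) ^+ 2) * r ^+ 2 <= n%:R * r ^+ n.+1 * d.
  case: n {IH h1 E D} => [|n]; first by rewrite !mul0r nm0 !mul0r.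
  rewrite !nmM !nmX -/d /=; have -> : nm (n.+1%:R : C) = n.+1%:R.
    by rewrite -(rmorph_nat (real_complex R)) nmR ger0_norm.
  rewrite -expr2 -/d.
  have -> : n.+1%:R * r ^+ n.+2 * d = n.+1%:R * r ^+ n * d * r ^+ 2.
    by rewrite !exprS expr0; ring.
  rewrite ler_wpM2r ?exprn_ge0// ler_wpM2r// ler_wpM2l//.
  by rewrite lerXn2r ?nnegrE ?nm_ge0.
apply: le_trans (lerD h1 h2) _; rewrite -natr1.
have rn : 0 <= r ^+ n.+1 * d by apply: mulr_ge0 => //; exact: exprn_ge0.
rewrite exprS in rn *; move: (n%:R : R) (ler0n R n) (r ^+ n) rn => N N0 Rn rn.
nra.
Qed.

Lemma psum_cder a z : pbd a -> nm z < 1 -> chol (psum a) z.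
Proof.
move=> ha z1; pose s := 1 - (1 - nm z) / 8.
have z0 := nm_ge0 z.
have s0 : 0 < s by rewrite /s; lra.
have s1 : s < 1 by rewrite /s; lra.
have s01 : 0 <= s < 1 by rewrite ltW.
(* The fourth power leaves room for termwise differentiation: one factor s^n pays for the
   coefficient bound M / s^n, two absorb n^2 through [nat_geo], and the last keeps the sum
   geometric. The 8 in [s] keeps s^4 above [nm z]. *)
pose r := s ^+ 4.
have zr : nm z < r.
  rewrite /r; have -> : s ^+ 4 = (s ^+ 2) ^+ 2 by rewrite -exprM.
  have h2 : 1 - (1 - nm z) / 4 <= s ^+ 2 by rewrite /s; nra.
  have : 1 - (1 - nm z) / 2 <= (s ^+ 2) ^+ 2 by nra.
  lra.
have r0 : 0 < r by rewrite exprn_gt0.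
have r1 : r < 1 by rewrite exprn_ilt1// ltW.
have r01 : 0 <= r < 1 by rewrite ltW.
have [M hM] := ha s s01.
have M0 : 0 <= M by apply: le_trans (hM 0%N); rewrite expr0 mulr1 nm_ge0.
have an n : nm (a n) <= M / s ^+ n by rewrite ler_pdivlMr ?exprn_gt0.
have ss0 : 0 < 1 - s by rewrite subr_gt0.
have rn n : r ^+ n / s ^+ n = s ^+ n * (s ^+ n * s ^+ n).
  rewrite /r -exprM mulnC exprM -!exprD [in LHS](_ : 4 = 3 + 1)%N//.
  rewrite -!exprM exprD; have : s ^+ n != 0 by rewrite expf_neq0 ?gt_eqF.
  move=> sn; rewrite mulnDr muln1 exprD mulfK// mulnC.
  by rewrite -exprD; congr (_ ^+ _); rewrite !mulSn mul0n addn0.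

have tb w n : nm w <= r -> nm (a n * (w ^+ n - z ^+ n - n%:R * z ^+ n.-1 * (w - z)))
   <= (M / (1 - s) ^+ 2 / r ^+ 2 * nm (w - z) ^+ 2) * s ^+ n.
  move=> wr; have := powdiff_bound n (ltW zr) wr.
  rewrite nmM -ler_pdivlMr ?exprn_gt0// => h.
  apply: le_trans (ler_pM (nm_ge0 _) (nm_ge0 _) (an n) h) _.
  have g := nat_geo n s01.
  have g2 : (n%:R * s ^+ n) ^+ 2 <= ((1 - s)^-1) ^+ 2.
    by rewrite lerXn2r ?nnegrE ?mulr_ge0 ?exprn_ge0 ?invr_ge0 ?(ltW s0) ?(ltW ss0).
  have -> : M / s ^+ n * (n%:R ^+ 2 * r ^+ n * nm (w - z) ^+ 2 / r ^+ 2) =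
    (n%:R * s ^+ n) ^+ 2 * (M / r ^+ 2 * nm (w - z) ^+ 2 * s ^+ n).
    transitivity (M * (n%:R ^+ 2) * (r ^+ n / s ^+ n) * nm (w - z) ^+ 2 / r ^+ 2).
      by ring.
    by rewrite rn exprMn; ring.
  have -> : M / (1 - s) ^+ 2 / r ^+ 2 * nm (w - z) ^+ 2 * s ^+ n =
    ((1 - s)^-1) ^+ 2 * (M / r ^+ 2 * nm (w - z) ^+ 2 * s ^+ n).
    by rewrite exprVn; ring.
  by rewrite ler_wpM2r// !mulr_ge0 ?invr_ge0 ?exprn_ge0 ?nm_ge0 ?(ltW r0) ?(ltW s0).

pose b n := a n * (n%:R * z ^+ n.-1).
have bb n : nm (b n) <= M / r / (1 - s) * s ^+ n.
  rewrite /b; case: n => [|n].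
    by rewrite mul0r mulr0 nm0 expr0 mulr1 !divr_ge0 ?(ltW r0) ?(ltW ss0).
  rewrite !nmM nmX /=; have -> : nm (n.+1%:R : C) = n.+1%:R.
    by rewrite -(rmorph_nat (real_complex R)) nmR ger0_norm.
  apply: (@le_trans _ _ (M / s ^+ n.+1 * (n.+1%:R * r ^+ n))).
    rewrite ler_pM ?mulr_ge0 ?exprn_ge0 ?nm_ge0 ?an// ler_wpM2l//.
    by rewrite lerXn2r ?nnegrE ?nm_ge0 ?(ltW zr) ?(ltW r0).
  have -> : M / s ^+ n.+1 * (n.+1%:R * r ^+ n) =
    M / r * (n.+1%:R * s ^+ n.+1) * (s ^+ n.+1 * s ^+ n.+1).
    transitivity (M / r * n.+1%:R * (r ^+ n.+1 / s ^+ n.+1)).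
      rewrite (exprS r); field; rewrite expf_neq0 ?gt_eqF//=.
    by rewrite rn; ring.
  have g := nat_geo n.+1 s01.
  have Mr : 0 <= M / r by rewrite divr_ge0 ?(ltW r0).
  have sn0 : 0 <= s ^+ n.+1 by rewrite exprn_ge0 ?(ltW s0).
  apply: ler_pM.
  - by rewrite mulr_ge0// mulr_ge0.
  - by rewrite mulr_ge0.
  - by rewrite ler_wpM2l.
  - by rewrite ler_piMr// exprn_ile1// ltW.
exists (csum b).
pose K := M / (1 - s) ^+ 2 / r ^+ 2 / (1 - s).
have K0 : 0 <= K by rewrite /K !divr_ge0 ?exprn_ge0 ?(ltW r0) ?(ltW ss0) ?(ltW s0).
have key w : nm w <= r ->
   nm (psum a w - psum a z - csum b * (w - z)) <= K * nm (w - z) ^+ 2.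
  move=> wr; rewrite -subr_le0; apply: (@le0_eps _ (2 + nm (w - z))) => e e0.
  have [N1 h1] := psum_tail ha r01 e0.
  have [N2 h2] := geo_small (2 * (M / r / (1 - s)) / (1 - s)) s01 e0.
  pose n := maxn N1 N2.
  have hw := h1 n (leq_maxl _ _) w wr.
  have hz := h1 n (leq_maxl _ _) z (ltW zr).
  have hb := csum_tail s01 bb n.
  have {}h2 := h2 n (leq_maxr _ _).
  have {}hb : nm (csum b - \sum_(k < n) b k) <= e.
    apply: le_trans hb _; apply: le_trans (ltW h2).
    by rewrite le_eqVlt; apply/orP; left; apply/eqP; ring.
  have -> : psum a w - psum a z - csum b * (w - z) =
    (psum a w - \sum_(k < n) a k * w ^+ k) - (psum a z - \sum_(k < n) a k * z ^+ k)
    - (csum b - \sum_(k < n) b k) * (w - z)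
    + \sum_(k < n) a k * (w ^+ k - z ^+ k - k%:R * z ^+ k.-1 * (w - z)).
    have -> : \sum_(k < n) a k * (w ^+ k - z ^+ k - k%:R * z ^+ k.-1 * (w - z)) =
      \sum_(k < n) a k * w ^+ k - \sum_(k < n) a k * z ^+ k -
      (\sum_(k < n) b k) * (w - z).
      rewrite mulr_suml -!sumrB; apply: eq_bigr => k _; rewrite /b; ring.
    have id (x1 x2 x3 x4 x5 x6 y : C) : x1 - x2 - x3 * y =
       (x1 - x4) - (x2 - x5) - (x3 - x6) * y + (x4 - x5 - x6 * y) by ring.
    exact: id.
  have hs : nm (\sum_(k < n) a k * (w ^+ k - z ^+ k - k%:R * z ^+ k.-1 * (w - z)))
     <= K * nm (w - z) ^+ 2.
    apply: le_trans (nm_sum _ _ _) _.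
    apply: (@le_trans _ _ (\sum_(k < n) (M / (1 - s) ^+ 2 / r ^+ 2 * nm (w - z) ^+ 2) * s ^+ k)).
      by apply: ler_sum => k _; exact: tb.
    rewrite -mulr_sumr.
    have -> : K * nm (w - z) ^+ 2 =
      (M / (1 - s) ^+ 2 / r ^+ 2 * nm (w - z) ^+ 2) / (1 - s) by rewrite /K; ring.
    rewrite ler_wpM2l ?mulr_ge0 ?invr_ge0 ?exprn_ge0 ?nm_ge0 ?(ltW r0) ?(ltW ss0) ?(ltW s0)//.
    rewrite -[leRHS]mul1r ler_pdivlMr// mulrC -[_ * _]opprK -mulNr opprB.
    rewrite -subrX1 opprB gerBl exprn_ge0// ltW//.
  rewrite lerBlDr; apply: le_trans (nmD _ _) _; apply: lerD hs.
  apply: le_trans (nmB _ _) _; rewrite [leRHS]mulrDl nmM; apply: lerD; last first.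
    by rewrite [leRHS]mulrC ler_wpM2r ?nm_ge0.
  rewrite mulr_natl mulr2n; apply: le_trans (nmB _ _) _.
  exact: lerD hw hz.
move=> e e0; exists (Num.min (r - nm z) (e / (K + 1))).
  by rewrite lt_min subr_gt0 zr/= divr_gt0// ltr_wpDl.
move=> w; rewrite lt_min => /andP[w1 w2].
have wr : nm w <= r by have := nm_lerB w z; lra.
apply: le_trans (key w wr) _; rewrite expr2 mulrA ler_wpM2r ?nm_ge0//.
have K1 : 0 < K + 1 by rewrite ltr_wpDl.
move: w2; rewrite ltr_pdivlMr// => w2.
apply: le_trans (ltW w2); rewrite mulrC ler_wpM2l ?nm_ge0// lerDl//.
Qed.

End PowerSeries.

Section ComplexPower.
Context {R : realType}.
Local Notation C := R[i].
Implicit Types (z w : C).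

Lemma nm_lt_of z (e : R) : `|complex.Re z| < e / 2 -> `|complex.Im z| < e / 2 -> nm z < e.
Proof. by move=> h1 h2; apply: le_lt_trans (nm_leD _) _; lra. Qed.

Lemma ratio_bound (a b a' b' dl : R) : 0 < a -> `|a' - a| < dl -> `|b' - b| < dl ->
  dl <= a / 2 -> `|b' / a' - b / a| <= 2 / a * (1 + `|b| / a) * dl.
Proof.
move=> a0 ha hb dla.
have a'0 : a / 2 < a' by move: ha; rewrite ltr_norml => /andP[]; lra.
have a'p : 0 < a' by lra.
have dl0 : 0 < dl by exact: le_lt_trans ha.
have -> : b' / a' - b / a = ((b' - b) - b / a * (a' - a)) / a'.
  by field; rewrite !gt_eqF.
rewrite normrM normfV (gtr0_norm a'p).
have h1 : `|b' - b - b / a * (a' - a)| <= (1 + `|b| / a) * dl.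
  apply: le_trans (ler_normB _ _) _; rewrite mulrDl mul1r lerD ?(ltW hb)//.
  by rewrite normrM normf_div (gtr0_norm a0) ler_wpM2l ?divr_ge0 ?(ltW a0)// ltW.
have h2 : a'^-1 <= 2 / a.
  by rewrite -[2 / a]invrK invf_div lef_pV2 ?posrE ?divr_gt0// ltW.
have -> : 2 / a * (1 + `|b| / a) * dl = (1 + `|b| / a) * dl * (2 / a) by ring.
by apply: ler_pM => //; rewrite invr_ge0 ltW.
Qed.

Lemma clog_cont z : 0 < complex.Re z -> forall e : R, 0 < e -> exists2 dl : R, 0 < dl &
  forall w, nm (w - z) < dl -> nm (clog w - clog z) < e.
Proof.
move=> z0 e e0; have e2 : 0 < e / 2 by rewrite divr_gt0.
have nz : 0 < nm z.
  by apply: lt_le_trans z0 _; exact: le_trans (ler_norm _) (Re_le_nm z).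
have [d1 d10 h1] := continuous_eps (continuous_ln nz) e2.
have [d2 d20 h2] := continuous_eps (@continuous_atan R (complex.Im z / complex.Re z)) e2.
set K := 2 / complex.Re z * (1 + `|complex.Im z| / complex.Re z).
have K0 : 0 < K.
  by rewrite /K mulr_gt0 ?divr_gt0// ltr_pwDl// divr_ge0// ltW.
exists (Num.min d1 (Num.min (complex.Re z / 2) (d2 / 2 / K))).
  by rewrite !lt_min d10 !divr_gt0.
move=> w; rewrite !lt_min => /and3P[w1 w2 w3].
apply: nm_lt_of; rewrite ?ReD ?ImD ?ReN ?ImN /=.
  by apply: h1; apply: le_lt_trans (nm_dist _ _) _.
apply: h2; set dl := Num.min (complex.Re z / 2) (d2 / 2 / K).
have wd : nm (w - z) < dl by rewrite lt_min w2.
apply: (@le_lt_trans _ _ (K * dl)).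
  apply: ratio_bound => //.
  - by apply: le_lt_trans wd; rewrite -ReN -ReD; exact: Re_le_nm.
  - by apply: le_lt_trans wd; rewrite -ImN -ImD; exact: Im_le_nm.
  - by rewrite ge_min lexx.
apply: (@le_lt_trans _ _ (K * (d2 / 2 / K))).
  by rewrite ler_wpM2l ?(ltW K0)// ge_min lexx orbT.
rewrite mulrC divfK ?gt_eqF//; lra.
Qed.

(** Inverse function argument: with k = clog w - clog z, differentiating [cexp] gives w - z = z k up
    to eta |k|. Continuity of [clog] makes k small, and eta <= |z| / 2 gives |k| <= 2 |w - z| /
    |z|. *)
Lemma cder_clog z : 0 < complex.Re z -> cder (@clog R) z z^-1.
Proof.
move=> z0 e e0.
have nz : 0 < nm z.
  by apply: lt_le_trans z0 _; exact: le_trans (ler_norm _) (Re_le_nm z).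
pose eta := Num.min (nm z / 2) (e * nm z ^+ 2 / 2).
have eta0 : 0 < eta by rewrite /eta lt_min !divr_gt0// mulr_gt0 ?exprn_gt0.
have [d dl0 hd] := cder_cexp (clog z) eta0.
have [d' dl0' hd'] := clog_cont z0 dl0.
exists (Num.min d' (complex.Re z)); first by rewrite lt_min dl0'.
move=> w; rewrite lt_min => /andP[w1 w2].
have w0 : 0 < complex.Re w.
  have := le_lt_trans (Re_le_nm _) w2; rewrite ReD ReN ltr_norml => /andP[]; lra.
have := hd _ (hd' w w1); rewrite !clogK//.
set k := clog w - clog z => hk.
have hk2 : nm (k - z^-1 * (w - z)) <= eta * nm k / nm z.
  rewrite ler_pdivlMr// -nmM.
  apply: le_trans hk; rewrite le_eqVlt; apply/orP; left; apply/eqP.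
  by rewrite -nmN; congr nm; field; rewrite -nm_gt0.
have hk3 : nm k <= 2 * nm (w - z) / nm z.
  have h1 : nm k <= nm (k - z^-1 * (w - z)) + nm (z^-1 * (w - z)).
    by rewrite -{1}[k](subrK (z^-1 * (w - z))) nmD.
  have h2 : eta * nm k / nm z <= nm k / 2.
    rewrite ler_pdivrMr// mulrC mulrAC -mulrA ler_wpM2l ?nm_ge0//.
    by rewrite ge_min lexx.
  move: h1; rewrite [nm (z^-1 * _)]nmM nmV => h1.
  have -> : 2 * nm (w - z) / nm z = 2 * ((nm z)^-1 * nm (w - z)) by ring.
  have := le_trans hk2 h2; move: h1; clear; lra.
apply: le_trans hk2 _; rewrite ler_pdivrMr//.
apply: (@le_trans _ _ (e * nm z ^+ 2 / 2 * (2 * nm (w - z) / nm z))).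
  by apply: ler_pM; rewrite ?nm_ge0 ?(ltW eta0)// ge_min lexx orbT.
by rewrite le_eqVlt; apply/orP; left; apply/eqP; field; rewrite gt_eqF.
Qed.

Definition cpow (a : R) z : C := cexp (a%:C * clog z).

Lemma cpow_neq0 a z : cpow a z != 0. Proof. exact: cexp_neq0. Qed.

Lemma cpowN a z : cpow (- a) z = (cpow a z)^-1.
Proof. by rewrite /cpow -cexpN rmorphN mulNr. Qed.

Lemma nm_cpow a z : z != 0 -> nm (cpow a z) = nm z `^ a.
Proof.
move=> z0; rewrite nm_cexp ReM /= mul0r subr0 /powR.
by rewrite nm_eq0 (negbTE z0).
Qed.

Lemma Re_cpow a z : z != 0 -> complex.Re (cpow a z) =
  nm z `^ a * cos (a * complex.Im (clog z)).
Proof.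
move=> z0; rewrite /cpow /cexp ReM /= !mul0r !subr0 addr0.
by rewrite /powR nm_eq0 (negbTE z0).
Qed.

Lemma chol_cpow a z : 0 < complex.Re z -> chol (cpow a) z.
Proof.
move=> z0; eexists; apply: (@cder_comp _ (fun w => a%:C * clog w)) (cder_cexp _).
by apply: cderZ; exact: cder_clog.
Qed.

Lemma chol_comp (f g : C -> C) z : chol f z -> chol g (f z) -> chol (fun w => g (f w)) z.
Proof. by move=> [d hd] [e he]; eexists; exact: cder_comp hd he. Qed.

Lemma cholM (f g : C -> C) z : chol f z -> chol g z -> chol (fun w => f w * g w) z.
Proof. by move=> [d hd] [e he]; eexists; exact: cderM hd he. Qed.

Lemma cholD (f g : C -> C) z : chol f z -> chol g z -> chol (fun w => f w + g w) z.
Proof. by move=> [d hd] [e he]; eexists; exact: cderD hd he. Qed.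

Lemma chol_cst (c : C) z : chol (fun=> c) z.
Proof. by exists 0; exact: cder_cst. Qed.

Lemma chol_id z : chol (@id C) z.
Proof. by exists 1; exact: cder_id. Qed.

Lemma cholX n z : chol (fun w : C => w ^+ n) z.
Proof. by eexists; exact: cderX. Qed.

End ComplexPower.

(** * Integrals over intervals *)

Section IntervalIntegrals.
Context {R : realType}.
Local Notation C := R[i].
Local Notation mu := (@lebesgue_measure R).
Implicit Types (a b x y : R) (f g : R -> R) (u v : R -> C).

Definition ii a b f := mu.-integrable `[a, b] (EFin \o f).
Definition Ir a b f : R := Rintegral mu `[a, b] f.
Definition ic a b u := ii a b (fun x => complex.Re (u x)) /\
  ii a b (fun x => complex.Im (u x)).
Definition Ic a b u : C := Ir a b (fun x => complex.Re (u x)) +i*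
  Ir a b (fun x => complex.Im (u x)).

Lemma itv_fin a b : (mu `[a, b] < +oo)%E.
Proof. by rewrite lebesgue_measure_itv /=; case: ifP => // _; rewrite ltry. Qed.

Lemma ii_meas a b f : ii a b f -> measurable_fun `[a, b] f.
Proof. by move=> /integrableP[/measurable_EFinP]. Qed.

Lemma ii_bd a b f (M : R) : measurable_fun `[a, b] f ->
  (forall x, a <= x <= b -> `|f x| <= M) -> ii a b f.
Proof.
move=> mf hM; apply: measurable_bounded_integrable => //; first exact: itv_fin.
exists M; split; first exact: num_real.
by move=> y My x /=; rewrite in_itv /= => /hM/le_trans; apply; exact: ltW.
Qed.

Lemma cont_meas a b f : (forall x, a <= x <= b -> {for x, continuous f}) ->
  measurable_fun `[a, b] f.
Proof.
move=> cf; apply: subspace_continuous_measurable_fun => //.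
apply: continuous_in_subspaceT => x; rewrite inE /= in_itv /= => /cf.
by [].
Qed.

Lemma ii_cont a b f : (forall x, a <= x <= b -> {for x, continuous f}) -> ii a b f.
Proof.
move=> cf; apply: continuous_compact_integrable; first exact: segment_compact.
apply: continuous_in_subspaceT => x; rewrite inE /= in_itv /= => /cf.
by [].
Qed.

Lemma cont_bounded a b f : (forall x, a <= x <= b -> {for x, continuous f}) ->
  exists M, forall x, a <= x <= b -> `|f x| <= M.
Proof.
move=> cf; have : {within `[a, b], continuous f}.
  apply: continuous_in_subspaceT => x; rewrite inE /= in_itv /= => /cf.
  by [].
move=> /continuous_compact/(_ (@segment_compact _ a b))/compact_bounded[M [_ hM]].
exists (M + 1) => x xab; apply: (hM (M + 1)); first by rewrite ltrDl.
by exists x => //=; rewrite in_itv.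
Qed.

Lemma ii_cst a b (c : R) : ii a b (fun=> c).
Proof. by apply: ii_cont => x _; exact: cvg_cst. Qed.

Lemma iiD a b f g : ii a b f -> ii a b g -> ii a b (fun x => f x + g x).
Proof.
move=> hf hg; have := @integrableD _ _ _ mu `[a,b]%classic ltac:(by []) _ _ hf hg.
by apply: eq_integrable => // x _; rewrite /= EFinD.
Qed.

Lemma iiZ a b (c : R) f : ii a b f -> ii a b (fun x => c * f x).
Proof.
move=> hf; have := @integrableZl _ _ _ mu `[a,b]%classic ltac:(by []) c _ hf.
by apply: eq_integrable => // x _; rewrite /= EFinM.
Qed.

Lemma iiN a b f : ii a b f -> ii a b (fun x => - f x).
Proof.
move=> hf; have := iiZ (-1) hf; apply: eq_integrable => // x _.
by rewrite /= mulN1r.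
Qed.

Lemma iiB a b f g : ii a b f -> ii a b g -> ii a b (fun x => f x - g x).
Proof. by move=> hf hg; apply: iiD => //; exact: iiN. Qed.

Lemma ii_abs a b f : ii a b f -> ii a b (fun x => `|f x|).
Proof. by move=> hf; have := integrable_norm hf. Qed.

Lemma ii_le a b f g : measurable_fun `[a, b] f -> ii a b g ->
  (forall x, a <= x <= b -> `|f x| <= g x) -> ii a b f.
Proof.
move=> mf hg h; apply: (le_integrable _ _ _ hg) => //.
  exact/measurable_EFinP.
move=> x /=; rewrite in_itv /= lee_fin => /h/le_trans; apply.
exact: ler_norm.
Qed.

Lemma IrD a b f g : ii a b f -> ii a b g ->
  Ir a b (fun x => f x + g x) = Ir a b f + Ir a b g.
Proof. exact: RintegralD. Qed.
Lemma IrB a b f g : ii a b f -> ii a b g ->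
  Ir a b (fun x => f x - g x) = Ir a b f - Ir a b g.
Proof. exact: RintegralB. Qed.
Lemma IrZ a b (c : R) f : ii a b f -> Ir a b (fun x => c * f x) = c * Ir a b f.
Proof. exact: RintegralZl. Qed.
Lemma Ir_cst a b (c : R) : a <= b -> Ir a b (fun=> c) = c * (b - a).
Proof.
move=> ab; rewrite /Ir Rintegral_cst//; congr (_ * _).
transitivity (fine (mu `[a, b]%classic)); first by [].
rewrite lebesgue_measure_itv /= lte_fin.
by case: ltP => //= ba; rewrite (@le_anti _ _ a b) ?ab// subrr.
Qed.
Lemma Ir_le a b f g : ii a b f -> ii a b g -> (forall x, a <= x <= b -> f x <= g x) ->
  Ir a b f <= Ir a b g.
Proof. by move=> hf hg h; apply: le_Rintegral => // x /=; rewrite in_itv; exact: h. Qed.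
Lemma Ir_abs a b f : ii a b f -> `|Ir a b f| <= Ir a b (fun x => `|f x|).
Proof. exact: le_normr_Rintegral. Qed.
Lemma eq_Ir a b f g : (forall x, a <= x <= b -> f x = g x) -> Ir a b f = Ir a b g.
Proof. by move=> h; apply: eq_Rintegral => x; rewrite inE /= in_itv; exact: h. Qed.
Lemma eq_ii a b f g : (forall x, a <= x <= b -> f x = g x) -> ii a b f -> ii a b g.
Proof.
move=> h; apply: eq_integrable => // x; rewrite inE /= in_itv /= => xab.
by rewrite h.
Qed.
Lemma Ir_ge0 a b f : (forall x, a <= x <= b -> 0 <= f x) -> 0 <= Ir a b f.
Proof. by move=> h; apply: Rintegral_ge0 => x /=; rewrite in_itv /=; exact: h. Qed.

Lemma Ir_split a b c f : a <= c <= b -> ii a b f ->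
  Ir a b f = Ir a c f + Ir c b f.
Proof.
move=> /andP[ac cb] hf; rewrite /Ir.
have := @Rintegral_itvB _ f (BLeft a) (BRight b) c hf ac cb.
rewrite Rintegral_itv_obnd_cbnd; last first.
  apply: integrableS hf => //; apply: subset_itvr => //.
by move=> <-; rewrite addrC subrK.
Qed.

Definition ccont u x := forall e : R, 0 < e -> exists2 dl : R, 0 < dl &
  forall y, `|y - x| < dl -> nm (u y - u x) < e.

Lemma ccont_Re u x : ccont u x -> {for x, continuous (fun y => complex.Re (u y))}.
Proof.
move=> h; apply: eps_continuous => e /h[d d0 hd]; exists d => // y /hd/ltW.
by apply: le_trans; rewrite -ReN -ReD Re_le_nm.
Qed.
Lemma ccont_Im u x : ccont u x -> {for x, continuous (fun y => complex.Im (u y))}.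
Proof.
move=> h; apply: eps_continuous => e /h[d d0 hd]; exists d => // y /hd/ltW.
by apply: le_trans; rewrite -ImN -ImD Im_le_nm.
Qed.
Lemma ccont_nm u x : ccont u x -> {for x, continuous (fun y => nm (u y))}.
Proof.
move=> h; apply: eps_continuous => e /h[d d0 hd]; exists d => // y /hd/ltW.
by apply: le_trans; exact: nm_dist.
Qed.
Lemma ccont_ReIm u x : {for x, continuous (fun y => complex.Re (u y))} ->
  {for x, continuous (fun y => complex.Im (u y))} -> ccont u x.
Proof.
move=> /continuous_eps h1 /continuous_eps h2 e e0.
have e2 : 0 < e / 2 by rewrite divr_gt0.
have [a a0 ha] := h1 _ e2; have [b b0 hb] := h2 _ e2.
exists (Num.min a b); first by rewrite lt_min a0.
move=> y; rewrite lt_min => /andP[/ha h3 /hb h4].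
by apply: nm_lt_of; rewrite ?ReD ?ImD ?ReN ?ImN.
Qed.

Lemma ccont_expi x : ccont (@expi R) x.
Proof. by apply: ccont_ReIm; [exact: continuous_cos|exact: continuous_sin]. Qed.

Lemma ccont_cst (c : C) x : ccont (fun=> c) x.
Proof. by move=> e e0; exists 1 => // y _; rewrite subrr nm0. Qed.

Lemma ccont_chol u x (f : C -> C) : ccont u x -> chol f (u x) ->
  ccont (fun y => f (u y)) x.
Proof.
move=> hu [d /cder_cont hf] e /hf[d1 /hu[d2 d20 h2] h1]; exists d2 => // y /h2.
exact: h1.
Qed.

Lemma ccontD u v x : ccont u x -> ccont v x -> ccont (fun y => u y + v y) x.
Proof.
move=> hu hv e e0; have e2 : 0 < e / 2 by rewrite divr_gt0.
have [a a0 ha] := hu _ e2; have [b b0 hb] := hv _ e2.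
exists (Num.min a b); first by rewrite lt_min a0.
move=> y; rewrite lt_min => /andP[/ha h3 /hb h4].
have -> : u y + v y - (u x + v x) = (u y - u x) + (v y - v x) by ring.
by apply: le_lt_trans (nmD _ _) _; rewrite (splitr e) ltrD.
Qed.

Lemma ccontM u v x : ccont u x -> ccont v x -> ccont (fun y => u y * v y) x.
Proof.
move=> hu hv.
have c1 := ccont_Re hu; have c2 := ccont_Im hu.
have c3 := ccont_Re hv; have c4 := ccont_Im hv.
apply: ccont_ReIm.
  have -> : (fun y => complex.Re (u y * v y)) = (fun y =>
    complex.Re (u y) * complex.Re (v y) - complex.Im (u y) * complex.Im (v y)).
    by apply/funext => y; rewrite ReM.
  by apply: continuousB; exact: continuousM.
have -> : (fun y => complex.Im (u y * v y)) = (fun y =>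
  complex.Re (u y) * complex.Im (v y) + complex.Im (u y) * complex.Re (v y)).
  by apply/funext => y; rewrite ImM.
by apply: continuousD; exact: continuousM.
Qed.

Lemma ccont_conj u x : ccont u x -> ccont (fun y => conjc (u y)) x.
Proof.
move=> h e /h[d d0 hd]; exists d => // y /hd.
by rewrite -rmorphB nm_conj.
Qed.

Lemma ccont_real f x : {for x, continuous f} -> ccont (fun y => (f y)%:C) x.
Proof. by move=> h; apply: ccont_ReIm => //=; exact: cvg_cst. Qed.

Lemma ic_cont a b u : (forall x, a <= x <= b -> ccont u x) -> ic a b u.
Proof. by move=> h; split; apply: ii_cont => x /h; [exact: ccont_Re|exact: ccont_Im]. Qed.

Lemma ic_cst a b (c : C) : ic a b (fun=> c).
Proof. by split; exact: ii_cst. Qed.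

Lemma icD a b u v : ic a b u -> ic a b v -> ic a b (fun x => u x + v x).
Proof.
move=> [h1 h2] [h3 h4]; split.
  by apply: eq_ii (iiD h1 h3) => x _; rewrite ReD.
by apply: eq_ii (iiD h2 h4) => x _; rewrite ImD.
Qed.

Lemma icZ a b (c : C) u : ic a b u -> ic a b (fun x => c * u x).
Proof.
move=> [h1 h2]; split.
  by apply: eq_ii (iiB (iiZ (complex.Re c) h1) (iiZ (complex.Im c) h2)) => x _; rewrite ReM.
by apply: eq_ii (iiD (iiZ (complex.Re c) h2) (iiZ (complex.Im c) h1)) => x _; rewrite ImM.
Qed.

Lemma eq_ic a b u v : (forall x, a <= x <= b -> u x = v x) -> ic a b u -> ic a b v.
Proof. by move=> h [h1 h2]; split; [move: h1|move: h2]; apply: eq_ii => x /h->. Qed.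

Lemma eq_Ic a b u v : (forall x, a <= x <= b -> u x = v x) -> Ic a b u = Ic a b v.
Proof. by move=> h; congr (_ +i* _); apply: eq_Ir => x /h->. Qed.

Lemma icN a b u : ic a b u -> ic a b (fun x => - u x).
Proof. by move=> /(icZ (-1)); apply: eq_ic => x _; rewrite mulN1r. Qed.

Lemma icB a b u v : ic a b u -> ic a b v -> ic a b (fun x => u x - v x).
Proof. by move=> hu hv; apply: icD => //; exact: icN. Qed.

Lemma IcD a b u v : ic a b u -> ic a b v ->
  Ic a b (fun x => u x + v x) = Ic a b u + Ic a b v.
Proof.
move=> [h1 h2] [h3 h4]; apply: complex_eqP; rewrite ?ReD ?ImD /= -IrD//.
  by apply: eq_Ir => x _; rewrite ReD.
by apply: eq_Ir => x _; rewrite ImD.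
Qed.

Lemma IcZ a b (c : C) u : ic a b u -> Ic a b (fun x => c * u x) = c * Ic a b u.
Proof.
move=> [h1 h2]; apply: complex_eqP; rewrite ?ReM ?ImM /= -!IrZ//.
  by rewrite -IrB; [apply: eq_Ir => x _; rewrite ReM|exact: iiZ|exact: iiZ].
by rewrite -IrD; [apply: eq_Ir => x _; rewrite ImM|exact: iiZ|exact: iiZ].
Qed.

Lemma IcB a b u v : ic a b u -> ic a b v ->
  Ic a b (fun x => u x - v x) = Ic a b u - Ic a b v.
Proof.
move=> hu hv; rewrite -mulN1r -IcZ// -IcD//; last exact: icZ.
by apply: eq_Ic => x _; rewrite mulN1r.
Qed.

Lemma Ic_cst a b (c : C) : a <= b -> Ic a b (fun=> c) = c * (b - a)%:C.
Proof.
move=> ab; apply: complex_eqP; rewrite ?ReM ?ImM /= Ir_cst//; ring.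
Qed.

Lemma Ic_split a b c u : a <= c <= b -> ic a b u ->
  Ic a b u = Ic a c u + Ic c b u.
Proof.
move=> acb [h1 h2]; apply: complex_eqP; rewrite ?ReD ?ImD /=; exact: Ir_split.
Qed.

Lemma ic_nm_meas a b u : measurable_fun `[a, b] (fun x => complex.Re (u x)) ->
  measurable_fun `[a, b] (fun x => complex.Im (u x)) ->
  measurable_fun `[a, b] (fun x => nm (u x)).
Proof.
move=> h1 h2; rewrite (_ : (fun x => nm (u x)) = (fun x =>
  ((complex.Re (u x)) ^+ 2 + (complex.Im (u x)) ^+ 2) `^ 2^-1)); last first.
  by apply/funext => x; rewrite powR12_sqrt ?nmE// addr_ge0// sqr_ge0.
apply: (@measurableT_comp _ _ _ _ _ _ (fun x : R => x `^ 2^-1)).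
  exact: measurable_powR.
by apply: measurable_funD; exact: measurable_funX.
Qed.

Lemma ii_nm a b u : ic a b u -> ii a b (fun x => nm (u x)).
Proof.
move=> [h1 h2]; apply: ii_le (iiD (ii_abs h1) (ii_abs h2)) _.
  by apply: ic_nm_meas; exact: ii_meas.
by move=> x _; rewrite ger0_norm ?nm_ge0// nm_leD.
Qed.

(** Multiplication by the unimodular [c] that turns the integral into its modulus leaves a
    comparison of real integrals. *)
Lemma Ic_nm a b u : ic a b u -> nm (Ic a b u) <= Ir a b (fun x => nm (u x)).
Proof.
move=> hu; have [J0|J0] := eqVneq (Ic a b u) 0.
  by rewrite J0 nm0 Ir_ge0// => x _; exact: nm_ge0.
have nJ : 0 < nm (Ic a b u) by rewrite nm_gt0.
set J := Ic a b u in J0 nJ *.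
pose c : C := conjc J / (nm J)%:C.
have nc : nm c = 1.
  by rewrite nmM nmV nmR nm_conj ger0_norm ?nm_ge0// mulfV// gt_eqF.
have cJ : c * J = (nm J)%:C.
  rewrite /c mulrAC mulrC [conjc J * J]mulrC mul_conj expr2 rmorphM mulrA mulVf ?mul1r//.
  by rewrite -nm_eq0 nmR ger0_norm ?nm_ge0// gt_eqF.
have : complex.Re (Ic a b (fun x => c * u x)) = nm J by rewrite IcZ// -/J cJ.
move=> <- /=; have [h1 _] := icZ c hu; apply: Ir_le => //; first exact: ii_nm.
move=> x _; apply: le_trans (ler_norm _) _; apply: le_trans (Re_le_nm _) _.
by rewrite nmM nc mul1r.
Qed.

Lemma Ic_nm_bd a b u (M : R) : a <= b -> ic a b u ->
  (forall x, a <= x <= b -> nm (u x) <= M) -> nm (Ic a b u) <= M * (b - a).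
Proof.
move=> ab hu h; apply: le_trans (Ic_nm hu) _; rewrite -Ir_cst//.
by apply: Ir_le => //; [exact: ii_nm|exact: ii_cst].
Qed.

Lemma ic_sum a b n (F : nat -> R -> C) : (forall k, ic a b (F k)) ->
  ic a b (fun x => \sum_(k < n) F k x).
Proof.
move=> h; elim: n => [|n IH].
  by apply: eq_ic (ic_cst a b 0) => x _; rewrite big_ord0.
by apply: eq_ic (icD IH (h n)) => x _; rewrite big_ord_recr.
Qed.

Lemma Ic_sum a b n (F : nat -> R -> C) : (forall k, ic a b (F k)) ->
  Ic a b (fun x => \sum_(k < n) F k x) = \sum_(k < n) Ic a b (F k).
Proof.
move=> h; elim: n => [|n IH].
  rewrite big_ord0; apply: complex_eqP => /=; rewrite /Ir.
    by under eq_Rintegral do rewrite big_ord0; rewrite /Rintegral integral0.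
  by under eq_Rintegral do rewrite big_ord0; rewrite /Rintegral integral0.
rewrite big_ord_recr /= -IH -IcD//; last exact: ic_sum.
by apply: eq_Ic => x _; rewrite big_ord_recr.
Qed.

End IntervalIntegrals.

(** * Goursat's theorem and Taylor coefficients *)

Section Goursat.
Context {R : realType}.
Local Notation C := R[i].
Implicit Types (a b c d x y : R) (G H : C -> C).

(** The contour integral of [G] counterclockwise around the rectangle [a, b] x [c, d]. *)
Definition rint G a b c d : C :=
  Ic a b (fun x => G (x +i* c)) - Ic a b (fun x => G (x +i* d))
  + 'i * (Ic c d (fun y => G (b +i* y)) - Ic c d (fun y => G (a +i* y))).

Definition rect a b c d (w : C) :=
  (a <= complex.Re w <= b) /\ (c <= complex.Im w <= d).

Definition rcont G a b c d := forall w, rect a b c d w ->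
  forall e : R, 0 < e -> exists2 dl : R, 0 < dl &
    forall z, nm (z - w) < dl -> nm (G z - G w) < e.

Lemma chol_rcont G a b c d : (forall w, rect a b c d w -> chol G w) -> rcont G a b c d.
Proof. by move=> h w /h[dd /cder_cont]. Qed.

Lemma nm_horiz x x' y : nm ((x +i* y) - (x' +i* y) : C) = `|x - x'|.
Proof.
have -> : (x +i* y) - (x' +i* y) = (x - x')%:C :> C.
  by apply: complex_eqP; rewrite /= ?subrr.
exact: nmR.
Qed.
Lemma nm_vert x y y' : nm ((x +i* y) - (x +i* y') : C) = `|y - y'|.
Proof.
have -> : (x +i* y) - (x +i* y') = 'i * (y - y')%:C :> C.
  by apply: complex_eqP; rewrite ?ReM ?ImM /= ?subrr; ring.
by rewrite nmM nm_i mul1r nmR.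
Qed.

Lemma rcont_h G a b c d y : rcont G a b c d -> c <= y <= d -> ic a b (fun x => G (x +i* y)).
Proof.
move=> h yd; apply: ic_cont => x xab e e0.
have [dl dl0 hd] := h (x +i* y) (conj xab yd) e e0.
by exists dl => // x' xx'; apply: hd; rewrite nm_horiz.
Qed.
Lemma rcont_v G a b c d x : rcont G a b c d -> a <= x <= b -> ic c d (fun y => G (x +i* y)).
Proof.
move=> h xd; apply: ic_cont => y yab e e0.
have [dl dl0 hd] := h (x +i* y) (conj xd yab) e e0.
by exists dl => // x' xx'; apply: hd; rewrite nm_vert.
Qed.

Lemma rint_splith G a b c d m : a <= m <= b -> c <= d -> rcont G a b c d ->
  rint G a b c d = rint G a m c d + rint G m b c d.
Proof.
move=> /andP[am mb] cd h; have ab := le_trans am mb.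
have h1 := rcont_h h (y := c) ltac:(by rewrite lexx cd).
have h2 := rcont_h h (y := d) ltac:(by rewrite lexx cd).
rewrite /rint (@Ic_split _ a b m (fun x => G (x +i* c))) ?am//.
rewrite (@Ic_split _ a b m (fun x => G (x +i* d))) ?am//; ring.
Qed.
Lemma rint_splitv G a b c d m : c <= m <= d -> a <= b -> rcont G a b c d ->
  rint G a b c d = rint G a b c m + rint G a b m d.
Proof.
move=> /andP[am mb] ab h; have cd := le_trans am mb.
have h1 := rcont_v h (x := a) ltac:(by rewrite lexx ab).
have h2 := rcont_v h (x := b) ltac:(by rewrite lexx ab).
rewrite /rint (@Ic_split _ c d m (fun y => G (a +i* y))) ?am//.
rewrite (@Ic_split _ c d m (fun y => G (b +i* y))) ?am//; ring.
Qed.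

Lemma rcont_sub G a b c d a' b' c' d' : a <= a' -> b' <= b -> c <= c' -> d' <= d ->
  rcont G a b c d -> rcont G a' b' c' d'.
Proof.
move=> h1 h2 h3 h4 h w [/andP[w1 w2] /andP[w3 w4]]; apply: h; split.
  by rewrite (le_trans h1)//= (le_trans w2).
by rewrite (le_trans h3)//= (le_trans w4).
Qed.

(** Affine functions have zero contour integral. Opposite sides are subtracted first: the
    differences are constant along each side, so no primitive is required. *)
Lemma rint_affine G a b c d (w0 A B : C) : a <= b -> c <= d -> rcont G a b c d ->
  rint G a b c d = rint (fun w => G w - A - B * (w - w0)) a b c d.
Proof.
move=> ab cd h.
have cl (w : C) : chol (fun w => A + B * (w - w0)) w.
  apply: cholD (chol_cst _ _) _; apply: cholM (chol_cst _ _) _.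
  exact: cholD (chol_id _) (chol_cst _ _).
set L := fun w : C => A + B * (w - w0) in cl.
have hL : rcont L a b c d by apply: chol_rcont => w _; exact: cl.
have -> : (fun w => G w - A - B * (w - w0)) = (fun w => G w - L w).
  by apply/funext => w; rewrite /L; ring.
have cc : c <= c <= d by rewrite lexx.
have dd : c <= d <= d by rewrite lexx cd.
have aa : a <= a <= b by rewrite lexx.
have bb : a <= b <= b by rewrite lexx ab.
rewrite [in RHS]/rint.
rewrite !IcB; try exact: (rcont_h (c := c) (d := d)); try exact: (rcont_v (a := a) (b := b)).
suff L0 : rint L a b c d = 0.
  transitivity (rint G a b c d - rint L a b c d); first by rewrite L0 subr0.
  by rewrite /rint; ring.
rewrite /rint -!IcB; try exact: (rcont_h (c := c) (d := d)); try exact: (rcont_v (a := a) (b := b)).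
rewrite (@eq_Ic _ a b _ (fun=> B * 'i * (c - d)%:C)); last first.
  move=> x _; rewrite /L (complexE (x +i* c)) (complexE (x +i* d)) /= rmorphB /=.
  by rewrite complexiE; ring.
rewrite (@eq_Ic _ c d _ (fun=> B * (b - a)%:C)); last first.
  move=> y _; rewrite /L (complexE (b +i* y)) (complexE (a +i* y)) /= rmorphB /=.
  by ring.
rewrite !Ic_cst// !rmorphB /=; ring.
Qed.

Lemma rint_bound G a b c d (M : R) : a <= b -> c <= d -> rcont G a b c d ->
  (forall w, rect a b c d w -> nm (G w) <= M) ->
  nm (rint G a b c d) <= 2 * M * (b - a + (d - c)).
Proof.
move=> ab cd h hM.
have cc : c <= c <= d by rewrite lexx.
have dd : c <= d <= d by rewrite lexx cd.
have aa : a <= a <= b by rewrite lexx.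
have bb : a <= b <= b by rewrite lexx ab.
have h1 := Ic_nm_bd ab (rcont_h h cc) (fun x hx => hM (x +i* c) (conj hx cc)).
have h2 := Ic_nm_bd ab (rcont_h h dd) (fun x hx => hM (x +i* d) (conj hx dd)).
have h3 := Ic_nm_bd cd (rcont_v h aa) (fun y hy => hM (a +i* y) (conj aa hy)).
have h4 := Ic_nm_bd cd (rcont_v h bb) (fun y hy => hM (b +i* y) (conj bb hy)).
rewrite /rint; apply: le_trans (nmD _ _) _.
have t1 := le_trans (nmB _ _) (lerD h1 h2).
have t2 := le_trans (nmB _ _) (lerD h4 h3).
rewrite nmM nm_i mul1r; apply: le_trans (lerD t1 t2) _.
by rewrite le_eqVlt; apply/orP; left; apply/eqP; ring.
Qed.

Lemma rint_small G a b c d (w0 dd : C) (e dl : R) : a <= b -> c <= d -> 0 <= e ->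
  rcont G a b c d -> rect a b c d w0 ->
  (forall w, nm (w - w0) < dl -> nm (G w - G w0 - dd * (w - w0)) <= e * nm (w - w0)) ->
  b - a + (d - c) < dl ->
  nm (rint G a b c d) <= 2 * e * (b - a + (d - c)) ^+ 2.
Proof.
move=> ab cd e0 h hw hd sdl.
rewrite (rint_affine w0 (G w0) dd ab cd h).
set S := b - a + (d - c).
have hs w : rect a b c d w -> nm (w - w0) <= S.
  move=> [/andP[w1 w2] /andP[w3 w4]]; case: hw => /andP[z1 z2] /andP[z3 z4].
  apply: le_trans (nm_leD _) _; rewrite ReD ImD ReN ImN /S lerD// ler_norml; lra.
have -> : 2 * e * S ^+ 2 = 2 * (e * S) * S by ring.
apply: rint_bound => //; last first.
  move=> w hw'; apply: le_trans (hd w _) _; first by apply: le_lt_trans sdl; exact: hs.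
  by rewrite ler_wpM2l// hs.
have cl (w : C) : chol (fun w => - G w0 + - dd * (w - w0)) w.
  apply: cholD (chol_cst _ _) _; apply: cholM (chol_cst _ _) _.
  exact: cholD (chol_id _) (chol_cst _ _).
move=> w hw' eps eps0.
have e2 : 0 < eps / 2 by rewrite divr_gt0.
have [d1 d10 k1] := h w hw' _ e2.
have [d2 /cder_cont/(_ _ e2)[d3 d30 k3]] := cl w.
exists (Num.min d1 d3); first by rewrite lt_min d10.
move=> z; rewrite lt_min => /andP[/k1 z1 /k3 z3].
have -> : G z - G w0 - dd * (z - w0) - (G w - G w0 - dd * (w - w0)) =
  (G z - G w) + (- G w0 + - dd * (z - w0) - (- G w0 + - dd * (w - w0))) by ring.
by apply: le_lt_trans (nmD _ _) _; rewrite (splitr eps) ltrD.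
Qed.

Lemma rint_quarter G x y w v (K : R) : 0 <= w -> 0 <= v ->
  rcont G x (x + (w + w)) y (y + (v + v)) ->
  4 * K < nm (rint G x (x + (w + w)) y (y + (v + v))) ->
  exists x' y', [/\ x' = x \/ x' = x + w, y' = y \/ y' = y + v &
    K < nm (rint G x' (x' + w) y' (y' + v))].
Proof.
move=> w0 v0 hc hk.
have xw : x <= x + w by rewrite lerDl.
have yv : y <= y + v by rewrite lerDl.
have xw2 : x + w <= x + w + w by rewrite lerDl.
have yv2 : y + v <= y + v + v by rewrite lerDl.
rewrite !addrA in hc hk.
have e1 : rint G x (x + w + w) y (y + v + v) =
   (rint G x (x + w) y (y + v) + rint G x (x + w) (y + v) (y + v + v)) +
   (rint G (x + w) (x + w + w) y (y + v) +
    rint G (x + w) (x + w + w) (y + v) (y + v + v)).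
  rewrite (@rint_splith _ _ _ _ _ (x + w)) ?xw ?xw2 ?(le_trans yv)//.
  rewrite (@rint_splitv _ x _ _ _ (y + v)) ?yv ?yv2//; last exact: rcont_sub hc.
  rewrite (@rint_splitv _ (x + w) _ _ _ (y + v)) ?yv ?yv2//; exact: rcont_sub hc.
have [h1|h1] := ltP K (nm (rint G x (x + w) y (y + v))).
  by exists x, y; split => //; left.
have [h2|h2] := ltP K (nm (rint G x (x + w) (y + v) (y + v + v))).
  by exists x, (y + v); split => //; [left|right].
have [h3|h3] := ltP K (nm (rint G (x + w) (x + w + w) y (y + v))).
  by exists (x + w), y; split => //; [right|left].
have [h4|h4] := ltP K (nm (rint G (x + w) (x + w + w) (y + v) (y + v + v))).
  by exists (x + w), (y + v); split => //; right.
exfalso; move: hk; rewrite e1 ltNge => /negP; apply.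
apply: le_trans (nmD _ _) _.
have t1 := le_trans (nmD _ _) (lerD h1 h2).
have t2 := le_trans (nmD _ _) (lerD h3 h4).
apply: le_trans (lerD t1 t2) _; lra.
Qed.

Lemma nested_point (x w : nat -> R) : (forall n, 0 <= w n) ->
  (forall n, x n <= x n.+1) -> (forall n, x n.+1 + w n.+1 <= x n + w n) ->
  exists xs, forall n, x n <= xs <= x n + w n.
Proof.
move=> w0 hx hw.
have mx m n : (m <= n)%N -> x m <= x n.
  by move=> mn; rewrite -(subnK mn); elim: (n - m)%N => // k IH; rewrite (le_trans IH).
have mw m n : (m <= n)%N -> x n + w n <= x m + w m.
  by move=> mn; rewrite -(subnK mn); elim: (n - m)%N => // k IH; apply: le_trans IH; rewrite addSn.
have ub m n : x m <= x n + w n.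
  have [mn|/ltnW nm] := leqP m n.
    by rewrite (le_trans (mx _ _ mn))// lerDl.
  by rewrite (le_trans _ (mw _ _ nm))// lerDl.
have hs : has_sup (range x).
  by split; [exists (x 0%N), 0%N|exists (x 0%N + w 0%N) => _ [m _ <-]].
exists (sup (range x)) => n; apply/andP; split.
  by apply: sup_upper_bound => //; exists n.
by apply: ge_sup; [exists (x 0%N), 0%N|move=> _ [m _ <-]].
Qed.

(** Bisection: if the integral is not 0, nested quarters carry integrals above k / 4^n. At their
    common point differentiability bounds the integral by 2 e (S / 2^n)^2, which is smaller once e
    is small. *)
Theorem goursat G a b c d : a <= b -> c <= d ->
  (forall w, rect a b c d w -> chol G w) -> rint G a b c d = 0.
Proof.
move=> ab cd hG; have hc := chol_rcont hG.
apply/eqP; rewrite -nm_eq0; apply/negPn/negP => N0.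
have {}N0 : 0 < nm (rint G a b c d) by rewrite lt0r N0 nm_ge0.
(* Half of the modulus, so that the strict inequality in [bad] already holds for the whole
   rectangle. *)
set k := nm (rint G a b c d) / 2; have k0 : 0 < k by rewrite divr_gt0.
pose w n : R := (b - a) / 2 ^+ n; pose v n : R := (d - c) / 2 ^+ n.
have w0 n : 0 <= w n by rewrite divr_ge0 ?subr_ge0 ?exprn_ge0.
have v0 n : 0 <= v n by rewrite divr_ge0 ?subr_ge0 ?exprn_ge0.
have p20 n : (2 : R) ^+ n != 0 by rewrite expf_neq0.
have wS n : w n = w n.+1 + w n.+1 by rewrite /w exprS; field.
have vS n : v n = v n.+1 + v n.+1 by rewrite /v exprS; field.
pose bad n (p : R * R) := [/\ a <= p.1, p.1 + w n <= b, c <= p.2, p.2 + v n <= d &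
  k / 4 ^+ n < nm (rint G p.1 (p.1 + w n) p.2 (p.2 + v n))].
pose nest n (p q : R * R) := [/\ p.1 <= q.1, q.1 + w n.+1 <= p.1 + w n,
  p.2 <= q.2 & q.2 + v n.+1 <= p.2 + v n].
(* Stated as an implication for every pair, good or bad, so that [choice] gives a total function to
   iterate. *)
have step n (p : R * R) : exists q : R * R, bad n p -> bad n.+1 q /\ nest n p q.
  have [hb|nb] := pselect (bad n p); last by exists p.
  case: p hb => x y [/= ax xb cy yd hk].
  have hc' : rcont G x (x + w n) y (y + v n) by apply: rcont_sub hc.
  have k4 : k / 4 ^+ n = 4 * (k / 4 ^+ n.+1).
    by rewrite exprS; field; rewrite expf_neq0.
  rewrite k4 in hk; move: (w0 n.+1) (v0 n.+1) xb yd hk hc'.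
  rewrite /bad /nest (wS n) (vS n) /=; move: (w n.+1) (v n.+1) (k / 4 ^+ n.+1) => W V K.
  clear -ax cy.
  move=> W0 V0 xb yd hk hc'.
  have [x' [y' [hx hy hk']]] := rint_quarter W0 V0 hc' hk.
  exists (x', y') => _ /=; clear hk hc'.
  case: hx hk' => ->; case: hy => -> hk'; split; split; try exact: hk'; clear hk'; lra.
have [st hst] := choice (fun np : nat * (R * R) => step np.1 np.2).
pose P := fix P n : R * R := if n is m.+1 then st (m, P m) else (a, c).
have badP n : bad n (P n).
  elim: n => [|n IH]; last by have [] := hst (n, P n) IH.
  have kk : k < nm (rint G a b c d) by move: N0; rewrite /k; clear; lra.
  have w00 : a + w 0%N = b by rewrite /w expr0 divr1 subrKC.
  have v00 : c + v 0%N = d by rewrite /v expr0 divr1 subrKC.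
  change (bad 0%N (a, c)); split; cbn [fst snd]; rewrite ?w00 ?v00 ?expr0 ?divr1//.
have nestP n : nest n (P n) (P n.+1) by have [] := hst (n, P n) (badP n).
have [xs hxs] := @nested_point (fun n => (P n).1) w w0
  (fun n => let: And4 h _ _ _ := nestP n in h) (fun n => let: And4 _ h _ _ := nestP n in h).
have [ys hys] := @nested_point (fun n => (P n).2) v v0
  (fun n => let: And4 _ _ h _ := nestP n in h) (fun n => let: And4 _ _ _ h := nestP n in h).
have hr : rect a b c d (xs +i* ys).
  have := hxs 0%N; have := hys 0%N.
  rewrite /w /v /= !expr0 !divr1 !subrKC => h1 h2.
  by split.
have [dd hdd] := hG _ hr.
pose S := b - a + (d - c).
have S0 : 0 <= S by rewrite addr_ge0 ?subr_ge0.
(* Chosen so that 2 e S^2 <= k; the added 1 covers a degenerate rectangle with S = 0. *)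
pose e := k / (2 * (S ^+ 2 + 1)).
have S21 : 0 < S ^+ 2 + 1 by rewrite ltr_wpDl ?sqr_ge0.
have e0 : 0 < e by rewrite divr_gt0 ?mulr_gt0.
have [dl dl0 hdl] := hdd _ e0.
have [n hn] : exists n, S * (1 / 2) ^+ n < dl.
  have [|N hN] := @geo_small R S (1 / 2) dl _ dl0; last by exists N; exact: hN.
  by apply/andP; split; lra.
have [h1 h2 h3 h4 h5] := badP n.
have := @rint_small G (P n).1 ((P n).1 + w n) (P n).2 ((P n).2 + v n) (xs +i* ys) dd e dl.
have wv : (P n).1 + w n - (P n).1 + ((P n).2 + v n - (P n).2) = S / 2 ^+ n.
  by rewrite /w /v /S; field.
rewrite !lerDl wv => /(_ (w0 n) (v0 n) (ltW e0) _ _ hdl) H.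
have {}H : nm (rint G (P n).1 ((P n).1 + w n) (P n).2 ((P n).2 + v n)) <= 2 * e * (S / 2 ^+ n) ^+ 2.
  apply: H.
  - by apply: rcont_sub hc.
  - by split; [exact: hxs|exact: hys].
  - by move: hn; rewrite div1r exprVn.
have := lt_le_trans h5 H; rewrite ltNge => /negP; apply.
have -> : 2 * e * (S / 2 ^+ n) ^+ 2 = (2 * e * S ^+ 2) / 4 ^+ n.
  rewrite expr_div_n -exprM mulnC exprM mulrA; congr (_ / _ ^+ _); ring.
rewrite ler_wpM2r ?invr_ge0 ?exprn_ge0//.
rewrite /e; have -> : 2 * (k / (2 * (S ^+ 2 + 1))) * S ^+ 2 = k * S ^+ 2 / (S ^+ 2 + 1).
  by field; rewrite gt_eqF.
by rewrite ler_pdivrMr// ler_wpM2l ?(ltW k0)// lerDl.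
Qed.

End Goursat.

Section CircleMeans.
Context {R : realType}.
Local Notation C := R[i].
Implicit Types (r t x y : R) (F g : C -> C).

Definition cir r t : C := r%:C * expi t.
Local Notation tp := (2 * pi : R).

Lemma tp_gt0 : 0 < tp. Proof. by rewrite mulr_gt0// pi_gt0. Qed.
Lemma tp_ge0 : 0 <= tp. Proof. exact: ltW tp_gt0. Qed.
Lemma tpC_neq0 : (tp%:C : C) != 0.
Proof. by rewrite -nm_eq0 nmR normr_eq0 gt_eqF// tp_gt0. Qed.

Lemma nm_cir r t : 0 <= r -> nm (cir r t) = r.
Proof. by move=> r0; rewrite nmM nmR nm_expi mulr1 ger0_norm. Qed.

Lemma cirM r s t : cir (r * s) t = r%:C * cir s t.
Proof. by rewrite /cir rmorphM mulrA. Qed.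

Lemma ccont_cir r x : ccont (cir r) x.
Proof. exact: ccontM (ccont_cst _ _) (ccont_expi _). Qed.

Definition dholo F := forall z, nm z < 1 -> chol F z.

Lemma dholo_ccont F r x : dholo F -> 0 <= r < 1 -> ccont (fun t => F (cir r t)) x.
Proof.
move=> hF /andP[r0 r1]; apply: (ccont_chol (u := cir r)); first exact: ccont_cir.
by apply: hF; rewrite nm_cir.
Qed.

(* Goursat on the rectangle [[ln r1, ln r2] x [0, 2pi]] for the periodic function [w |-> g (e^w)]. *)
Lemma circ_const g r1 r2 : (forall z, 0 < nm z < 1 -> chol g z) -> 0 < r1 -> r1 <= r2 -> r2 < 1 ->
  Ic 0 tp (fun t => g (cir r1 t)) = Ic 0 tp (fun t => g (cir r2 t)).
Proof.
move=> hg r10 r12 r21.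
have r20 : 0 < r2 := lt_le_trans r10 r12.
pose G w := g (cexp w).
have hG w : rect (ln r1) (ln r2) 0 tp w -> chol G w.
  move=> [/andP[_ w2] _]; apply: chol_comp; first by eexists; exact: cder_cexp.
  by apply: hg; rewrite nm_cexp expR_gt0/= (le_lt_trans _ r21)// -(lnK r20) ler_expR.
have ll : ln r1 <= ln r2 by rewrite ler_ln ?posrE.
have := goursat ll tp_ge0 hG; rewrite /rint.
have cirE r t : 0 < r -> cexp (ln r +i* t) = cir r t.
  by move=> r0; rewrite /cexp /= lnK ?posrE.
rewrite (@eq_Ic _ _ _ (fun x => G (x +i* 0)) (fun x => G (x +i* tp))); last first.
  by move=> x _; rewrite /G /cexp /= -[tp]add0r expiD2pi.
rewrite subrr add0r => /eqP; rewrite mulf_eq0 -(nm_eq0 'i) nm_i oner_eq0 /=.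
rewrite subr_eq0 => /eqP.
rewrite (@eq_Ic _ _ _ (fun t => G (ln r2 +i* t)) (fun t => g (cir r2 t))); last first.
  by move=> t _; rewrite /G cirE.
rewrite (@eq_Ic _ _ _ (fun t => G (ln r1 +i* t)) (fun t => g (cir r1 t))) => [->//|].
by move=> t _; rewrite /G cirE.
Qed.

(** By [circ_const] the radius may be shrunk until [F] is within [e] of [F 0] on the whole
    circle. *)
Lemma circ_mean F r : dholo F -> 0 <= r < 1 ->
  Ic 0 tp (fun t => F (cir r t)) = tp%:C * F 0.
Proof.
move=> hF /andP[r0 r1]; move: r0; rewrite le_eqVlt => /predU1P[<-|r0].
  rewrite (@eq_Ic _ _ _ _ (fun=> F 0)); last by move=> t _; rewrite /cir mul0r.
  by rewrite Ic_cst ?tp_ge0// subr0 mulrC.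
apply/eqP; rewrite -subr_eq0 -nm_eq0 eq_le nm_ge0 andbT.
apply: (@le0_eps _ _ tp) => e e0.
have [d hd] := hF 0 ltac:(by rewrite nm0).
have [dl dl0 h] := cder_cont hd e0.
pose s := Num.min r (dl / 2).
have s0 : 0 < s by rewrite lt_min r0 divr_gt0.
have sr : s <= r by rewrite ge_min lexx.
rewrite -(@circ_const F s r)//; last by move=> z /andP[_]; exact: hF.
have s1 : 0 <= s < 1 by rewrite (ltW s0) (le_lt_trans sr).
have icF : ic 0 tp (fun t => F (cir s t)).
  by apply: ic_cont => x _; exact: dholo_ccont.
have -> : tp%:C * F 0 = Ic 0 tp (fun=> F 0) by rewrite Ic_cst ?tp_ge0// subr0 mulrC.
rewrite -IcB//; last exact: ic_cst.
have -> : tp * e = e * (tp - 0) by rewrite subr0 mulrC.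
apply: Ic_nm_bd; [exact: tp_ge0|exact: icB icF (ic_cst _ _ _)|].
move=> t _; apply/ltW/h; rewrite subr0 nm_cir ?(ltW s0)//.
by rewrite /s gt_min; apply/orP; right; lra.
Qed.

(** Cauchy's integral for the Taylor coefficient. The radius 1/2 is an arbitrary choice: [coefE]
    gives the same value on every circle. *)
Definition coef F n : C := (tp%:C)^-1 *
  Ic 0 tp (fun t => F (cir (1 / 2) t) / cir (1 / 2) t ^+ n).

Lemma coefE F n r : dholo F -> 0 < r < 1 ->
  Ic 0 tp (fun t => F (cir r t) * expi (- t) ^+ n) = tp%:C * (coef F n * (r ^+ n)%:C).
Proof.
move=> hF /andP[r0 r1]; have hg z : 0 < nm z < 1 -> chol (fun z => F z * (z ^+ n)^-1) z.
  move=> /andP[z0 z1]; apply: cholM; first exact: hF.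
  apply: (chol_comp (cholX n z)); eexists; apply: cder_inv.
  by rewrite expf_neq0// -nm_gt0.
have ht t : 0 < nm (cir r t) < 1 by rewrite nm_cir ?(ltW r0)// r0.
have rn : (r%:C : C) ^+ n != 0 by rewrite expf_neq0// -nm_eq0 nmR normr_eq0 gt_eqF.
have h12 : Ic 0 tp (fun t => F (cir r t) / cir r t ^+ n) =
  Ic 0 tp (fun t => F (cir (1 / 2) t) / cir (1 / 2) t ^+ n).
  have [rh|/ltW rh] := leP r (1 / 2).
    by apply: (@circ_const (fun z => F z / z ^+ n)) => //; lra.
  by apply/esym/(@circ_const (fun z => F z / z ^+ n)) => //; lra.
have cE : tp%:C * coef F n = Ic 0 tp (fun t => F (cir r t) / cir r t ^+ n).
  by rewrite h12; exact: mulVKf tpC_neq0 _.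
rewrite mulrA cE [RHS]mulrC -IcZ; last first.
  apply: ic_cont => t _; apply: (ccont_chol (u := cir r)(f := fun z => F z / z ^+ n)); first exact: ccont_cir.
  exact: hg (ht t).
apply: eq_Ic => t _; rewrite /cir exprMn rmorphXn /= expiN.
rewrite exprVn invfM.
by rewrite [RHS]mulrCA mulVKf.
Qed.

(** The mean value property of F z^(n+1), which vanishes at 0. On the circle of radius 0 the
    integrand is a constant times [expi t ^+ n.+1], handled by the mean value of a monomial. *)
Lemma coef_neg F n r : dholo F -> 0 <= r < 1 ->
  Ic 0 tp (fun t => F (cir r t) * expi t ^+ n.+1) = 0.
Proof.
move=> hF /andP[r0 r1]; move: r0; rewrite le_eqVlt => /predU1P[<-|r0].
  have := @circ_mean (fun z => z ^+ n.+1) (1 / 2) (fun z _ => cholX n.+1 z) ltac:(by apply/andP; split; lra).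
  rewrite exprS mul0r mulr0 => h.
  rewrite (@eq_Ic _ _ _ _ (fun t => F 0 * 2 ^+ n.+1 * cir (1 / 2) t ^+ n.+1)).
    rewrite IcZ ?h ?mulr0//; apply: ic_cont => x _.
    exact: (ccont_chol (ccont_cir _ _) (cholX n.+1 _)).
  move=> t _; rewrite /cir mul0r exprMn mulrA -[_ * _%:C ^+ _]mulrA -exprMn.
  have -> : 2 * (1 / 2 : R)%:C = 1 :> C.
    by apply: complex_eqP; rewrite ?ReM ?ImM /=; lra.
  by rewrite expr1n mulr1.
have hg : dholo (fun z => F z * z ^+ n.+1).
  by move=> z z1; apply: cholM; [exact: hF|exact: cholX].
have := circ_mean hg (r := r) ltac:(by rewrite (ltW r0)).
rewrite exprS mul0r !mulr0 => h.
rewrite (@eq_Ic _ _ _ _ (fun t => (r ^- n.+1)%:C * (F (cir r t) * cir r t ^+ n.+1))).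
  rewrite IcZ ?h ?mulr0//; apply: ic_cont => x _.
  by apply: (dholo_ccont _ hg); rewrite (ltW r0).
move=> t _; rewrite /cir exprMn mulrCA; congr (_ * _).
rewrite mulrA -rmorphXn -rmorphM mulVf ?mul1r//.
by rewrite expf_neq0// gt_eqF.
Qed.

Lemma dholo_bd F r : dholo F -> 0 <= r < 1 ->
  exists M, forall t, 0 <= t <= tp -> nm (F (cir r t)) <= M.
Proof.
move=> hF hr; have [M hM] := @cont_bounded _ 0 tp (fun t => nm (F (cir r t)))
   (fun x _ => ccont_nm (dholo_ccont x hF hr)).
by exists M => t /hM; rewrite ger0_norm ?nm_ge0.
Qed.

(** Cauchy's estimate, on the circle of radius max(r, 1/2) because [coefE] asks for a positive
    radius. *)
Lemma coef_pbd F : dholo F -> pbd (coef F).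
Proof.
move=> hF r /andP[r0 r1]; pose s := Num.max r (1 / 2).
have s0 : 0 < s by rewrite lt_max; apply/orP; right; lra.
have s1 : s < 1 by rewrite gt_max r1; lra.
have s01 : 0 <= s < 1 by rewrite (ltW s0).
have [M hM] := dholo_bd hF s01; exists M => n.
apply: (@le_trans _ _ (nm (coef F n) * s ^+ n)).
  by rewrite ler_wpM2l ?nm_ge0// lerXn2r ?nnegrE ?(ltW s0)// le_max lexx.
have h : tp * (nm (coef F n) * s ^+ n) <= tp * M.
  have <- : nm (tp%:C * (coef F n * (s ^+ n)%:C)) = tp * (nm (coef F n) * s ^+ n).
    by rewrite !nmM !nmR !ger0_norm ?exprn_ge0 ?(ltW s0)// ?tp_ge0.
  rewrite -coefE ?s0//; have -> : tp * M = M * (tp - 0) by rewrite subr0 mulrC.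
  apply: Ic_nm_bd; first exact: tp_ge0.
    apply: ic_cont => x _; apply: ccontM; first exact: dholo_ccont.
    apply: (ccont_chol (u := fun y => expi (- y)) (f := fun z => z ^+ n)); last exact: cholX.
    have -> : (fun y => expi (- y)) = (fun y => conjc (expi y : C)).
      by apply/funext => y; rewrite conj_expi.
    exact: ccont_conj (ccont_expi _).
  by move=> t ht; rewrite nmM nmX nm_expi expr1n mulr1; exact: hM.
by move: h; rewrite ler_pM2l ?tp_gt0.
Qed.

End CircleMeans.

(** * The Poisson kernel *)

Section Poisson.
Context {R : realType}.
Local Notation C := R[i].
Local Notation tp := (2 * pi : R).
Implicit Types (a b r t x y th : R) (f : R -> R) (F : C -> C) (u : R -> C).

Definition pker t x : R := (1 - t ^+ 2) / (1 - 2 * t * cos x + t ^+ 2).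

Lemma pden_ge t x : 0 <= t -> (1 - t) ^+ 2 <= 1 - 2 * t * cos x + t ^+ 2.
Proof.
move=> t0; have := cos_le1 x; have := cos_geN1 x; nra.
Qed.
Lemma pden_gt0 t x : 0 <= t < 1 -> 0 < 1 - 2 * t * cos x + t ^+ 2.
Proof.
move=> /andP[t0 t1]; apply: lt_le_trans (pden_ge x t0).
by rewrite exprn_gt0// subr_gt0.
Qed.
Lemma pker_ge0 t x : 0 <= t < 1 -> 0 <= pker t x.
Proof.
move=> t01; rewrite divr_ge0 ?(ltW (pden_gt0 _ t01))//.
by case/andP: t01 => t0 t1; rewrite subr_ge0 exprn_ile1// ltW.
Qed.
Lemma pker_le t x : 0 <= t < 1 -> pker t x <= (1 + t) / (1 - t).
Proof.
move=> t01; rewrite /pker ler_pdivrMr ?pden_gt0//; case/andP: t01 => t0 t1.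
have d0 : 0 < 1 - t by rewrite subr_gt0.
apply: (@le_trans _ _ ((1 + t) / (1 - t) * (1 - t) ^+ 2)).
  by rewrite le_eqVlt; apply/orP; left; apply/eqP; field; rewrite gt_eqF.
by rewrite ler_wpM2l ?pden_ge// divr_ge0 ?(ltW d0)// addr_ge0.
Qed.
Lemma pkerN t x : pker t (- x) = pker t x.
Proof. by rewrite /pker cosN. Qed.

Lemma pker_cont t x : 0 <= t < 1 -> {for x, continuous (pker t)}.
Proof.
move=> t01; apply: continuousM; first exact: cvg_cst.
apply: continuousV; first by rewrite gt_eqF// pden_gt0.
apply: continuousD; last exact: cvg_cst.
apply: continuousB; first exact: cvg_cst.
apply: continuousM; first exact: cvg_cst.
exact: continuous_cos.
Qed.

Lemma pker_shift_cont t th x : 0 <= t < 1 -> {for x, continuous (fun s => pker t (th - s))}.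
Proof.
move=> t01; apply: (@continuous_comp _ _ _ (fun s => th - s) (pker t)).
  by apply: continuousB; [exact: cvg_cst|exact: cvg_id].
exact: pker_cont.
Qed.

Lemma cir_neq1 t x : 0 <= t < 1 -> cir t x != 1.
Proof.
move=> /andP[t0 t1]; apply/eqP => h.
by move: t1; rewrite -(nm_cir x t0) h nm1 ltxx.
Qed.

Lemma geo_sumE (z : C) n : z != 1 -> \sum_(k < n) z ^+ k = (1 - z)^-1 - z ^+ n * (1 - z)^-1.
Proof.
move=> z1; have z10 : 1 - z != 0 by rewrite subr_eq0 eq_sym.
apply: (mulfI z10); rewrite mulrBr mulfV// mulrCA mulfV// mulr1.
by rewrite -opprB mulNr -subrX1 opprB.
Qed.

Lemma pkerE t x : 0 <= t < 1 -> (pker t x)%:C =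
  (1 - cir t x)^-1 + conjc (cir t x) * (1 - conjc (cir t x))^-1 :> C.
Proof.
move=> t01; have [t0 _] := andP t01.
have z1 : 1 - cir t x != 0 by rewrite subr_eq0 eq_sym cir_neq1.
have z2 : 1 - conjc (cir t x) != 0.
  by rewrite -(rmorph1 (@conjc R)) -rmorphB conjc_eq0.
have zz : (1 - cir t x) * (1 - conjc (cir t x)) = (1 - 2 * t * cos x + t ^+ 2)%:C.
  have -> : (1 - cir t x) * (1 - conjc (cir t x)) =
    1 - (cir t x + conjc (cir t x)) + cir t x * conjc (cir t x) by ring.
  rewrite mul_conj nm_cir//; apply: complex_eqP; rewrite /cir /=; ring.
have tt : cir t x * conjc (cir t x) = (t ^+ 2)%:C by rewrite mul_conj nm_cir.
have -> : (pker t x)%:C = (1 - t ^+ 2)%:C * ((1 - 2 * t * cos x + t ^+ 2)%:C)^-1 :> C.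
  by rewrite /pker rmorphM fmorphV.
have -> : (1 - t ^+ 2)%:C = 1 - (t ^+ 2)%:C :> C by rewrite rmorphB rmorph1.
by rewrite -zz -tt; field; rewrite z1 z2.
Qed.

Lemma pker_series t x n : 0 <= t < 1 ->
  nm ((pker t x)%:C - (\sum_(k < n) cir t x ^+ k + \sum_(k < n) conjc (cir t x) ^+ k.+1))
   <= 2 / (1 - t) * t ^+ n.
Proof.
move=> t01; have [t0 t1] := andP t01.
have c1 : conjc (cir t x) != 1 by rewrite -(rmorph1 (@conjc R)) (inj_eq (can_inj (@conjcK R))) cir_neq1.
have -> : \sum_(k < n) conjc (cir t x) ^+ k.+1 = conjc (cir t x) * \sum_(k < n) conjc (cir t x) ^+ k.
  by rewrite mulr_sumr; apply: eq_bigr => k _; rewrite exprS.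
rewrite !geo_sumE ?cir_neq1// pkerE//.
have nV (z : C) : nm z = t -> nm ((1 - z)^-1) <= (1 - t)^-1.
  move=> zt; rewrite nmV lef_pV2 ?posrE ?subr_gt0//.
    by have := nm_lerB 1 z; rewrite nm1 zt.
  by rewrite (lt_le_trans _ (nm_lerB _ _))// nm1 zt subr_gt0.
set z := cir t x; set w := conjc z.
have -> : (1 - z)^-1 + w * (1 - w)^-1 - ((1 - z)^-1 - z ^+ n * (1 - z)^-1 +
   w * ((1 - w)^-1 - w ^+ n * (1 - w)^-1)) = z ^+ n * (1 - z)^-1 + w * (w ^+ n * (1 - w)^-1).
  by ring.
have nz : nm z = t by rewrite nm_cir.
have nw : nm w = t by rewrite nm_conj.
apply: le_trans (nmD _ _) _; rewrite !nmM !nmX nz nw.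
have h1 := nV z nz; have h2 := nV w nw.
have tn : 0 <= t ^+ n by rewrite exprn_ge0.
have -> : 2 / (1 - t) * t ^+ n = t ^+ n * (1 - t)^-1 + 1 * (t ^+ n * (1 - t)^-1) by ring.
apply: lerD; first by rewrite ler_wpM2l.
by apply: ler_pM; rewrite ?mulr_ge0 ?nm_ge0 ?(ltW t1) ?ler_wpM2l.
Qed.

Lemma ic_mulbd a b (c : R -> C) u (M : R) :
  measurable_fun `[a, b] (fun x => complex.Re (c x)) ->
  measurable_fun `[a, b] (fun x => complex.Im (c x)) ->
  (forall x, a <= x <= b -> nm (c x) <= M) -> ic a b u -> ic a b (fun x => c x * u x).
Proof.
move=> mr mi cM hu; have hn := iiZ M (ii_nm hu).
have [/ii_meas h1 /ii_meas h2] := hu.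
have bd x : a <= x <= b -> nm (c x * u x) <= M * nm (u x).
  by move=> xab; rewrite nmM ler_wpM2r ?nm_ge0 ?cM.
split; apply: (ii_le _ hn).
- have -> : (fun x => complex.Re (c x * u x)) = (fun x =>
     complex.Re (c x) * complex.Re (u x) - complex.Im (c x) * complex.Im (u x)).
     by apply/funext => x; rewrite ReM.
  by apply: measurable_funB; exact: measurable_funM.
- by move=> x /bd; apply: le_trans; exact: Re_le_nm.
- have -> : (fun x => complex.Im (c x * u x)) = (fun x =>
     complex.Re (c x) * complex.Im (u x) + complex.Im (c x) * complex.Re (u x)).
     by apply/funext => x; rewrite ImM.
  by apply: measurable_funD; exact: measurable_funM.
- by move=> x /bd; apply: le_trans; exact: Im_le_nm.
Qed.

Lemma ic_mulcont a b (c : R -> C) u : (forall x, a <= x <= b -> ccont c x) ->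
  ic a b u -> ic a b (fun x => c x * u x).
Proof.
move=> cc; have [M hM] := cont_bounded (fun x xab => ccont_nm (cc x xab)).
apply: (@ic_mulbd _ _ _ _ M).
- by apply: cont_meas => x /cc/ccont_Re.
- by apply: cont_meas => x /cc/ccont_Im.
- by move=> x /hM; rewrite ger0_norm ?nm_ge0.
Qed.

Lemma ccontX (c : R -> C) n x : ccont c x -> ccont (fun y => c y ^+ n) x.
Proof. by move=> h; exact: (ccont_chol h (cholX n _)). Qed.

Lemma ccont_expiN x : ccont (fun y => expi (- y) : C) x.
Proof.
have -> : (fun y => expi (- y)) = (fun y => conjc (expi y : C)).
  by apply/funext => y; rewrite conj_expi.
exact: ccont_conj (ccont_expi _).
Qed.

Lemma cir_conj r x : conjc (cir r x) = r%:C * expi (- x).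
Proof. by apply: complex_eqP; rewrite /= ?cosN ?sinN; ring. Qed.

(** The kernel is the sum of t^|k| e^(ik(th - s)) over all integers k. Truncating it leaves a
    uniform error of order t^n, which multiplies the L^1 norm of [u]. *)
Lemma poisson_fourier t th u n : 0 <= t < 1 -> ic 0 tp u ->
  nm (Ic 0 tp (fun s => (pker t (th - s))%:C * u s) -
   (\sum_(k < n) cir t th ^+ k * Ic 0 tp (fun s => expi (- s) ^+ k * u s) +
    \sum_(k < n) conjc (cir t th) ^+ k.+1 * Ic 0 tp (fun s => expi s ^+ k.+1 * u s)))
  <= 2 / (1 - t) * t ^+ n * Ir 0 tp (fun s => nm (u s)).
Proof.
move=> t01 hu.
have i1 k : ic 0 tp (fun s => expi (- s) ^+ k * u s).
  by apply: ic_mulcont => // x _; exact/ccontX/ccont_expiN.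
have i2 k : ic 0 tp (fun s => expi s ^+ k.+1 * u s).
  by apply: ic_mulcont => // x _; exact/ccontX/ccont_expi.
have i1' k := icZ (cir t th ^+ k) (i1 k).
have i2' k := icZ (conjc (cir t th) ^+ k.+1) (i2 k).
have i3 : ic 0 tp (fun s => (pker t (th - s))%:C * u s).
  by apply: ic_mulcont => // x _; apply: ccont_real; exact: pker_shift_cont.
have -> : \sum_(k < n) cir t th ^+ k * Ic 0 tp (fun s => expi (- s) ^+ k * u s) =
    Ic 0 tp (fun s => \sum_(k < n) cir t th ^+ k * (expi (- s) ^+ k * u s)).
  by rewrite (Ic_sum n i1'); apply: eq_bigr => k _; rewrite IcZ.
have -> : \sum_(k < n) conjc (cir t th) ^+ k.+1 * Ic 0 tp (fun s => expi s ^+ k.+1 * u s) =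
    Ic 0 tp (fun s => \sum_(k < n) conjc (cir t th) ^+ k.+1 * (expi s ^+ k.+1 * u s)).
  by rewrite (Ic_sum n i2'); apply: eq_bigr => k _; rewrite IcZ.
have s1 := ic_sum n i1'; have s2 := ic_sum n i2'.
rewrite -IcD// -IcB//; last exact: icD.
apply: le_trans (Ic_nm (icB i3 (icD s1 s2))) _.
rewrite -IrZ; last exact: ii_nm.
apply: Ir_le; [exact: ii_nm (icB i3 (icD s1 s2))|by apply: iiZ; exact: ii_nm|].
move=> s _.
have -> : \sum_(k < n) cir t th ^+ k * (expi (- s) ^+ k * u s) =
  (\sum_(k < n) cir t (th - s) ^+ k) * u s.
  rewrite mulr_suml; apply: eq_bigr => k _.
  by rewrite mulrA -exprMn /cir expiD mulrA.
have -> : \sum_(k < n) conjc (cir t th) ^+ k.+1 * (expi s ^+ k.+1 * u s) =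
  (\sum_(k < n) conjc (cir t (th - s)) ^+ k.+1) * u s.
  rewrite mulr_suml; apply: eq_bigr => k _; rewrite mulrA -exprMn; congr (_ ^+ _ * _).
  by rewrite !cir_conj opprB addrC expiD mulrA.
rewrite -mulrDl -mulrBl nmM ler_wpM2r ?nm_ge0//.
exact: pker_series.
Qed.

Lemma Ic_conj a b u : ic a b u -> Ic a b (fun x => conjc (u x)) = conjc (Ic a b u).
Proof.
move=> [h1 h2]; apply: complex_eqP; rewrite ?Re_conj ?Im_conj /=.
  by apply: eq_Ir => x _; rewrite Re_conj.
rewrite -mulN1r -IrZ//; apply: eq_Ir => x _; by rewrite Im_conj mulN1r.
Qed.

Lemma Ic_expi k : Ic 0 tp (fun s => expi s ^+ k.+1 : C) = 0.
Proof.
have h : 0 <= (1 / 2 : R) < 1 by apply/andP; split; lra.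
have := @coef_neg R (fun=> 1) k (1 / 2) (fun z _ => chol_cst 1 z) h.
by rewrite (@eq_Ic _ _ _ _ (fun s => expi s ^+ k.+1))// => t _; rewrite mul1r.
Qed.

Lemma Ic_expiN k : Ic 0 tp (fun s => expi (- s) ^+ k.+1 : C) = 0.
Proof.
have h : ic 0 tp (fun s => expi s ^+ k.+1 : C).
  by apply: ic_cont => x _; exact/ccontX/ccont_expi.
rewrite -(conjc0 R) -(Ic_expi k) -Ic_conj//.
by apply: eq_Ic => x _; rewrite -conj_expi; apply/esym; exact: rmorphXn.
Qed.

Lemma ii_pker t th f : 0 <= t < 1 -> ii 0 tp f -> ii 0 tp (fun s => pker t (th - s) * f s).
Proof.
move=> t01 hf; have hu : ic 0 tp (fun s => (f s)%:C) by split => //; exact: ii_cst.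
have [h _] := ic_mulcont (c := fun s => (pker t (th - s))%:C)
  (fun x _ => ccont_real (@pker_shift_cont t th x t01)) hu.
by apply: eq_ii h => x _; rewrite ReM /=; ring.
Qed.

(** [poisson_fourier] applied to the constant 1, all of whose Fourier coefficients but one
    vanish. *)
Lemma Ir_pker t th : 0 <= t < 1 -> Ir 0 tp (fun s => pker t (th - s)) = tp.
Proof.
move=> t01; have c1 : ic 0 tp (fun=> 1 : C) := ic_cst _ _ _.
have key : Ic 0 tp (fun s => (pker t (th - s))%:C * 1) = (tp%:C : C).
  apply/eqP; rewrite -subr_eq0 -nm_eq0 eq_le nm_ge0 andbT.
  apply: (@le0_eps _ _ 1) => e e0; rewrite mul1r.
  have [N hN] := geo_small (2 / (1 - t) * Ir 0 tp (fun s => nm (1 : C))) t01 e0.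
  have := poisson_fourier th N.+1 t01 c1.
  rewrite big_ord_recl expr0 mul1r big1; last first.
    move=> i _; rewrite (@eq_Ic _ _ _ _ (fun s => expi (- s) ^+ (bump 0 i))); last first.
      by move=> x _; rewrite mulr1.
    by rewrite /bump /= add1n Ic_expiN mulr0.
  rewrite big1; last first.
    move=> i _; rewrite (@eq_Ic _ _ _ _ (fun s => expi s ^+ i.+1)); last first.
      by move=> x _; rewrite mulr1.
    by rewrite Ic_expi mulr0.
  rewrite !addr0 (@eq_Ic _ _ _ (fun s => expi (- s) ^+ 0 * 1) (fun=> 1)); last first.
    by move=> x _; rewrite expr0 mulr1.
  rewrite Ic_cst ?tp_ge0// subr0 mul1r => /le_trans; apply; apply/ltW.
  by apply: le_lt_trans (hN N.+1 (leqnSn N)); rewrite mulrAC.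
transitivity (complex.Re (tp%:C : C)); last by [].
by rewrite -key; apply: eq_Ir => x _; rewrite ReM /= mulr1 mulr0 subr0.
Qed.

(** Negative frequencies vanish by [coef_neg], the others are Taylor coefficients by [coefE]. That
    the series sums to [F] is not known yet; [holo_expansion] deduces it from this identity. *)
Lemma poisson_holo F t r th : dholo F -> 0 <= t < 1 -> 0 < r < 1 ->
  Ic 0 tp (fun s => (pker t (th - s))%:C * F (cir r s)) =
  tp%:C * psum (coef F) (cir (t * r) th).
Proof.
move=> hF t01 r01; have [t0 t1] := andP t01; have [r0 r1] := andP r01.
have r01' : 0 <= r < 1 by rewrite (ltW r0).
have hu : ic 0 tp (fun s => F (cir r s)) by apply: ic_cont => x _; exact: dholo_ccont.
have tr : 0 <= t * r < 1.
  by rewrite mulr_ge0 ?(ltW r0)//= (le_lt_trans _ t1)// ler_piMr// ltW.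
apply/eqP; rewrite -subr_eq0 -nm_eq0 eq_le nm_ge0 andbT.
apply: (@le0_eps _ _ (1 + tp)) => e e0; rewrite [leRHS]mulrDl [1 * e]mul1r.
have [N hN] := geo_small (2 / (1 - t) * Ir 0 tp (fun s => nm (F (cir r s)))) t01 e0.
have [N' hN'] := psum_tail (coef_pbd hF) tr e0.
pose n := maxn N N'.
have := poisson_fourier th n t01 hu.
have -> : \sum_(k < n) conjc (cir t th) ^+ k.+1 *
    Ic 0 tp (fun s => expi s ^+ k.+1 * F (cir r s)) = 0.
  apply: big1 => i _; rewrite (@eq_Ic _ _ _ _ (fun s => F (cir r s) * expi s ^+ i.+1)); last first.
    by move=> x _; rewrite mulrC.
  by rewrite coef_neg// mulr0.
rewrite addr0.
have -> : \sum_(i < n) cir t th ^+ i * Ic 0 tp (fun s => expi (- s) ^+ i * F (cir r s)) =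
   tp%:C * \sum_(i < n) coef F i * cir (t * r) th ^+ i.
  rewrite mulr_sumr; apply: eq_bigr => i _.
  rewrite (@eq_Ic _ _ _ _ (fun s => F (cir r s) * expi (- s) ^+ i)); last first.
    by move=> x _; rewrite mulrC.
  rewrite coefE//.
  have -> : cir (t * r) th ^+ i = cir t th ^+ i * (r ^+ i)%:C.
    by rewrite [t * r]mulrC cirM exprMn rmorphXn mulrC.
  ring.
set J := Ic _ _ _; set S := \sum_(i < n) _ => h1.
have h2 : nm (tp%:C * S - tp%:C * psum (coef F) (cir (t * r) th)) <= tp * e.
  rewrite -mulrBr nmM nmR ger0_norm ?tp_ge0// ler_wpM2l ?tp_ge0// nm_distC.
  by apply: hN' => //; [exact: leq_maxr|rewrite nm_cir//; case/andP: tr].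
apply: le_trans (nm_tri _ (tp%:C * S) _) _; apply: lerD h2.
apply: le_trans h1 _; apply: ltW; apply: le_lt_trans (hN n (leq_maxl _ _)).
by rewrite mulrAC.
Qed.

End Poisson.

(** * Poisson integrals at Lebesgue points *)

Section LebesguePoints.
Context {R : realType}.
Local Notation C := R[i].
Local Notation mu := (@lebesgue_measure R).
Local Notation tp := (2 * pi : R).
Implicit Types (r s t x y th : R) (u : R -> R).

Lemma sin_mvt x : 0 < x -> exists2 c, 0 < c < x & sin x = cos c * x.
Proof.
move=> x0; have [|c] := @MVT R sin cos 0 x x0.
  by apply: continuous_subspaceT; exact: continuous_sin.
by rewrite in_itv /= sin0 !subr0 => hc ->; exists c.
Qed.

Lemma sin_le_id x : 0 <= x -> sin x <= x.
Proof.
rewrite le_eqVlt => /predU1P[<-|x0]; first by rewrite sin0.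
have [c _ ->] := sin_mvt x0.
by rewrite -[leRHS]mul1r ler_wpM2r ?(ltW x0)// cos_le1.
Qed.

Lemma one_sub_cos x : 1 - cos x = 2 * sin (x / 2) ^+ 2.
Proof.
have {1}-> : x = (x / 2) *+ 2 by rewrite -mulr_natr; field.
by rewrite cos_mulr2n -mulr_natr; have := cos2Dsin2 (x / 2); lra.
Qed.

Lemma sin_ge_half x : 0 <= x <= 1 -> x / 2 <= sin x.
Proof.
move=> /andP[]; rewrite le_eqVlt => /predU1P[<- _|x0 x1]; first by rewrite sin0 mul0r.
have [c /andP[c0 cx] ->] := sin_mvt x0.
have h1 := sin_le_id (ltW (divr_gt0 c0 (ltr0n R 2))).
have h0 : 0 <= sin (c / 2).
  have c2 : 0 < c / 2 < 2 by apply/andP; split; lra.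
  exact: ltW (sin2_gt0 c2).
have h := one_sub_cos c.
have h3 : sin (c / 2) ^+ 2 <= (c / 2) ^+ 2 by rewrite lerXn2r ?nnegrE//; lra.
have h4 : (c / 2) ^+ 2 <= 1 / 4 by nra.
have h5 : 1 / 2 <= cos c by lra.
by rewrite mulrC ler_wpM2r ?(ltW x0)//; lra.
Qed.

Lemma one_sub_cos_ge y : `|y| <= 1 -> y ^+ 2 / 8 <= 1 - cos y.
Proof.
move=> y1; rewrite -cos_norm -[y ^+ 2]real_normK ?num_real//.
have y0 := normr_ge0 y; move: (`|y|) y0 y1 => x x0 x1.
rewrite one_sub_cos.
have h : x / 2 / 2 <= sin (x / 2) by apply: sin_ge_half; apply/andP; split; lra.
have : (x / 2 / 2) ^+ 2 <= sin (x / 2) ^+ 2 by rewrite lerXn2r ?nnegrE; lra.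
lra.
Qed.

Lemma cos_far d y : 0 < d <= pi -> d <= y <= tp - d -> cos y <= cos d.
Proof.
move=> /andP[d0 dpi] /andP[dy yd].
have [yp|yp] := leP y pi.
  by rewrite leNgt ltr_cos -?leNgt// in_itv /=; apply/andP; split; lra.
have -> : cos y = cos (tp - y).
  by rewrite cosB mulr_natl cos2pi sin2pi mul1r mul0r addr0.
by rewrite leNgt ltr_cos -?leNgt ?in_itv /=; first lra; apply/andP; split; lra.
Qed.

Lemma pker_far t y d : 1 / 2 <= t < 1 -> 0 < d <= pi -> d <= y <= tp - d -> cos d < 1 ->
  pker t y <= 2 * (1 - t) / (1 - cos d).
Proof.
move=> /andP[t2 t1] hd hy cd.
have cy := cos_far hd hy.
have t01 : 0 <= t < 1 by apply/andP; split; lra.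
rewrite /pker ler_pdivrMr ?pden_gt0//.
have c1 : 0 < 1 - cos d by lra.
have -> : 2 * (1 - t) / (1 - cos d) * (1 - 2 * t * cos y + t ^+ 2) =
   2 * (1 - t) * (1 - 2 * t * cos y + t ^+ 2) / (1 - cos d) by ring.
rewrite ler_pdivlMr//.
have h1 : 1 - cos d <= 1 - 2 * t * cos y + t ^+ 2.
  have := sqr_ge0 (1 - t); nra.
have -> : 1 - t ^+ 2 = (1 + t) * (1 - t) by ring.
have d0 : 0 < 1 - t by lra.
rewrite [(1 + t) * _]mulrC -!mulrA [leRHS]mulrCA ler_wpM2l ?(ltW d0)//.
by apply: ler_pM => //; lra.
Qed.

(** The denominator is (1 - t)^2 + 2t (1 - cos y), at least ((1 - t)^2 + y^2) / 8 when t >= 1/2, and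
    the numerator is at most 2 (1 - t): hence 16. *)
Lemma pker_near t y : 1 / 2 <= t < 1 -> `|y| <= 1 ->
  pker t y <= 16 * ((1 - t) / ((1 - t) ^+ 2 + y ^+ 2)).
Proof.
move=> /andP[t2 t1] y1; have h := one_sub_cos_ge y1.
have t01 : 0 <= t < 1 by apply/andP; split; lra.
have d0 : 0 < 1 - t by lra.
have y20 : 0 <= y ^+ 2 by exact: sqr_ge0.
have e0 : 0 < (1 - t) ^+ 2 + y ^+ 2 by rewrite ltr_wpDr// exprn_gt0.
rewrite /pker ler_pdivrMr ?pden_gt0//.
have -> : 16 * ((1 - t) / ((1 - t) ^+ 2 + y ^+ 2)) * (1 - 2 * t * cos y + t ^+ 2) =
  16 * (1 - t) * (1 - 2 * t * cos y + t ^+ 2) / ((1 - t) ^+ 2 + y ^+ 2) by ring.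
rewrite ler_pdivlMr//.
have h1 : (1 - t) ^+ 2 + y ^+ 2 / 8 <= 1 - 2 * t * cos y + t ^+ 2 by nra.
have -> : 1 - t ^+ 2 = (1 - t) * (1 + t) by ring.
rewrite [16 * _]mulrC -!mulrA ler_wpM2l ?(ltW d0)//.
have : (1 + t) * ((1 - t) ^+ 2 + y ^+ 2) <= 2 * ((1 - t) ^+ 2 + y ^+ 2).
  by rewrite ler_wpM2r ?(ltW e0)//; lra.
have := sqr_ge0 (1 - t); lra.
Qed.

Definition ball_ind th s x : R := if `|x - th| < s then 1 else 0.

Lemma ball_ind_ge0 th s x : 0 <= ball_ind th s x.
Proof. by rewrite /ball_ind; case: ifP. Qed.

Lemma shell_ge0 (c e : R) k th s x : 0 <= c -> 0 < e ->
  0 <= c * (1 / 4) ^+ k / e * ball_ind th s x.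
Proof.
move=> c0 e0; apply: mulr_ge0; last exact: ball_ind_ge0.
apply: divr_ge0; last exact: ltW.
by apply: mulr_ge0 => //; apply: exprn_ge0; lra.
Qed.

(** For |x - th| between 2^K e and 2^(K+1) e the left side is at most 4^(-K) / e, which is 4 times
    4^(-(K+1)) / e; this explains the factor 4. The remaining indicators only add nonnegative
    terms. *)
Lemma shell_bound th x (e : R) K : 0 < e -> `|x - th| < 2 ^+ K * e ->
  e / (e ^+ 2 + (th - x) ^+ 2) <=
  \sum_(k < K.+1) 4 * (1 / 4) ^+ k / e * ball_ind th (2 ^+ k * e) x.
Proof.
move=> e0; have e20 : 0 < e ^+ 2 by rewrite exprn_gt0.
have den : 0 < e ^+ 2 + (th - x) ^+ 2 by rewrite ltr_wpDr// sqr_ge0.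
have nn K' : 0 <= \sum_(k < K') 4 * (1 / 4) ^+ k / e * ball_ind th (2 ^+ k * e) x.
  by apply: sumr_ge0 => k _; exact: shell_ge0.
elim: K => [|K IH] h.
  rewrite big_ord_recl big_ord0 addr0 expr0 /= /ball_ind expr0 mul1r.
  rewrite expr0 mul1r in h; rewrite h !mulr1.
  rewrite ler_pdivrMr//.
  have -> : 4 / e * (e ^+ 2 + (th - x) ^+ 2) = 4 * e + 4 * (th - x) ^+ 2 / e.
    by field; rewrite gt_eqF.
  have : 0 <= 4 * (th - x) ^+ 2 / e by apply: divr_ge0; [apply: mulr_ge0 => //; exact: sqr_ge0|exact: ltW].
  lra.
rewrite big_ord_recr /=.
have [h1|h1] := ltP `|x - th| (2 ^+ K * e).
  by apply: le_trans (IH h1) _; rewrite lerDl; exact: shell_ge0.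
rewrite /ball_ind h mulr1.
apply: (@le_trans _ _ (4 * (1 / 4) ^+ K.+1 / e)); last by rewrite lerDr; exact: nn.
have h2 : (2 ^+ K * e) ^+ 2 <= (th - x) ^+ 2.
  rewrite -[leRHS]real_normK ?num_real// distrC lerXn2r ?nnegrE//.
  by rewrite mulr_ge0 ?exprn_ge0 ?(ltW e0).
have -> : 4 * (1 / 4 : R) ^+ K.+1 / e = e / ((2 ^+ K * e) ^+ 2).
  have p4 : (4 : R) ^+ K = 2 ^+ K * 2 ^+ K by rewrite -exprMn; congr (_ ^+ _); ring.
  have P0 : (2 : R) ^+ K != 0 by rewrite expf_neq0.
  rewrite div1r exprVn exprS p4; move: (2 ^+ K) P0 => P P0.
  by field; rewrite P0 gt_eqF.
rewrite ler_pM2l// lef_pV2 ?posrE ?exprn_gt0 ?mulr_gt0 ?exprn_gt0//.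
by apply: le_trans h2 _; rewrite lerDr ltW.
Qed.

(* Lebesgue points of [u], tested on the balls centred at [th]. *)
Definition wlp u th := forall eta, 0 < eta -> exists2 d, 0 < d & forall s, 0 < s <= d ->
  Ir 0 tp (fun x => ball_ind th s x * `|u x - u th|) <= eta * s.

Lemma ii_ball_ind th s u : ii 0 tp u -> ii 0 tp (fun x => ball_ind th s x * u x).
Proof.
move=> hu; apply: ii_le (ii_abs hu) _; last first.
  by move=> x _; rewrite /ball_ind; case: ifP => _; rewrite ?mul1r ?mul0r ?normr0.
apply: measurable_funM; last exact: ii_meas.
apply: measurable_funTS; rewrite /ball_ind; apply: measurable_fun_ifT => //.
apply: measurable_fun_ltr => //.
apply: measurableT_comp => //; apply: measurable_funB => //.
Qed.

Definition pint t u th : R := tp^-1 * Ir 0 tp (fun s => pker t (th - s) * u s).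

Lemma dyadic_exists (e d : R) : 0 < e <= d -> exists K, 2 ^+ K * e <= d < 2 ^+ K.+1 * e.
Proof.
move=> /andP[e0 ed].
have ex : exists n, d < 2 ^+ n * e.
  have h : 0 <= (1 / 2 : R) < 1 by apply/andP; split; lra.
  have [N hN] := geo_small d h e0; exists N.
  have := hN N (leqnn N); rewrite div1r exprVn ltr_pdivrMr ?exprn_gt0// mulrC.
  by [].
case: (ex_minnP ex) => -[|K] dK min.
  by move: dK; rewrite expr0 mul1r ltNge ed.
exists K; rewrite dK andbT leNgt; apply/negP => /min.
by rewrite ltnn.
Qed.

Lemma Ir_sum a b n (F : nat -> R -> R) : (forall k, ii a b (F k)) ->
  Ir a b (fun x => \sum_(k < n) F k x) = \sum_(k < n) Ir a b (F k) /\
  ii a b (fun x => \sum_(k < n) F k x).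
Proof.
move=> h; elim: n => [|n [IH1 IH2]].
  rewrite big_ord0; split; last by apply: eq_ii (ii_cst a b 0) => x _; rewrite big_ord0.
  by rewrite /Ir; under eq_Rintegral do rewrite big_ord0; rewrite /Rintegral integral0.
rewrite big_ord_recr /= -IH1 -IrD//; split.
  by apply: eq_Ir => x _; rewrite big_ord_recr.
by apply: eq_ii (iiD IH2 (h n)) => x _; rewrite big_ord_recr.
Qed.

(* Split the circle into dyadic shells [|x - th| ~ 2^k (1 - t)]: there the kernel is
   [O(4^-k / (1 - t))] while the oscillation of [u] integrates to [o(2^k (1 - t))]. *)
Lemma poisson_lebesgue u th : ii 0 tp u -> 0 < th < tp -> wlp u th ->
  forall e, 0 < e -> exists2 t0, t0 < 1 & forall t, t0 < t < 1 -> 0 <= t ->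
   `|pint t u th - u th| <= e.
Proof.
move=> hu /andP[th0 th1] hw e e0.
pose D := Ir 0 tp (fun x => `|u x - u th|).
have hd : ii 0 tp (fun x => `|u x - u th|) by apply: ii_abs; apply: iiB => //; exact: ii_cst.
have D0 : 0 <= D by apply: Ir_ge0.
(* 64 is 16 from [pker_near] times 4 from [shell_bound]; the shells then contribute 64 eta times the
   sum of 2^(-k), at most e / 2. *)
pose eta := e / (4 * 64).
have eta0 : 0 < eta by apply: divr_gt0 => //; apply: mulr_gt0; lra.
have [d' d'0 hd'] := hw _ eta0.
pose d := Num.min d' (Num.min 1 (Num.min th (tp - th))).
have d0 : 0 < d by rewrite !lt_min d'0 ltr01 th0 subr_gt0.
have dd' : d <= d' by rewrite ge_min lexx.
have d1 : d <= 1 by rewrite !ge_min lexx orbT.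
have dth : d <= th by rewrite !ge_min lexx !orbT.
have dth2 : d <= tp - th by rewrite !ge_min lexx !orbT.
pose d2 := d / 2.
have d20 : 0 < d2 by rewrite divr_gt0.
have dpi : d2 <= pi by have := @pi_ge2 R; rewrite /d2; lra.
have cd : cos d2 < 1.
  have h : `|d2| <= 1 by rewrite ger0_norm ?(ltW d20)// /d2; lra.
  have := one_sub_cos_ge h; have : 0 < d2 ^+ 2 by rewrite exprn_gt0.
  lra.
pose M := 2 / (1 - cos d2) * D.
have M0 : 0 <= M by rewrite mulr_ge0// divr_ge0//; lra.
pose t0 := Num.max (1 / 2) (Num.max (1 - d) (1 - e / (2 * (M + 1)))).
have M1 : 0 < M + 1 by lra.
exists t0.
  rewrite !gt_max; apply/and3P; split; [lra|lra|].
  by rewrite ltrBlDr ltrDl divr_gt0// mulr_gt0.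
move=> t /andP[]; rewrite !gt_max => /and3P[t2 td te] t1 tt0.
have t01 : 0 <= t < 1 by rewrite tt0.
have t21 : 1 / 2 <= t < 1 by rewrite (ltW t2).
pose ep := 1 - t; have ep0 : 0 < ep by rewrite subr_gt0.
(* The shells up to [K] stay within distance [d] but reach beyond d / 2, and from there on
   [pker_far] makes the kernel O(1 - t). *)
have [|K /andP[K1 K2]] := @dyadic_exists ep d; first by rewrite ep0 /ep; lra.
have ptw x : 0 <= x <= tp -> pker t (th - x) <=
    \sum_(k < K.+1) 64 * (1 / 4) ^+ k / ep * ball_ind th (2 ^+ k * ep) x +
    2 * ep / (1 - cos d2).
  move=> /andP[x0 x1].
  have [xk|xk] := ltP `|x - th| (2 ^+ K * ep).
    have y1 : `|th - x| <= 1.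
      by rewrite distrC (le_trans (ltW xk))// (le_trans K1).
    apply: le_trans (pker_near t21 y1) _.
    apply: (@le_trans _ _ (16 * \sum_(k < K.+1) 4 * (1 / 4) ^+ k / ep * ball_ind th (2 ^+ k * ep) x)).
      by rewrite ler_wpM2l// shell_bound.
    rewrite mulr_sumr -[leLHS]addr0 lerD//; last first.
      by rewrite divr_ge0 ?mulr_ge0 ?(ltW ep0)//; lra.
    apply: ler_sum => k _; rewrite le_eqVlt; apply/orP; left; apply/eqP; ring.
  have nn : 0 <= \sum_(k < K.+1) 64 * (1 / 4) ^+ k / ep * ball_ind th (2 ^+ k * ep) x.
    by apply: sumr_ge0 => k _; exact: shell_ge0.
  apply: (@le_trans _ _ (2 * ep / (1 - cos d2))); last by rewrite lerDr.
  have -> : pker t (th - x) = pker t `|x - th|.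
    by rewrite /pker -cos_norm distrC.
  apply: pker_far => //; first by rewrite d20.
  apply/andP; split.
    apply: le_trans xk; rewrite /d2; move: K2; rewrite exprS.
    by move: (2 ^+ K) => P; lra.
  by rewrite ler_norml /d2; apply/andP; split; lra.
have ibi k : ii 0 tp (fun x => (64 * (1 / 4) ^+ k / ep) *
    (ball_ind th (2 ^+ k * ep) x * `|u x - u th|)).
  by apply: iiZ; exact: ii_ball_ind.
have [Is iis] := Ir_sum K.+1 ibi.
have int1 : Ir 0 tp (fun x => pker t (th - x) * `|u x - u th|) <=
   \sum_(k < K.+1) 64 * (1 / 4) ^+ k / ep * (eta * (2 ^+ k * ep)) + M * ep.
  apply: (@le_trans _ _ (Ir 0 tp (fun x => \sum_(k < K.+1) (64 * (1 / 4) ^+ k / ep) *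
    (ball_ind th (2 ^+ k * ep) x * `|u x - u th|) + 2 * ep / (1 - cos d2) * `|u x - u th|))).
    apply: Ir_le; [exact: ii_pker|by apply: iiD => //; exact: iiZ|].
    move=> x hx; apply: le_trans (ler_wpM2r (normr_ge0 _) (ptw x hx)) _.
    rewrite mulrDl mulr_suml lerD2r; apply: ler_sum => k _.
    by rewrite mulrA.
  rewrite IrD//; last exact: iiZ.
  rewrite Is IrZ//; apply: lerD; last first.
    by rewrite /M -/D le_eqVlt; apply/orP; left; apply/eqP; ring.
  apply: ler_sum => k _; rewrite IrZ; last exact: ii_ball_ind.
  apply: ler_wpM2l.
    apply: divr_ge0; last exact: ltW.
    by apply: mulr_ge0 => //; apply: exprn_ge0; lra.
  apply: hd'; rewrite mulr_gt0 ?exprn_gt0//=.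
  apply: le_trans dd'; apply: le_trans K1; rewrite ler_wpM2r ?(ltW ep0)//.
  by rewrite ler_weXn2l ?ler1n// -ltnS ltn_ord.
have sum1 : \sum_(k < K.+1) 64 * (1 / 4) ^+ k / ep * (eta * (2 ^+ k * ep)) <= e / 2.
  apply: (@le_trans _ _ (64 * eta * \sum_(k < K.+1) (1 / 2 : R) ^+ k)).
    rewrite mulr_sumr; apply: ler_sum => k _; rewrite le_eqVlt; apply/orP; left; apply/eqP.
    have -> : (1 / 2 : R) ^+ k = (1 / 4) ^+ k * 2 ^+ k.
      by rewrite -exprMn; congr (_ ^+ _); field.
    by field; rewrite gt_eqF.
  have : \sum_(k < K.+1) (1 / 2 : R) ^+ k <= 2.
    have := subrX1 (1 / 2 : R) K.+1.
    have : 0 <= (1 / 2 : R) ^+ K.+1 by rewrite exprn_ge0// divr_ge0.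
    move: (\sum_(k < K.+1) _) ((1 / 2) ^+ K.+1) => S P; lra.
  by move=> /(ler_wpM2l (ltW eta0)); rewrite /eta; lra.
have far1 : M * ep <= e / 2.
  have : ep < e / (2 * (M + 1)) by rewrite /ep; lra.
  rewrite ltr_pdivlMr ?mulr_gt0// => h.
  have : M * ep <= (M + 1) * ep by rewrite ler_wpM2r ?(ltW ep0)// lerDl.
  lra.
have eqn : pint t u th - u th = tp^-1 * Ir 0 tp (fun x => pker t (th - x) * (u x - u th)).
  have -> : Ir 0 tp (fun x => pker t (th - x) * (u x - u th)) =
    Ir 0 tp (fun x => pker t (th - x) * u x) - u th * tp.
    have ip : ii 0 tp (fun x => pker t (th - x)).
      by apply: eq_ii (ii_pker th t01 (ii_cst 0 tp 1)) => x _; rewrite mulr1.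
    have -> : u th * tp = Ir 0 tp (fun x => u th * pker t (th - x)).
      by rewrite IrZ// Ir_pker.
    rewrite -IrB; [|exact: ii_pker|exact: iiZ].
    by apply: eq_Ir => x _; ring.
  rewrite mulrBr; congr (_ - _); rewrite mulrCA mulVf ?mulr1// gt_eqF// tp_gt0//.
rewrite eqn normrM ger0_norm ?invr_ge0 ?tp_ge0// ler_pdivrMl ?tp_gt0//.
apply: (@le_trans _ _ e); last first.
  have p1 : 1 <= tp by have := @pi_ge2 R; clear; lra.
  by rewrite ler_peMl ?(ltW e0).
have ig : ii 0 tp (fun x => pker t (th - x) * (u x - u th)).
  by apply: ii_pker => //; apply: iiB => //; exact: ii_cst.
apply: le_trans (Ir_abs ig) _.
apply: (@le_trans _ _ (Ir 0 tp (fun x => pker t (th - x) * `|u x - u th|))).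
  apply: Ir_le; [exact: ii_abs|exact: ii_pker|].
  by move=> x _; rewrite normrM (ger0_norm (pker_ge0 _ t01)).
by apply: le_trans int1 _; rewrite (splitr e) lerD.
Qed.

End LebesguePoints.

(** * Almost every angle is a Lebesgue point *)

Section AlmostEverywherePoisson.
Context {R : realType}.
Local Notation C := R[i].
Local Notation mu := (@lebesgue_measure R).
Local Notation tp := (2 * pi : R).
Implicit Types (r s t x y th : R) (u : R -> R).

Lemma wlp_lebesgue_pt u th : ii 0 tp u -> 0 < th < tp ->
  lebesgue_pt (u \_ `[0, tp]) th -> wlp u th.
Proof.
move=> hu /andP[th0 th1] hl eta eta0.
set g := u \_ `[0, tp] in hl.
have gth : g th = u th by rewrite /g patchE mem_set// /= in_itv /= !ltW.
have mg : measurable_fun setT g.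
  by apply/(measurable_restrictT _ _).1 => //; exact: ii_meas.
(* A ball of radius s has measure 2 s, hence the half. *)
have e20 : (0 < (eta / 2)%:E)%E by rewrite lte_fin divr_gt0.
have hn : nbhs (0%E : \bar R) [set y | (y < (eta / 2)%:E)%E].
  by apply: open_nbhs_nbhs; split => //; exact: open_ereal_lt_ereal.
have /nbhs_ballP[d /= d0 hd] := hl _ hn.
exists (d / 2); first by rewrite divr_gt0.
move=> s /andP[s0 sd].
have : (davg g th s < (eta / 2)%:E)%E.
  by apply: (hd s) => //; rewrite /ball /= sub0r normrN gtr0_norm//; lra.
rewrite /davg /iavg lebesgue_measure_ball ?(ltW s0)//.
set J := (\int[_]_(y in _) _)%E => hJ.
have J1 : (J <= (eta * s)%:E)%E.
  move: hJ; rewrite inver gt_eqF ?mulrn_wgt0// muleC lte_pdivrMr ?mulrn_wgt0//.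
  by rewrite -EFinM => /ltW/le_trans; apply; rewrite lee_fin -mulr_natr; lra.
have hdi : ii 0 tp (fun x => ball_ind th s x * `|u x - u th|).
  by apply: ii_ball_ind; apply: ii_abs; apply: iiB => //; exact: ii_cst.
rewrite -lee_fin /Ir /Rintegral fineK; last exact: integrable_fin_num.
apply: le_trans J1; rewrite /J integral_mkcond [in leRHS]integral_mkcond.
apply: ge0_le_integral => //.
- by move=> x _; rewrite patchE; case: ifP => // _; rewrite lee_fin mulr_ge0// ball_ind_ge0.
- by apply/(measurable_restrictT _ _).1 => //; apply/measurable_EFinP; exact: ii_meas.
- apply/(measurable_restrictT _ _).1; first exact: measurable_ball.
  apply: measurable_funTS; apply/measurable_EFinP; apply: measurableT_comp => //.
  by apply: measurable_funB.
- move=> x _; rewrite !patchE; case: ifP => [|_]; last first.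
    by case: ifP => // _; rewrite lee_fin.
  rewrite inE /= in_itv /= => hx; rewrite /ball_ind distrC.
  have [xb|xb] := ltP `|th - x| s; last first.
    by rewrite mul0r; case: ifP => // _; rewrite lee_fin.
  have -> : (x \in (ball th s : set R)) = true by exact: mem_set.
  by rewrite lee_fin mul1r gth /g patchE mem_set.
Qed.

Lemma ae_imp (P Q : R -> Prop) : (forall x, P x -> Q x) ->
  {ae mu, forall x, P x} -> {ae mu, forall x, Q x}.
Proof. by move=> h; apply: filterS; first exact: (ae_filter_ringOfSetsType mu). Qed.

Lemma ae_and (P Q : R -> Prop) : {ae mu, forall x, P x} -> {ae mu, forall x, Q x} ->
  {ae mu, forall x, P x /\ Q x}.
Proof. by move=> h1 h2; apply: filterI => //; exact: (ae_filter_ringOfSetsType mu). Qed.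

Lemma ae_poisson u : ii 0 tp u ->
  {ae mu, forall th, 0 < th < tp -> wlp u th}.
Proof.
move=> hu; have hl : locally_integrable setT (u \_ `[0, tp]).
  apply: open_integrable_locally; first exact: openT.
  have := hu; rewrite /ii integrable_mkcond//.
  by apply: eq_integrable => // x _; rewrite /= !patchE; case: ifP.
apply: (@ae_imp (lebesgue_pt (u \_ `[0, tp]))); last exact: lebesgue_differentiation hl.
by move=> th h th0; exact: wlp_lebesgue_pt.
Qed.

Lemma wlp_cont u th : ii 0 tp u -> {for th, continuous u} -> 0 < th < tp -> wlp u th.
Proof.
move=> hu cu th01; apply: wlp_lebesgue_pt => //.
apply: (@continuous_lebesgue_pt _ _ _ setT) => //.
- by split => //; exact: openT.
- by apply/(measurable_restrictT _ _).1 => //; exact: ii_meas.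
apply: eps_continuous => e e0; have [d d0 hd] := continuous_eps cu e0.
have /andP[th0 th1] := th01.
have inn x : 0 <= x <= tp -> (u \_ `[0, tp]) x = u x.
  by move=> hx; rewrite patchE mem_set//= in_itv.
exists (Num.min d (Num.min th (tp - th))); first by rewrite !lt_min d0 th0 subr_gt0.
move=> y; rewrite !lt_min => /and3P[y1 y2 y3].
rewrite !inn ?(ltW (hd y y1)) ?(ltW th0) ?(ltW th1)//.
by move: y2 y3; rewrite !ltr_norml => /andP[? ?] /andP[? ?]; apply/andP; split; lra.
Qed.

End AlmostEverywherePoisson.

(** * Taylor expansion in the disc from Poisson integrals *)

Section HoloExpansion.
Context {R : realType}.
Local Notation C := R[i].
Local Notation tp := (2 * pi : R).
Implicit Types (r s t x y th : R) (u : R -> C) (F : C -> C).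

Definition cpint t u th : C := (tp%:C)^-1 * Ic 0 tp (fun s => (pker t (th - s))%:C * u s).

Lemma tpV : ((tp%:C)^-1 : C) = (tp^-1)%:C. Proof. by rewrite fmorphV. Qed.

Lemma Re_cpint t u th : complex.Re (cpint t u th) = pint t (fun s => complex.Re (u s)) th.
Proof.
rewrite /cpint tpV ReM /= mul0r subr0 /pint; congr (_ * _).
by apply: eq_Ir => x _; rewrite ReM /= mul0r subr0.
Qed.
Lemma Im_cpint t u th : complex.Im (cpint t u th) = pint t (fun s => complex.Im (u s)) th.
Proof.
rewrite /cpint tpV ImM /= mul0r addr0 /pint; congr (_ * _).
by apply: eq_Ir => x _; rewrite ImM /= mul0r addr0.
Qed.

Lemma cpoisson_lebesgue u th : ic 0 tp u -> 0 < th < tp ->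
  wlp (fun s => complex.Re (u s)) th -> wlp (fun s => complex.Im (u s)) th ->
  forall e, 0 < e -> exists2 t0, t0 < 1 & forall t, t0 < t < 1 -> 0 <= t ->
   nm (cpint t u th - u th) <= e.
Proof.
move=> [h1 h2] hth w1 w2 e e0; have e2 : 0 < e / 2 by rewrite divr_gt0.
have [t1 t11 ht1] := poisson_lebesgue h1 hth w1 e2.
have [t2 t21 ht2] := poisson_lebesgue h2 hth w2 e2.
exists (Num.max t1 t2); first by rewrite gt_max t11.
move=> t /andP[]; rewrite gt_max => /andP[a b] c d.
have k1 := ht1 t ltac:(by rewrite a c) d.
have k2 := ht2 t ltac:(by rewrite b c) d.
apply: le_trans (nm_leD _) _; rewrite ReD ImD ReN ImN Re_cpint Im_cpint.
by rewrite (splitr e) lerD.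
Qed.

Lemma ccont_uniq u th : ccont u th -> (forall d, 0 < d -> exists y, `|y - th| < d /\ u y = 0) ->
  u th = 0.
Proof.
move=> cu h; apply/eqP; rewrite -nm_eq0; apply/negPn/negP => n0.
have np : 0 < nm (u th) by rewrite lt0r n0 nm_ge0.
have [d d0 hd] := cu _ np; have [y [yd y0]] := h d d0.
by have := hd y yd; rewrite y0 sub0r nmN ltxx.
Qed.

Lemma cpint_holo F t r th : dholo F -> 0 <= t < 1 -> 0 < r < 1 ->
  cpint t (fun s => F (cir r s)) th = psum (coef F) (cir (t * r) th).
Proof.
move=> hF t01 r01; rewrite /cpint poisson_holo//.
exact: mulKf tpC_neq0 _.
Qed.

(** Let t tend to 1 in [cpint_holo]: the Poisson integral tends to [F (cir r th)] since the circle
    function is continuous there, and the power series is continuous too. *)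
Lemma holo_expansion F r th : dholo F -> 0 < r < 1 -> 0 <= th <= tp ->
  F (cir r th) = psum (coef F) (cir r th).
Proof.
move=> hF r01 thc; have /andP[r0 r1] := r01.
have r01' : 0 <= r < 1 by rewrite (ltW r0).
have hP := coef_pbd hF.
have cP : dholo (psum (coef F)) by move=> z z1; exact: psum_cder.
have main th' : 0 < th' < tp -> F (cir r th') = psum (coef F) (cir r th').
  move=> hth; apply/eqP; rewrite -subr_eq0 -nm_eq0 eq_le nm_ge0 andbT.
  apply: (@le0_eps _ _ 2) => e e0.
  have hu : ic 0 tp (fun s => F (cir r s)) by apply: ic_cont => x _; exact: dholo_ccont.
  have hc := dholo_ccont th' hF r01'.
  have w1 := wlp_cont hu.1 (ccont_Re hc) hth.
  have w2 := wlp_cont hu.2 (ccont_Im hc) hth.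
  have [t0 t01 ht] := cpoisson_lebesgue hu hth w1 w2 e0.
  have [dd hdd] := cP (cir r th') ltac:(by rewrite nm_cir ?(ltW r0)).
  have [d d0 hd] := cder_cont hdd e0.
  pose t := Num.max (Num.max (1 / 2) ((1 + t0) / 2)) (1 - d / 2).
  have t1 : t < 1 by rewrite !gt_max; apply/andP; split; [apply/andP; split; lra|lra].
  have tt0 : t0 < t by rewrite !lt_max; apply/orP; left; apply/orP; right; lra.
  have tp0 : 0 <= t by rewrite !le_max; apply/orP; left; apply/orP; left; lra.
  have td : 1 - t < d.
    by have : 1 - d / 2 <= t; [rewrite !le_max lexx !orbT|lra].
  have k1 := ht t ltac:(by rewrite tt0) tp0.
  rewrite cpint_holo ?tp0// in k1.
  have k2 : nm (psum (coef F) (cir (t * r) th') - psum (coef F) (cir r th')) < e.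
    apply: hd; rewrite mulrC cirM -[X in _ - X](mulr1) /cir.
    have -> : r%:C * (t%:C * expi th') - r%:C * expi th' * 1 =
      - ((1 - t)%:C * (r%:C * expi th')) by rewrite rmorphB rmorph1; ring.
    rewrite nmN !nmM !nmR nm_expi mulr1 ger0_norm ?subr_ge0 ?(ltW t1)//.
    rewrite ger0_norm ?(ltW r0)//; apply: le_lt_trans td.
    by rewrite ler_piMr ?subr_ge0 ?(ltW t1) ?(ltW r1).
  apply: le_trans (nm_tri _ (psum (coef F) (cir (t * r) th')) _) _.
  rewrite mulr_natl mulr2n; apply: lerD; last exact: ltW k2.
  by rewrite nm_distC; exact: k1.
(* Convergence of Poisson integrals is available at interior angles only; 0 and 2 pi are reached by
   continuity. *)
have cd : ccont (fun x => F (cir r x) - psum (coef F) (cir r x)) th.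
  have -> : (fun x => F (cir r x) - psum (coef F) (cir r x)) =
    (fun x => F (cir r x) + (fun z => -1 * z) (psum (coef F) (cir r x))).
    by apply/funext => x; rewrite mulN1r.
  apply: ccontD; first exact: dholo_ccont.
  apply: ccontM; first exact: ccont_cst.
  exact: dholo_ccont.
apply/eqP; rewrite -subr_eq0; apply/eqP; apply: (ccont_uniq cd) => d d0.
have p2 := @pi_ge2 R.
have [/andP[h0 h1]|] := boolP (0 < th < tp).
  by exists th; rewrite subrr normr0 d0; split => //; rewrite main ?subrr// h0.
case/andP: thc => h0 h1; rewrite negb_and -!leNgt => h.
pose y := Num.min (d / 2) 1.
have y0 : 0 < y by rewrite lt_min ltr01 andbT divr_gt0.
have y1 : y <= 1 by rewrite ge_min lexx orbT.
have yd : y < d by rewrite gt_min; apply/orP; left; lra.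
have [e1|e1] : th = 0 \/ th = tp.
- by case/orP: h => h; [left|right]; lra.
- exists y; rewrite e1 subr0 gtr0_norm//; split => //.
  by rewrite main ?subrr//; apply/andP; split; lra.
- exists (tp - y); rewrite e1; split.
    by rewrite addrAC subrr add0r normrN gtr0_norm.
  by rewrite main ?subrr//; apply/andP; split; lra.
Qed.

Lemma cpint_dil F t r th : dholo F -> 0 < t < 1 -> 0 < r < 1 -> 0 <= th <= tp ->
  cpint t (fun s => F (cir r s)) th = F (cir (t * r) th).
Proof.
move=> hF /andP[t0 t1] r01 hth; rewrite cpint_holo ?(ltW t0)//.
apply/esym/holo_expansion => //; case/andP: r01 => r0 r1.
by rewrite mulr_gt0//= (lt_trans _ t1)// gtr_pMr.
Qed.

End HoloExpansion.

(** * Poisson integrals contract L^p *)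

Section PoissonContraction.
Context {R : realType}.
Local Notation C := R[i].
Local Notation mu := (@lebesgue_measure R).
Local Notation tp := (2 * pi : R).
Implicit Types (a b r s t x y th p : R) (u v f : R -> R) (F : C -> C).

Lemma EFin_Ir a b f : ii a b f -> (\int[mu]_(x in `[a, b]) (f x)%:E)%E = (Ir a b f)%:E.
Proof. by move=> hf; rewrite /Ir /Rintegral fineK//; exact: integrable_fin_num. Qed.

Lemma ii_ge0 a b f : measurable_fun `[a, b] f -> (forall x, a <= x <= b -> 0 <= f x) ->
  (\int[mu]_(x in `[a, b]) (f x)%:E < +oo)%E -> ii a b f.
Proof.
move=> mf f0 h; apply/integrableP; split; first exact/measurable_EFinP.
apply: le_lt_trans h; rewrite le_eqVlt; apply/orP; left; apply/eqP.
apply: eq_integral => x; rewrite inE /= in_itv /= => hx.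
by rewrite ger0_norm// f0.
Qed.

Lemma Ir_pker_l t s : 0 <= t < 1 -> Ir 0 tp (fun th => pker t (th - s)) = tp.
Proof.
move=> t01; rewrite -[RHS](Ir_pker s t01); apply: eq_Ir => x _.
by rewrite -pkerN opprB.
Qed.

(** The kernel has mass 2 pi in either variable. Cutoffs replace the domain so that Tonelli applies
    on the whole plane; it also supplies the measurability of [pint t v]. *)
Lemma pint_tonelli t v : 0 <= t < 1 -> ii 0 tp v -> (forall x, 0 <= x <= tp -> 0 <= v x) ->
  ii 0 tp (pint t v) /\ Ir 0 tp (pint t v) = Ir 0 tp v.
Proof.
move=> t01 hv v0.
pose D := `[0, tp]%classic : set R.
have mD : measurable (D : set (measurableTypeR R)) by exact: measurable_itv.
pose vD := v \_ D; pose iD : R -> R := (fun=> 1 : R) \_ D.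
have mv : measurable_fun setT vD.
  by apply/(measurable_restrictT _ _).1 => //; exact: ii_meas.
have mi : measurable_fun setT iD by apply/(measurable_restrictT _ _).1.
have inD x : (x \in D) = (0 <= x <= tp).
  by apply/idP/idP; rewrite inE /D /= in_itv.
have vD0 x : 0 <= vD x.
  by rewrite /vD patchE; case: ifP => //; rewrite inD => /v0.
have iD0 x : 0 <= iD x by rewrite /iD patchE; case: ifP.
pose f (z : R * R) := (iD z.1 * pker t (z.1 - z.2) * vD z.2)%:E.
have mf : measurable_fun setT f.
  apply/measurable_EFinP; apply: measurable_funM; last exact: measurableT_comp.
  apply: measurable_funM; first exact: measurableT_comp.
  apply: (measurableT_comp (f := pker t)); last exact: measurable_funB.
  by apply: continuous_measurable_fun => x; exact: pker_cont.
have f0 z : (0 <= f z)%E.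
  by rewrite lee_fin; apply: mulr_ge0 => //; apply: mulr_ge0 => //; exact: pker_ge0.
have := @fubini_tonelli _ _ _ _ _ mu mu f mf f0.
have mF := @measurable_fun_fubini_tonelli_F _ _ _ _ _ mu f mf f0.
have FE x : (\int[mu]_y f (x, y))%E = (iD x * (tp * pint t v x))%:E.
  transitivity (\int[mu]_(y in D) (iD x * (pker t (x - y) * v y))%:E)%E.
    rewrite [RHS]integral_mkcond; apply: eq_integral => y _.
    by rewrite /f /= patchE /vD patchE; case: ifP => _; rewrite ?mulr0 ?mulrA.
  rewrite EFin_Ir; last by apply: iiZ; exact: ii_pker.
  by rewrite IrZ; [rewrite /pint mulVKf// gt_eqF ?tp_gt0|exact: ii_pker].
have GE y : (\int[mu]_x f (x, y))%E = (tp * vD y)%:E.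
  transitivity (\int[mu]_(x in D) (vD y * pker t (x - y))%:E)%E.
    rewrite [RHS]integral_mkcond; apply: eq_integral => x _.
    rewrite /f /= patchE /iD patchE; case: ifP => _; rewrite ?mul0r//.
    by rewrite mul1r mulrC.
  have ip : ii 0 tp (fun x => pker t (x - y)).
    apply: (eq_ii (f := fun x => pker t (y - x) * 1)) => [x _|]; last exact/ii_pker/ii_cst.
    by rewrite mulr1 -pkerN opprB.
  by rewrite (EFin_Ir (iiZ (vD y) ip)) (IrZ (vD y) ip) (Ir_pker_l y t01) mulrC.
under eq_integral do rewrite FE.
under [in X in _ = X -> _]eq_integral do rewrite GE.
have -> : (\int[mu]_x (iD x * (tp * pint t v x))%:E)%E = (\int[mu]_(x in D) (tp * pint t v x)%:E)%E.
  rewrite [RHS]integral_mkcond; apply: eq_integral => x _.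
  by rewrite patchE /iD patchE; case: ifP => _; rewrite ?mul1r ?mul0r.
have -> : (\int[mu]_y (tp * vD y)%:E)%E = (tp * Ir 0 tp v)%:E.
  rewrite -IrZ// -EFin_Ir; last exact: iiZ.
  rewrite [RHS]integral_mkcond; apply: eq_integral => x _.
  by rewrite patchE /vD patchE; case: ifP => _; rewrite ?mulr0.
move=> E.
have pint0 x : 0 <= pint t v x.
  apply: mulr_ge0; first by rewrite invr_ge0 tp_ge0.
  by apply: Ir_ge0 => s hs; rewrite mulr_ge0 ?pker_ge0 ?v0.
have mp : measurable_fun D (fun x => tp * pint t v x).
  apply/measurable_EFinP; have := measurable_funTS mF (D := D).
  apply: eq_measurable_fun => x xD; rewrite /fubini_F FE /iD patchE.
  by rewrite xD mul1r.
have itp : ii 0 tp (fun x => tp * pint t v x).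
  apply: ii_ge0 => //; first by move=> x _; apply: mulr_ge0 => //; exact: tp_ge0.
  by rewrite [X in (X < _)%E]E ltry.
have ip : ii 0 tp (pint t v).
  apply: eq_ii (iiZ tp^-1 itp) => x _; rewrite mulKf// gt_eqF ?tp_gt0//.
split=> //.
move: E; rewrite EFin_Ir// IrZ// => -[] /(mulfI _); apply.
by rewrite gt_eqF ?tp_gt0.
Qed.

(** The convex function x^p lies above its tangent at [c]: this is Young's inequality for the
    product of x and c^(p-1). *)
Lemma powR_tangent p x c : 1 < p -> 0 <= x -> 0 <= c ->
  c `^ p + p * c `^ (p - 1) * (x - c) <= x `^ p.
Proof.
move=> p1 x0 c0; have p0 : 0 < p by lra.
have pn : p != 0 by rewrite gt_eqF.
have p1n : p - 1 != 0 by rewrite gt_eqF// subr_gt0.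
pose q := p / (p - 1).
have q0 : 0 < q by rewrite divr_gt0// subr_gt0.
have pq : p^-1 + q^-1 = 1 by rewrite /q; field; rewrite pn p1n.
have := conjugate_powR x0 (powR_ge0 c (p - 1)) p0 q0 pq.
rewrite -powRrM; have -> : (p - 1) * q = p by rewrite /q; field.
have cc : c * c `^ (p - 1) = c `^ p by exact: mulr_powRB1.
have -> : c `^ p / q = (p - 1) * (c `^ p / p) by rewrite /q; field; rewrite pn p1n.
move=> /(ler_wpM2l (ltW p0)); rewrite mulrDr [p * (x `^ p / p)]mulrC divfK//.
rewrite [p * ((p - 1) * _)]mulrCA [p * (c `^ p / p)]mulrC divfK//.
rewrite mulrBr -[p * c `^ (p - 1) * c]mulrA [c `^ (p - 1) * c]mulrC cc.
move: (c `^ p) (x `^ p) (c `^ (p - 1)) => A B E; lra.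
Qed.

Lemma pint_ge0 t v th : 0 <= t < 1 -> (forall x, 0 <= x <= tp -> 0 <= v x) -> 0 <= pint t v th.
Proof.
move=> t01 v0; apply: mulr_ge0; first by rewrite invr_ge0 tp_ge0.
by apply: Ir_ge0 => s hs; rewrite mulr_ge0 ?pker_ge0 ?v0.
Qed.

(* Integrating the tangent inequality at [pint t u th] against the kernel gives Jensen. *)
Lemma pint_jensen p t u th : 1 < p -> 0 <= t < 1 -> (forall x, 0 <= x <= tp -> 0 <= u x) ->
  ii 0 tp u -> ii 0 tp (fun x => u x `^ p) ->
  pint t u th `^ p <= pint t (fun x => u x `^ p) th.
Proof.
move=> p1 t01 u0 hu hup; set c := pint t u th.
have c0 : 0 <= c := pint_ge0 th t01 u0.
have tp0 := @tp_gt0 R.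
have tpn : tp != 0 by rewrite gt_eqF.
pose K := p * c `^ (p - 1).
have i1 := ii_pker th t01 hup.
have i2 := ii_pker th t01 hu.
have i0 : ii 0 tp (fun s => pker t (th - s)).
  by apply: eq_ii (ii_pker th t01 (ii_cst 0 tp 1)) => x _; rewrite mulr1.
have : Ir 0 tp (fun s => (c `^ p - K * c) * pker t (th - s) + K * (pker t (th - s) * u s)) <=
   Ir 0 tp (fun s => pker t (th - s) * u s `^ p).
  apply: Ir_le => //; first by apply: iiD; exact: iiZ.
  move=> s hs; have := powR_tangent p1 (u0 s hs) c0.
  move=> /(ler_wpM2l (pker_ge0 (th - s) t01)); apply: le_trans.
  by rewrite /K le_eqVlt; apply/orP; left; apply/eqP; ring.
rewrite IrD; [|exact: iiZ|exact: iiZ].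
rewrite IrZ// IrZ// Ir_pker//.
have cE : Ir 0 tp (fun s => pker t (th - s) * u s) = tp * c by rewrite /c /pint mulVKf.
rewrite cE /pint ler_pdivlMl// => h; apply: le_trans h.
by rewrite le_eqVlt; apply/orP; left; apply/eqP; ring.
Qed.

Lemma pint_contract p t u : 1 < p -> 0 <= t < 1 -> (forall x, 0 <= x <= tp -> 0 <= u x) ->
  ii 0 tp u -> ii 0 tp (fun x => u x `^ p) ->
  ii 0 tp (fun th => pint t u th `^ p) /\
  Ir 0 tp (fun th => pint t u th `^ p) <= Ir 0 tp (fun x => u x `^ p).
Proof.
move=> p1 t01 u0 hu hup.
have up0 x : 0 <= x <= tp -> 0 <= u x `^ p by move=> _; exact: powR_ge0.
have [j1 j2] := pint_tonelli t01 hup up0.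
have [k1 _] := pint_tonelli t01 hu u0.
have jj : ii 0 tp (fun th => pint t u th `^ p).
  apply: ii_le j1 _.
    apply: (@measurableT_comp _ _ _ _ _ _ (fun x : R => x `^ p)); last exact: ii_meas.
    exact: measurable_powR.
  by move=> x _; rewrite ger0_norm ?powR_ge0// pint_jensen.
split => //; rewrite -j2; apply: Ir_le => // x _.
exact: pint_jensen.
Qed.

End PoissonContraction.

(** * The Riesz projection *)

Section CauchyProjection.
Context {R : realType}.
Local Notation C := R[i].
Local Notation tp := (2 * pi : R).
Implicit Types (r s t x y th p : R) (u v : R -> C) (a b : nat -> C) (z w : C).

Lemma polar z : exists2 th, 0 <= th <= tp & z = cir (nm z) th.
Proof.
have [->|z0] := eqVneq z 0.
  by exists 0; rewrite ?lexx ?tp_ge0// nm0 /cir mul0r.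
have nz : 0 < nm z by rewrite nm_gt0.
pose c := complex.Re z / nm z; pose d := complex.Im z / nm z.
have cd : c ^+ 2 + d ^+ 2 = 1.
  have h := nm_sqr z.
  have -> : c ^+ 2 + d ^+ 2 = (complex.Re z ^+ 2 + complex.Im z ^+ 2) / nm z ^+ 2.
    by rewrite /c /d; field; rewrite gt_eqF.
  by rewrite -h mulfV// expf_neq0// gt_eqF.
have c1 : -1 <= c <= 1.
  by have := sqr_ge0 d; move=> h; apply/andP; split; nra.
have zE : z = (nm z)%:C * (c +i* d).
  apply: complex_eqP; rewrite ?ReM ?ImM /= /c /d; field; rewrite gt_eqF//.
have pp := @pi_gt0 R; have a0 := acos_ge0 c1; have a1 := acos_lepi c1.
have sE : sin (acos c) = `|d|.
  rewrite sin_acos// -sqrtr_sqr; congr Num.sqrt; lra.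
have [d0|d0] := leP 0 d.
  exists (acos c); first by apply/andP; split; lra.
  rewrite {1}zE /cir /expi acosK ?in_itv//= sE ger0_norm//.
exists (tp - acos c); first by apply/andP; split; lra.
rewrite {1}zE /cir; congr (_ * _); apply: complex_eqP => /=.
  by rewrite cosB mulr_natl cos2pi sin2pi mul1r mul0r addr0 acosK.
by rewrite sinB mulr_natl cos2pi sin2pi mul0r mul1r add0r sE ltr0_norm// opprK.
Qed.

Lemma psum_eps a z : pbd a -> nm z < 1 -> forall e, 0 < e -> exists N, forall n, (N <= n)%N ->
  nm (psum a z - \sum_(k < n) a k * z ^+ k) <= e.
Proof.
move=> ha z1 e e0; have h : 0 <= nm z < 1 by rewrite nm_ge0.
by have [N hN] := psum_tail ha h e0; exists N => n Nn; apply: hN.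
Qed.

Lemma psum_lim a z (l : C) : pbd a -> nm z < 1 ->
  (forall e, 0 < e -> exists N, forall n, (N <= n)%N ->
    nm (l - \sum_(k < n) a k * z ^+ k) <= e) -> psum a z = l.
Proof.
move=> ha z1 h; apply/eqP; rewrite -subr_eq0 -nm_eq0 eq_le nm_ge0 andbT.
apply: (@le0_eps _ _ 2) => e e0.
have [N hN] := psum_eps ha z1 e0; have [N' hN'] := h e e0.
have h1 := hN _ (leq_maxl N N'); have h2 := hN' _ (leq_maxr N N').
apply: le_trans (nm_tri _ (\sum_(k < maxn N N') a k * z ^+ k) _) _.
rewrite mulr_natl mulr2n; apply: lerD; first exact: h1.
by rewrite nm_distC; exact: h2.
Qed.

Lemma pbdD a b : pbd a -> pbd b -> pbd (fun n => a n + b n).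
Proof.
move=> ha hb r hr; have [M hM] := ha r hr; have [K hK] := hb r hr.
exists (M + K) => n; have /andP[r0 _] := hr.
apply: (@le_trans _ _ ((nm (a n) + nm (b n)) * r ^+ n)).
  by rewrite ler_wpM2r ?exprn_ge0 ?nmD.
by rewrite mulrDl lerD.
Qed.
Lemma pbdZ (c : C) a : pbd a -> pbd (fun n => c * a n).
Proof.
move=> ha r hr; have [M hM] := ha r hr; exists (nm c * M) => n.
by rewrite nmM -mulrA ler_wpM2l ?nm_ge0.
Qed.

Lemma psumD a b z : pbd a -> pbd b -> nm z < 1 ->
  psum (fun n => a n + b n) z = psum a z + psum b z.
Proof.
move=> ha hb z1; apply: psum_lim => //; first exact: pbdD.
move=> e e0; have e2 : 0 < e / 2 by rewrite divr_gt0.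
have [N hN] := psum_eps ha z1 e2; have [N' hN'] := psum_eps hb z1 e2.
exists (maxn N N') => n; rewrite geq_max => /andP[/hN h1 /hN' h2].
have -> : \sum_(k < n) (a k + b k) * z ^+ k =
  \sum_(k < n) a k * z ^+ k + \sum_(k < n) b k * z ^+ k.
  by rewrite -big_split; apply: eq_bigr => k _; rewrite mulrDl.
move: h1 h2; set A := psum a z; set B := psum b z.
move: (\sum_(k < n) a k * z ^+ k) (\sum_(k < n) b k * z ^+ k) => S T h1 h2.
have -> : A + B - (S + T) = (A - S) + (B - T) by ring.
by apply: le_trans (nmD _ _) _; rewrite (splitr e) lerD.
Qed.

Lemma psumZ (c : C) a z : pbd a -> nm z < 1 -> psum (fun n => c * a n) z = c * psum a z.
Proof.
move=> ha z1; apply: psum_lim => //; first exact: pbdZ.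
move=> e e0; have c1 : 0 < nm c + 1 by rewrite ltr_wpDl ?nm_ge0.
have [N hN] := psum_eps ha z1 (divr_gt0 e0 c1).
exists N => n /hN h1.
have -> : \sum_(k < n) c * a k * z ^+ k = c * \sum_(k < n) a k * z ^+ k.
  by rewrite mulr_sumr; apply: eq_bigr => k _; rewrite mulrA.
rewrite -mulrBr nmM; apply: (@le_trans _ _ (nm c * (e / (nm c + 1)))).
  by apply: ler_wpM2l; [exact: nm_ge0|exact: h1].
rewrite mulrA ler_pdivrMr// mulrC ler_wpM2l ?(ltW e0)// lerDl//.
Qed.

(** Riesz's theorem is proved on bounded measurable functions only. That is enough, since it is
    applied to functions built from dilates, and it makes every integral finite. *)
Definition cbm u := [/\ measurable_fun `[0, tp] (fun x => complex.Re (u x)),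
  measurable_fun `[0, tp] (fun x => complex.Im (u x)) &
  exists M, forall x, 0 <= x <= tp -> nm (u x) <= M].

Lemma cbm_ic u : cbm u -> ic 0 tp u.
Proof.
move=> [h1 h2 [M hM]]; split.
  by apply: (@ii_bd _ _ _ _ M) => // x /hM; apply: le_trans; exact: Re_le_nm.
by apply: (@ii_bd _ _ _ _ M) => // x /hM; apply: le_trans; exact: Im_le_nm.
Qed.

Lemma cbm_nm u : cbm u -> measurable_fun `[0, tp] (fun x => nm (u x)).
Proof. by move=> [h1 h2 _]; exact: ic_nm_meas. Qed.

Lemma meas_powR (f : R -> R) p : measurable_fun `[0, tp] f ->
  measurable_fun `[0, tp] (fun x => f x `^ p).
Proof.
by move=> h; apply: (@measurableT_comp _ _ _ _ _ _ (fun x : R => x `^ p)) => //; exact: measurable_powR.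
Qed.

Lemma cbm_pow u p : 0 <= p -> cbm u -> ii 0 tp (fun x => nm (u x) `^ p).
Proof.
move=> p0 hu; have [_ _ [M hM]] := hu.
apply: (@ii_bd _ _ _ _ (M `^ p)); first exact: (@meas_powR _ p (cbm_nm hu)).
move=> x hx; rewrite ger0_norm ?powR_ge0//.
have h := hM x hx; rewrite ge0_ler_powR// ?nnegrE ?nm_ge0//.
exact: le_trans (nm_ge0 _) h.
Qed.

Lemma cbm_cont u : (forall x, 0 <= x <= tp -> ccont u x) -> cbm u.
Proof.
move=> h; have [M hM] := cont_bounded (fun x xab => ccont_nm (h x xab)).
split.
- by apply: cont_meas => x /h/ccont_Re.
- by apply: cont_meas => x /h/ccont_Im.
- by exists M => x /hM; rewrite ger0_norm ?nm_ge0.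
Qed.

Lemma cbmD u v : cbm u -> cbm v -> cbm (fun x => u x + v x).
Proof.
move=> [h1 h2 [M hM]] [h3 h4 [K hK]]; split.
- have -> : (fun x => complex.Re (u x + v x)) = (fun x => complex.Re (u x) + complex.Re (v x)).
    by apply/funext => x; rewrite ReD.
  exact: measurable_funD.
- have -> : (fun x => complex.Im (u x + v x)) = (fun x => complex.Im (u x) + complex.Im (v x)).
    by apply/funext => x; rewrite ImD.
  exact: measurable_funD.
- by exists (M + K) => x hx; apply: le_trans (nmD _ _) _; rewrite lerD ?hM ?hK.
Qed.

Lemma cbmM u v : cbm u -> cbm v -> cbm (fun x => u x * v x).
Proof.
move=> [h1 h2 [M hM]] [h3 h4 [K hK]]; split.
- have -> : (fun x => complex.Re (u x * v x)) = (fun x =>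
    complex.Re (u x) * complex.Re (v x) - complex.Im (u x) * complex.Im (v x)).
    by apply/funext => x; rewrite ReM.
  by apply: measurable_funB; exact: measurable_funM.
- have -> : (fun x => complex.Im (u x * v x)) = (fun x =>
    complex.Re (u x) * complex.Im (v x) + complex.Im (u x) * complex.Re (v x)).
    by apply/funext => x; rewrite ImM.
  by apply: measurable_funD; exact: measurable_funM.
- exists (M * K) => x hx; rewrite nmM ler_pM ?nm_ge0 ?hM ?hK//.
Qed.

Lemma cbm_real (f : R -> R) (M : R) : measurable_fun `[0, tp] f ->
  (forall x, 0 <= x <= tp -> `|f x| <= M) -> cbm (fun x => (f x)%:C).
Proof. by move=> mf hM; split => //; exists M => x hx; rewrite nmR hM. Qed.

Lemma cbm_cst (c : C) : cbm (fun=> c).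
Proof. by apply: cbm_cont => x _; exact: ccont_cst. Qed.

Definition fc u n : C := (tp%:C)^-1 * Ic 0 tp (fun s => expi (- s) ^+ n * u s).

Lemma IcfcE u n : Ic 0 tp (fun s => expi (- s) ^+ n * u s) = tp%:C * fc u n.
Proof. exact: esym (mulVKf tpC_neq0 _). Qed.

Lemma ic_expiN u n : ic 0 tp u -> ic 0 tp (fun s => expi (- s) ^+ n * u s).
Proof. by apply: ic_mulcont => x _; exact/ccontX/ccont_expiN. Qed.
Lemma ic_expi u n : ic 0 tp u -> ic 0 tp (fun s => expi s ^+ n * u s).
Proof. by apply: ic_mulcont => x _; exact/ccontX/ccont_expi. Qed.

Lemma fc_bd u n : ic 0 tp u -> nm (fc u n) <= tp^-1 * Ir 0 tp (fun x => nm (u x)).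
Proof.
move=> hu; rewrite /fc nmM tpV nmR ger0_norm ?invr_ge0 ?tp_ge0//.
apply: ler_wpM2l; first by rewrite invr_ge0 tp_ge0.
apply: le_trans (Ic_nm (ic_expiN n hu)) _.
rewrite le_eqVlt; apply/orP; left; apply/eqP; apply: eq_Ir => x _.
by rewrite nmM nmX nm_expi expr1n mul1r.
Qed.

Lemma fc_pbd u : ic 0 tp u -> pbd (fc u).
Proof.
move=> hu r /andP[r0 r1]; exists (tp^-1 * Ir 0 tp (fun x => nm (u x))) => n.
by apply: le_trans (fc_bd n hu); rewrite ler_piMr ?nm_ge0// exprn_ile1// ltW.
Qed.

Lemma fcD u v : ic 0 tp u -> ic 0 tp v -> fc (fun x => u x + v x) = (fun n => fc u n + fc v n).
Proof.
move=> hu hv; apply/funext => n; rewrite /fc -mulrDr -IcD; [|exact: ic_expiN|exact: ic_expiN].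
by congr (_ * _); apply: eq_Ic => x _; rewrite mulrDr.
Qed.
Lemma fcZ (c : C) u : ic 0 tp u -> fc (fun x => c * u x) = (fun n => c * fc u n).
Proof.
move=> hu; apply/funext => n; rewrite /fc [RHS]mulrCA; congr (_ * _).
rewrite -(IcZ c (ic_expiN n hu)).
by apply: eq_Ic => x _; rewrite mulrCA.
Qed.

(* [cp u] is the analytic (Riesz) projection of [u] evaluated inside the disc. *)
Definition cp u := psum (fc u).

Lemma cpD u v z : ic 0 tp u -> ic 0 tp v -> nm z < 1 ->
  cp (fun x => u x + v x) z = cp u z + cp v z.
Proof. by move=> hu hv z1; rewrite /cp fcD// psumD//; exact: fc_pbd. Qed.
Lemma cpZ (c : C) u z : ic 0 tp u -> nm z < 1 -> cp (fun x => c * u x) z = c * cp u z.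
Proof. by move=> hu z1; rewrite /cp fcZ// psumZ//; exact: fc_pbd. Qed.

Lemma cp_dholo u : ic 0 tp u -> dholo (cp u).
Proof. by move=> hu z z1; apply: psum_cder => //; exact: fc_pbd. Qed.

Lemma conjD z w : conjc (z + w) = conjc z + conjc w.
Proof. by apply: complex_eqP; rewrite ?Re_conj ?Im_conj ?ReD ?ImD ?Re_conj ?Im_conj ?opprD. Qed.
Lemma conjB z w : conjc (z - w) = conjc z - conjc w.
Proof.
rewrite conjD; congr (_ + _).
by apply: complex_eqP; rewrite ?Re_conj ?Im_conj ?ReN ?ImN ?Re_conj ?Im_conj.
Qed.
Lemma conjM z w : conjc (z * w) = conjc z * conjc w.
Proof.
by apply: complex_eqP; rewrite ?Re_conj ?Im_conj ?ReM ?ImM ?Re_conj ?Im_conj; ring.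
Qed.
Lemma conjX z n : conjc (z ^+ n) = conjc z ^+ n.
Proof.
elim: n => [|n IH]; last by rewrite !exprS conjM IH.
by rewrite !expr0; apply: complex_eqP; rewrite //= oppr0.
Qed.
Lemma conj_sum n (f : 'I_n -> C) : conjc (\sum_(k < n) f k) = \sum_(k < n) conjc (f k).
Proof.
elim: n f => [|n IH] f; last by rewrite !big_ord_recl conjD IH.
by rewrite !big_ord0; apply: complex_eqP; rewrite //= oppr0.
Qed.

Lemma fc_conj (g : R -> R) m : ii 0 tp g ->
  Ic 0 tp (fun s => expi s ^+ m * (g s)%:C) = tp%:C * conjc (fc (fun s => (g s)%:C) m).
Proof.
move=> hg; have hu : ic 0 tp (fun s => (g s)%:C) by split => //; exact: ii_cst.
rewrite /fc conjM tpV conjc_real mulrA -rmorphM mulfV ?gt_eqF ?tp_gt0// rmorph1 mul1r.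
rewrite -Ic_conj; last exact: ic_expiN.
by apply: eq_Ic => x _; rewrite conjM conjX conj_expi opprK conjc_real.
Qed.

(** The Herglotz transform: for real [u] its real part is the Poisson integral of [u], so it maps
    the disc into the right half-plane when [u] is positive. *)
Definition herg u z := 2 * cp u z - fc u 0.

Lemma herg_dholo u : ic 0 tp u -> dholo (herg u).
Proof.
move=> hu z z1; apply: cholD; last exact: chol_cst.
by apply: cholM; [exact: chol_cst|exact: cp_dholo].
Qed.

(** For real [g] the negative Fourier coefficients are the conjugates of the positive ones, so the
    Poisson integral is P + conj P minus the zeroth coefficient counted twice, with P the
    projection. *)
Lemma Re_herg (g : R -> R) t th : ii 0 tp g -> 0 <= t < 1 ->
  complex.Re (herg (fun s => (g s)%:C) (cir t th)) = pint t g th.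
Proof.
move=> hg t01; set u := fun s => (g s)%:C : C.
have hu : ic 0 tp u by split => //; exact: ii_cst.
have [t0 t1] := andP t01.
have z1 : nm (cir t th) < 1 by rewrite nm_cir.
have key : cpint t u th = cp u (cir t th) + conjc (cp u (cir t th)) - conjc (fc u 0).
  apply/eqP; rewrite -subr_eq0 -nm_eq0 eq_le nm_ge0 andbT.
  apply: (@le0_eps _ _ 3) => e e0.
  have etp : 0 < tp * e by rewrite mulr_gt0 ?tp_gt0.
  have [N hN] := geo_small (2 / (1 - t) * Ir 0 tp (fun s => nm (u s))) t01 etp.
  have [N' hN'] := psum_eps (fc_pbd hu) z1 e0.
  pose n := maxn N N'.
  have h1 := poisson_fourier th n t01 hu.
  have h2 := hN' n (leq_maxr _ _).
  have h2' := hN' n.+1 (leq_trans (leq_maxr N N') (leqnSn n)).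
  set S1 := \sum_(k < n) fc u k * cir t th ^+ k in h2.
  set S2 := \sum_(k < n.+1) fc u k * cir t th ^+ k in h2'.
  have e1 : \sum_(k < n) cir t th ^+ k * Ic 0 tp (fun s => expi (- s) ^+ k * u s) = tp%:C * S1.
    rewrite mulr_sumr; apply: eq_bigr => k _; rewrite IcfcE.
    by rewrite mulrCA [cir _ _ ^+ _ * _]mulrC.
  have e2 : \sum_(k < n) conjc (cir t th) ^+ k.+1 * Ic 0 tp (fun s => expi s ^+ k.+1 * u s) =
    tp%:C * (conjc S2 - conjc (fc u 0)).
    rewrite /S2 big_ord_recl expr0 mulr1 conjD addrAC subrr add0r conj_sum mulr_sumr.
    apply: eq_bigr => k _; rewrite (fc_conj k.+1 hg) -/u [conjc (fc _ _ * _)]conjM conjX.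
    have -> : nat_of_ord (lift ord0 k) = k.+1 by [].
    by rewrite mulrCA [conjc (fc _ _) * _]mulrC.
  rewrite e1 e2 -mulrDr in h1.
  have h3 : nm (cpint t u th - (S1 + (conjc S2 - conjc (fc u 0)))) <= e.
    rewrite -(ler_pM2l (@tp_gt0 R)).
    have -> : tp * nm (cpint t u th - (S1 + (conjc S2 - conjc (fc u 0)))) =
       nm (tp%:C * cpint t u th - tp%:C * (S1 + (conjc S2 - conjc (fc u 0)))).
      by rewrite -mulrBr nmM nmR ger0_norm ?tp_ge0.
    rewrite /cpint mulVKf ?tpC_neq0//; apply: le_trans h1 _.
    apply: ltW; apply: le_lt_trans (hN n (leq_maxl _ _)).
    by rewrite mulrAC.
  set P := cp u (cir t th) in h2 h2' *.
  have -> : cpint t u th - (P + conjc P - conjc (fc u 0)) =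
    (cpint t u th - (S1 + (conjc S2 - conjc (fc u 0)))) - (P - S1) - (conjc P - conjc S2).
    by ring.
  have h4 : nm (conjc P - conjc S2) <= e by rewrite -conjB nm_conj.
  apply: le_trans (nmB _ _) _; have h5 := le_trans (nmB _ _) (lerD h3 h2).
  by apply: le_trans (lerD h5 h4) _; lra.
transitivity (complex.Re (cpint t u th)); last by rewrite Re_cpint.
by rewrite key /herg !ReD !ReN ReM !Re_conj /=; lra.
Qed.

End CauchyProjection.

(** * Riesz's inequality for nonnegative functions and exponents up to 2 *)

Section Riesz.
Context {R : realType}.
Local Notation C := R[i].
Local Notation tp := (2 * pi : R).
Implicit Types (r s t x y th p : R) (g : R -> R) (u v : R -> C) (z w : C).

Lemma ReZ x z : complex.Re (x%:C * z) = x * complex.Re z.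
Proof. by rewrite ReM /= mul0r subr0. Qed.

Lemma Re_clog w : 0 < complex.Re w -> complex.Re w = nm w * cos (complex.Im (clog w)).
Proof.
move=> w0; have nw : 0 < nm w.
  by apply: lt_le_trans w0 _; exact: le_trans (ler_norm _) (Re_le_nm w).
have := congr1 (@complex.Re R) (clogK w0).
rewrite /cexp ReM [complex.Re (expi _)]/= [complex.Re (_%:C)]/= [complex.Im (_%:C)]/=.
by rewrite mul0r subr0 lnK ?posrE// => {1}<-.
Qed.

(* [Re (w ^ p) = |w| ^ p cos (p arg w)], and [cos (p pi / 2) < 0] for [1 < p <= 2]: near the
   imaginary axis [- Re (w ^ p)] dominates [|w| ^ p], elsewhere [Re w] does. *)
Lemma sector p : 1 < p <= 2 -> exists A B : R, [/\ 0 <= A, 0 <= B &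
  forall w, 0 < complex.Re w ->
    nm w `^ p <= A * complex.Re w `^ p - B * complex.Re (cpow p w)].
Proof.
move=> /andP[p1 p2]; have p0 : 0 < p by lra.
have pp := @pi_gt0 R.
(* [p * ga] is the midpoint of pi / 2 and p pi / 2, so that [ga] lies below pi / 2 while
   [cos (p * ga)] is already negative. *)
pose ga := pi * (1 + p) / (4 * p).
have pga : p * ga = pi * (1 + p) / 4 by rewrite /ga; field; rewrite gt_eqF.
have ga0 : 0 < ga by rewrite /ga !divr_gt0 ?mulr_gt0//; lra.
have ga2 : ga < pi / 2.
  by rewrite -(ltr_pM2l p0) pga; nra.
have cg : 0 < cos ga by rewrite cos_gt0_pihalf//; apply/andP; split; lra.
have c0 : cos (p * ga) < 0.
  rewrite -cos_pihalf ltr_cos ?in_itv /=; first by rewrite pga; nra.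
  - by apply/andP; split; lra.
  - by rewrite pga; apply/andP; split; nra.
pose B := - (cos (p * ga))^-1.
have B0 : 0 < B by rewrite oppr_gt0 invr_lt0.
have cgp : 0 < cos ga `^ p by rewrite powR_gt0.
pose A := (1 + B) / cos ga `^ p.
have A0 : 0 <= A by rewrite divr_ge0 ?(ltW cgp)//; lra.
exists A, B; split => //; first exact: ltW.
move=> w w0; have nw : w != 0.
  by apply: contraTneq w0 => ->; rewrite ltxx.
rewrite Re_cpow// {1}(Re_clog w0).
set f := complex.Im (clog w).
have fr : -(pi / 2) < f < pi / 2 by rewrite /f /= atan_gtNpi2 atan_ltpi2.
have cf0 : 0 < cos f by exact: cos_gt0_pihalf.
rewrite powRM ?nm_ge0 ?(ltW cf0)//.
set N := nm w `^ p; have N0 : 0 <= N by exact: powR_ge0.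
suff : 1 <= A * cos f `^ p - B * cos (p * f) by nra.
have -> : cos (p * f) = cos (p * `|f|).
  by rewrite -[LHS]cos_norm normrM gtr0_norm.
rewrite -(cos_norm f) in cf0 *.
have f0 := normr_ge0 f.
have f2 : `|f| < pi / 2 by rewrite ltr_norml.
move: (`|f|) f0 f2 cf0 => x x0 x2 cx.
have [xg|xg] := leP ga x.
  have h : cos (p * x) <= cos (p * ga).
    rewrite leNgt ltr_cos -?leNgt ?in_itv /=; first by rewrite ler_wpM2l// ltW.
      have : p * x <= 2 * x by rewrite ler_wpM2r.
      have : 0 <= p * x by rewrite mulr_ge0// ltW.
      by clear -x2; move=> h1 h2; apply/andP; split; lra.
    by rewrite pga; clear -p1 p2 pp; apply/andP; split; nra.
  have h2 : B * cos (p * x) <= -1.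
    apply: le_trans (ler_wpM2l (ltW B0) h) _.
    by rewrite /B mulNr mulVf// lt_eqF.
  have h3 : 0 <= A * cos x `^ p by rewrite mulr_ge0 ?powR_ge0.
  lra.
have h : cos ga <= cos x.
  rewrite leNgt ltr_cos -?leNgt ?in_itv /=; first exact: ltW.
    by apply/andP; split; lra.
  by apply/andP; split; lra.
have h2 : cos ga `^ p <= cos x `^ p.
  by rewrite ge0_ler_powR ?nnegrE ?(ltW p0) ?(ltW cg) ?(ltW cx).
have h3 : 1 + B <= A * cos x `^ p.
  apply: le_trans (ler_wpM2l A0 h2); rewrite /A divfK ?gt_eqF//.
have h4 : B * cos (p * x) <= B by rewrite ler_piMr ?cos_le1 ?(ltW B0).
lra.
Qed.

Lemma powR_add_le p x y : 0 <= p -> 0 <= x -> 0 <= y ->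
  (x + y) `^ p <= 2 `^ p * (x `^ p + y `^ p).
Proof.
move=> p0 x0 y0; wlog xy : x y x0 y0 / x <= y.
  move=> h; have [xy|/ltW yx] := leP x y; first exact: h.
  by rewrite addrC [x `^ p + _]addrC; exact: h.
apply: (@le_trans _ _ ((2 * y) `^ p)).
  by rewrite ge0_ler_powR ?nnegrE ?addr_ge0 ?mulr_ge0//; lra.
by rewrite powRM// ler_wpM2l ?powR_ge0// lerDr powR_ge0.
Qed.

Definition bmp g := measurable_fun `[0, tp] g /\ exists M, forall x, 0 <= x <= tp -> 0 <= g x <= M.

Lemma bmp_ii g : bmp g -> ii 0 tp g.
Proof.
by move=> [mg [M hM]]; apply: (@ii_bd _ _ _ _ M) => // x /hM /andP[h1 h2]; rewrite ger0_norm.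
Qed.
Lemma bmp_pow g p : 0 <= p -> bmp g -> bmp (fun x => g x `^ p).
Proof.
move=> p0 [mg [M hM]]; split; first exact: meas_powR.
exists (M `^ p) => x hx; rewrite powR_ge0/=; have /andP[h1 h2] := hM x hx.
by rewrite ge0_ler_powR ?nnegrE// (le_trans h1).
Qed.
Lemma bmp_ic g : bmp g -> ic 0 tp (fun s => (g s)%:C).
Proof. by move=> h; split; [exact: bmp_ii|exact: ii_cst]. Qed.

Lemma pint_ge (d t th : R) g : 0 <= t < 1 -> ii 0 tp g -> (forall x, 0 <= x <= tp -> d <= g x) ->
  d <= pint t g th.
Proof.
move=> t01 hg h; rewrite /pint ler_pdivlMl ?tp_gt0//.
have i0 : ii 0 tp (fun s => pker t (th - s)).
  by apply: eq_ii (ii_pker th t01 (ii_cst 0 tp 1)) => x _; rewrite mulr1.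
have -> : tp * d = Ir 0 tp (fun s => d * pker t (th - s)) by rewrite IrZ// Ir_pker// mulrC.
apply: Ir_le; [exact: iiZ|exact: ii_pker|].
by move=> x hx; rewrite mulrC ler_wpM2l ?pker_ge0 ?h.
Qed.

Lemma herg0 u : ic 0 tp u -> herg u 0 = fc u 0.
Proof. by move=> hu; rewrite /herg /cp psum0; [ring|exact: fc_pbd]. Qed.

Lemma dholo_cbm (F : C -> C) t : dholo F -> 0 <= t < 1 -> cbm (fun th => F (cir t th)).
Proof. by move=> hF t01; apply: cbm_cont => x _; exact: dholo_ccont. Qed.

(** The lower bound [d] keeps the transform F in the open half-plane, where F^p is holomorphic. Its
    mean is F(0)^p with F(0) a positive real, so the term with [B] has a favourable sign and drops
    out; what remains is the p-th power of a Poisson integral. *)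
Lemma herg_pos_bound p : 1 < p <= 2 -> exists2 A, 0 <= A & forall g (d t : R), 0 < d ->
  bmp g -> (forall x, 0 <= x <= tp -> d <= g x) -> 0 < t < 1 ->
  Ir 0 tp (fun th => nm (herg (fun s => (g s)%:C) (cir t th)) `^ p) <= A * Ir 0 tp (fun x => g x `^ p).
Proof.
move=> hp; have [A [B [A0 B0 hAB]]] := sector hp.
exists A => // g d t d0 hg gd /andP[t0 t1].
have /andP[p1 p2] := hp; have p0 : 0 <= p by lra.
have t01 : 0 <= t < 1 by rewrite (ltW t0).
set u := fun s => (g s)%:C : C; set F := herg u.
have hu : ic 0 tp u := bmp_ic hg; have gi := bmp_ii hg.
have hF : dholo F := herg_dholo hu.
have Fpos z : nm z < 1 -> 0 < complex.Re (F z).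
  move=> z1; have [th _ ->] := polar z.
  have nz : 0 <= nm z < 1 by rewrite nm_ge0.
  by rewrite /F Re_herg//; apply: lt_le_trans d0 _; exact: pint_ge.
pose G z := cpow p (F z).
have hG : dholo G.
  by move=> z z1; apply: chol_comp; [exact: hF|exact/chol_cpow/Fpos].
have hm := circ_mean hG t01.
have G0 : 0 <= complex.Re (G 0).
  have F0 : complex.Im (F 0) = 0.
    rewrite /F herg0// /fc tpV ImM /= mul0r addr0.
    rewrite (eq_Ir (g := fun=> 0)); last by move=> x _; rewrite mulr0 mul0r addr0.
    by rewrite Ir_cst ?tp_ge0// mul0r mulr0.
  rewrite /G Re_cpow; last first.
    apply: contraTneq (Fpos 0 ltac:(by rewrite nm0)) => ->; rewrite ltxx//.
  have -> : complex.Im (clog (F 0)) = atan (complex.Im (F 0) / complex.Re (F 0)) by [].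
  by rewrite F0 mul0r atan0 mulr0 cos0 mulr1 powR_ge0.
have icG : ic 0 tp (fun th => G (cir t th)) := cbm_ic (dholo_cbm hG t01).
have g0 x : 0 <= x <= tp -> 0 <= g x.
  by move=> /gd; apply: le_trans; exact: ltW.
have gpi := bmp_ii (bmp_pow p0 hg).
have [c1 c2] := pint_contract p1 t01 g0 gi gpi.
have i1 : ii 0 tp (fun th => nm (F (cir t th)) `^ p) := cbm_pow p0 (dholo_cbm hF t01).
apply: (@le_trans _ _ (Ir 0 tp (fun th => A * pint t g th `^ p - B * complex.Re (G (cir t th))))).
  apply: Ir_le => //; first by apply: iiB; apply: iiZ => //; exact: icG.1.
  move=> th _; have zt : nm (cir t th) < 1 by rewrite nm_cir ?(ltW t0).
  by have := hAB _ (Fpos _ zt); rewrite {2}/F Re_herg.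
rewrite IrB; [|exact: iiZ|by apply: iiZ; exact: icG.1].
rewrite IrZ// IrZ; last exact: icG.1.
have -> : Ir 0 tp (fun th => complex.Re (G (cir t th))) = tp * complex.Re (G 0).
  transitivity (complex.Re (Ic 0 tp (fun th => G (cir t th)))); first by [].
  by rewrite hm ReZ.
have h1 : 0 <= B * (tp * complex.Re (G 0)) by rewrite !mulr_ge0 ?tp_ge0// pi_ge0.
apply: (@le_trans _ _ (A * Ir 0 tp (fun th => pint t g th `^ p))); first lra.
by rewrite ler_wpM2l.
Qed.

Lemma fc_cst (c : C) n : fc (fun=> c) n = if n == 0%N then c else 0.
Proof.
rewrite /fc; case: n => [|n] /=.
  rewrite (@eq_Ic _ _ _ _ (fun=> c)); last by move=> x _; rewrite expr0 mul1r.
  by rewrite Ic_cst ?tp_ge0// subr0 mulrCA mulVf ?mulr1// tpC_neq0.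
rewrite (@eq_Ic _ _ _ _ (fun x => c * expi (- x) ^+ n.+1)); last by move=> x _; rewrite mulrC.
rewrite IcZ ?Ic_expiN ?mulr0//.
by apply: ic_cont => x _; exact/ccontX/ccont_expiN.
Qed.

Lemma cp_cst (c : C) z : nm z < 1 -> cp (fun=> c) z = c.
Proof.
move=> z1; apply: psum_lim => //; first by apply: fc_pbd; exact: ic_cst.
move=> e e0; exists 1%N => -[//|n] _.
rewrite big_ord_recl big1 ?addr0; last by move=> i _; rewrite fc_cst /= mul0r.
by rewrite fc_cst /= expr0 mulr1 subrr nm0 ltW.
Qed.

Lemma comb_bound (P A X Y W Z e T : R) : 0 <= P -> 0 <= A -> X <= P * (Y + e * T) ->
  Y <= A * W -> W <= P * (Z + e * T) ->
  X - P * (A * P) * Z <= P * (A * P * T + T) * e.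
Proof.
move=> P0 A0 h1 h2 h3; have h4 := le_trans h2 (ler_wpM2l A0 h3).
have h5 := ler_wpM2l P0 h4; lra.
Qed.

(** Shift [g] by [d] with d^p = e: the transform moves by the same constant, and e tends to 0. The
    factor 2^p enters once when the shift is removed on each side. *)
Lemma herg_bound p : 1 < p <= 2 -> exists2 A, 0 <= A & forall g t,
  bmp g -> 0 < t < 1 ->
  Ir 0 tp (fun th => nm (herg (fun s => (g s)%:C) (cir t th)) `^ p) <= A * Ir 0 tp (fun x => g x `^ p).
Proof.
move=> hp; have [A A0 hA] := herg_pos_bound hp.
have /andP[p1 p2] := hp; have p0 : 0 < p by lra.
have P0 : 0 <= 2 `^ p :> R by exact: powR_ge0.
exists (2 `^ p * (A * 2 `^ p)); first by rewrite !mulr_ge0.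
move=> g t hg ht; have /andP[t0 t1] := ht.
have t01 : 0 <= t < 1 by rewrite (ltW t0).
rewrite -subr_le0; apply: (@le0_eps _ _ (2 `^ p * (A * 2 `^ p * tp + tp))) => e e0.
pose d := e `^ p^-1; have d0 : 0 < d by exact: powR_gt0.
have dp : d `^ p = e by rewrite /d -powRrM mulVf ?gt_eqF// powRr1// ltW.
have hu := bmp_ic hg; have gi := bmp_ii hg.
have [mg [M hM]] := hg.
pose g' x := g x + d.
have hg' : bmp g'.
  split; first by apply: measurable_funD.
  exists (M + d) => x /hM/andP[h1 h2]; rewrite /g' addr_ge0 ?(ltW d0)//=.
  by rewrite lerD2r.
have gd x : 0 <= x <= tp -> d <= g' x by move=> /hM/andP[h1 h2]; rewrite lerDr.
have := hA g' d t d0 hg' gd ht.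
have E z : nm z < 1 -> herg (fun s => (g' s)%:C) z = herg (fun s => (g s)%:C) z + d%:C.
  move=> z1; have -> : (fun s => (g' s)%:C) = (fun s => (g s)%:C + d%:C : C).
    by apply/funext => s; rewrite /g' rmorphD.
  rewrite /herg cpD//; last exact: ic_cst.
  rewrite cp_cst// fcD//; last exact: ic_cst.
  by rewrite fc_cst /=; ring.
have i1 : ii 0 tp (fun th => nm (herg (fun s => (g s)%:C) (cir t th)) `^ p).
  by apply: (cbm_pow (ltW p0)); apply: dholo_cbm => //; exact: herg_dholo.
have i2 : ii 0 tp (fun th => nm (herg (fun s => (g' s)%:C) (cir t th)) `^ p).
  by apply: (cbm_pow (ltW p0)); apply: dholo_cbm => //; apply: herg_dholo; exact: bmp_ic.
have gp := bmp_ii (bmp_pow (ltW p0) hg).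
have gp' := bmp_ii (bmp_pow (ltW p0) hg').
have k1 : Ir 0 tp (fun th => nm (herg (fun s => (g s)%:C) (cir t th)) `^ p) <=
  2 `^ p * (Ir 0 tp (fun th => nm (herg (fun s => (g' s)%:C) (cir t th)) `^ p) + e * tp).
  have -> : e * tp = Ir 0 tp (fun=> e) by rewrite Ir_cst ?tp_ge0// subr0.
  rewrite -IrD//; last exact: ii_cst.
  rewrite -IrZ; last by apply: iiD => //; exact: ii_cst.
  apply: Ir_le => //; first by apply: iiZ; apply: iiD => //; exact: ii_cst.
  move=> th _; rewrite E; last by rewrite nm_cir ?(ltW t0).
  set w := herg _ _; rewrite -dp.
  have h : nm w <= nm (w + d%:C) + d.
    have := nm_lerB w (- d%:C); rewrite opprK nmN nmR gtr0_norm// lerBlDr.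
    by [].
  apply: le_trans (powR_add_le (ltW p0) (nm_ge0 _) (ltW d0)).
  by rewrite ge0_ler_powR ?nnegrE ?nm_ge0 ?addr_ge0 ?nm_ge0 ?(ltW d0) ?(ltW p0).
have k2 : Ir 0 tp (fun x => g' x `^ p) <= 2 `^ p * (Ir 0 tp (fun x => g x `^ p) + e * tp).
  have -> : e * tp = Ir 0 tp (fun=> e) by rewrite Ir_cst ?tp_ge0// subr0.
  rewrite -IrD//; last exact: ii_cst.
  rewrite -IrZ; last by apply: iiD => //; exact: ii_cst.
  apply: Ir_le => //; first by apply: iiZ; apply: iiD => //; exact: ii_cst.
  move=> x /hM/andP[h1 _]; rewrite -dp; apply: powR_add_le => //; exact: ltW.
move=> k3; exact: comb_bound P0 A0 k1 k3 k2.
Qed.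

(** The projection is half the sum of the Herglotz transform and the mean of [g]. The mean is
    controlled by Jensen at t = 0, where the Poisson kernel is constantly 1. *)
Lemma cp_pos_bound p : 1 < p <= 2 -> exists2 A, 0 <= A & forall g t,
  bmp g -> 0 < t < 1 ->
  Ir 0 tp (fun th => nm (cp (fun s => (g s)%:C) (cir t th)) `^ p) <= A * Ir 0 tp (fun x => g x `^ p).
Proof.
move=> hp; have [A A0 hA] := herg_bound hp.
have /andP[p1 p2] := hp; have p0 : 0 < p by lra.
have P0 : 0 <= 2 `^ p :> R by exact: powR_ge0.
exists (2 `^ p * (A + 1)); first by rewrite mulr_ge0// addr_ge0.
move=> g t hg ht; have /andP[t0 t1] := ht.
have t01 : 0 <= t < 1 by rewrite (ltW t0).
have hu := bmp_ic hg; have gi := bmp_ii hg.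
have gp := bmp_ii (bmp_pow (ltW p0) hg).
set u := fun s => (g s)%:C : C.
have g0 x : 0 <= x <= tp -> 0 <= g x by case: hg => _ [M hM] /hM /andP[].
have c0 : nm (fc u 0) `^ p <= tp^-1 * Ir 0 tp (fun x => g x `^ p).
  have z01 : 0 <= (0 : R) < 1 by rewrite lexx ltr01.
  have k0 s : pker 0 s = 1 by rewrite /pker !(expr0n, mulr0, mul0r, subr0, addr0) divr1.
  have := @pint_jensen R p 0 g 0 p1 z01 g0 gi gp.
  rewrite /pint (@eq_Ir _ _ _ _ g); last by move=> x _; rewrite k0 mul1r.
  rewrite (@eq_Ir _ _ _ (fun s => _ * _ `^ p) (fun x => g x `^ p)); last by move=> x _; rewrite k0 mul1r.
  apply: le_trans; have G0 : 0 <= Ir 0 tp g by apply: Ir_ge0.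
  rewrite ge0_ler_powR ?nnegrE ?nm_ge0 ?(ltW p0) ?mulr_ge0 ?invr_ge0 ?tp_ge0//.
  apply: le_trans (fc_bd 0 hu) _; rewrite ler_wpM2l ?invr_ge0 ?tp_ge0//.
  rewrite le_eqVlt; apply/orP; left; apply/eqP; apply: eq_Ir => x hx.
  by rewrite nmR ger0_norm ?g0.
have i1 : ii 0 tp (fun th => nm (herg u (cir t th)) `^ p).
  by apply: (cbm_pow (ltW p0)); apply: dholo_cbm => //; exact: herg_dholo.
have i2 : ii 0 tp (fun th => nm (cp u (cir t th)) `^ p).
  by apply: (cbm_pow (ltW p0)); apply: dholo_cbm => //; exact: cp_dholo.
apply: (@le_trans _ _ (2 `^ p * (Ir 0 tp (fun th => nm (herg u (cir t th)) `^ p) +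
    Ir 0 tp (fun=> nm (fc u 0) `^ p)))).
  have j := iiD i1 (ii_cst 0 tp (nm (fc u 0) `^ p)).
  rewrite -(IrD i1 (ii_cst _ _ _)) -(IrZ _ j).
  apply: Ir_le; [exact: i2|exact: iiZ j|].
  move=> th _; apply: le_trans (powR_add_le (ltW p0) (nm_ge0 _) (nm_ge0 _)).
  rewrite ge0_ler_powR ?nnegrE ?nm_ge0 ?addr_ge0 ?nm_ge0 ?(ltW p0)//.
  have h : 2 * nm (cp u (cir t th)) <= nm (herg u (cir t th)) + nm (fc u 0).
    have -> : 2 * nm (cp u (cir t th)) = nm (2 * cp u (cir t th)).
      by rewrite nmM -[2 in RHS](rmorph_nat (real_complex R)) nmR ger0_norm.
    by have := nm_lerB (2 * cp u (cir t th)) (fc u 0); rewrite lerBlDr.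
  by have := nm_ge0 (cp u (cir t th)); lra.
rewrite -mulrA; apply: ler_wpM2l P0 _ _ _; rewrite [(A + 1) * _]mulrDl [1 * _]mul1r.
apply: lerD; first exact: hA.
rewrite Ir_cst ?tp_ge0// subr0 -ler_pdivlMr ?tp_gt0//.
by rewrite [leRHS]mulrC.
Qed.

End Riesz.

(** * Riesz's theorem for complex functions and every exponent above 1 *)

Section RieszProjection.
Context {R : realType}.
Local Notation C := R[i].
Local Notation tp := (2 * pi : R).
Implicit Types (r s t x y th p q : R) (g : R -> R) (u v : R -> C) (z w : C).

Definition riesz_bound p (A : R) := 0 <= A /\ forall u t, cbm u -> 0 < t < 1 ->
  Ir 0 tp (fun th => nm (cp u (cir t th)) `^ p) <= A * Ir 0 tp (fun x => nm (u x) `^ p).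

Lemma bmp_max (f : R -> R) u : cbm u -> measurable_fun `[0, tp] f ->
  (forall x, `|f x| <= nm (u x)) -> bmp (fun x => Num.max (f x) 0).
Proof.
move=> [_ _ [M hM]] mf h; split; first exact: measurable_maxr.
exists M => x hx; rewrite le_max lexx orbT /= ge_max.
have := le_trans (h x) (hM x hx); rewrite ler_norml => /andP[_ ->].
exact: le_trans (nm_ge0 _) (hM x hx).
Qed.

Lemma cp_t_pow u p t : 0 <= p -> ic 0 tp u -> 0 < t < 1 ->
  ii 0 tp (fun th => nm (cp u (cir t th)) `^ p).
Proof.
move=> p0 hu /andP[t0 t1]; apply: cbm_pow => //; apply: dholo_cbm; first exact: cp_dholo.
by rewrite ltW.
Qed.

Lemma complex_posneg z :
  z = ((Num.max (complex.Re z) 0)%:C + -1 * (Num.max (- complex.Re z) 0)%:C) +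
      ('i * (Num.max (complex.Im z) 0)%:C + - 'i * (Num.max (- complex.Im z) 0)%:C).
Proof.
have maxB (y : R) : Num.max y 0 - Num.max (- y) 0 = y.
  by have [y0|y0] := leP y 0; have [z0|z0] := leP (- y) 0; lra.
case: z => a b; rewrite -{1}(maxB a) -{1}(maxB b); apply: complex_eqP; rewrite /=; ring.
Qed.

Lemma Ir_comb4 (a b c d : R -> R) P K : 0 <= P ->
  ii 0 tp a -> ii 0 tp b -> ii 0 tp c -> ii 0 tp d ->
  Ir 0 tp a <= K -> Ir 0 tp b <= K -> Ir 0 tp c <= K -> Ir 0 tp d <= K ->
  Ir 0 tp (fun x => P * (P * ((a x + b x) + (c x + d x)))) <= P * (P * (4 * K)).
Proof.
move=> P0 ha hb hc hd la lb lc ld.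
rewrite (IrZ P (iiZ P (iiD (iiD ha hb) (iiD hc hd)))) (IrZ P (iiD (iiD ha hb) (iiD hc hd))).
rewrite (IrD (iiD ha hb) (iiD hc hd)) (IrD ha hb) (IrD hc hd).
apply: ler_wpM2l => //; apply: ler_wpM2l => //.
apply: le_trans (lerD (lerD la lb) (lerD lc ld)) _.
by rewrite le_eqVlt; apply/orP; left; apply/eqP; ring.
Qed.

Lemma riesz_le2 p : 1 < p <= 2 -> exists A, riesz_bound p A.
Proof.
move=> hp; have [A A0 hA] := cp_pos_bound hp.
have /andP[p1 p2] := hp; have p0 : 0 <= p by lra.
pose P := 2 `^ p : R; have P0 : 0 <= P by exact: powR_ge0.
(* [u] splits into positive and negative parts of its real and imaginary parts. [P] occurs twice
   because the four terms are added as two sums of two. *)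
exists (P * (P * (A * 4))); split; first by rewrite !mulr_ge0.
move=> u t hu ht; have [mr mi _] := hu; have /andP[t0 t1] := ht.
pose g1 x := Num.max (complex.Re (u x)) 0; pose g2 x := Num.max (- complex.Re (u x)) 0.
pose g3 x := Num.max (complex.Im (u x)) 0; pose g4 x := Num.max (- complex.Im (u x)) 0.
have b1 : bmp g1 by apply: (bmp_max hu mr) => x; exact: Re_le_nm.
have b2 : bmp g2.
  apply: (bmp_max hu); first exact: measurableT_comp.
  by move=> x; rewrite normrN; exact: Re_le_nm.
have b3 : bmp g3 by apply: (bmp_max hu mi) => x; exact: Im_le_nm.
have b4 : bmp g4.
  apply: (bmp_max hu); first exact: measurableT_comp.
  by move=> x; rewrite normrN; exact: Im_le_nm.
have gle (f : R -> R) x : `|f x| <= nm (u x) -> 0 <= Num.max (f x) 0 <= nm (u x).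
  rewrite ler_norml => /andP[_ h]; rewrite le_max lexx orbT /= ge_max h.
  exact: nm_ge0.
have up := cbm_pow p0 hu.
have gI g : bmp g -> (forall x, 0 <= g x <= nm (u x)) ->
   Ir 0 tp (fun th => nm (cp (fun s => (g s)%:C) (cir t th)) `^ p) <=
   A * Ir 0 tp (fun x => nm (u x) `^ p).
  move=> bg gu; apply: le_trans (hA g t bg ht) _; apply: ler_wpM2l => //.
  apply: Ir_le; [exact: bmp_ii (bmp_pow p0 bg)|exact: up|].
  move=> x _; have /andP[h1 h2] := gu x.
  by rewrite ge0_ler_powR ?nnegrE ?nm_ge0.
have k1 := gI g1 b1 (fun x => gle (fun x => complex.Re (u x)) x (Re_le_nm _)).
have k2 : Ir 0 tp (fun th => nm (cp (fun s => (g2 s)%:C) (cir t th)) `^ p) <=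
   A * Ir 0 tp (fun x => nm (u x) `^ p).
  apply: (gI g2 b2) => x; apply: (gle (fun x => - complex.Re (u x))).
  by rewrite normrN; exact: Re_le_nm.
have k3 := gI g3 b3 (fun x => gle (fun x => complex.Im (u x)) x (Im_le_nm _)).
have k4 : Ir 0 tp (fun th => nm (cp (fun s => (g4 s)%:C) (cir t th)) `^ p) <=
   A * Ir 0 tp (fun x => nm (u x) `^ p).
  apply: (gI g4 b4) => x; apply: (gle (fun x => - complex.Im (u x))).
  by rewrite normrN; exact: Im_le_nm.
have i1 := bmp_ic b1; have i2 := bmp_ic b2; have i3 := bmp_ic b3; have i4 := bmp_ic b4.
have uE : u = (fun x => ((g1 x)%:C + -1 * (g2 x)%:C) + ('i * (g3 x)%:C + - 'i * (g4 x)%:C)).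
  by apply/funext => x; exact: complex_posneg.
have cE th : nm (cp u (cir t th)) <=
   (nm (cp (fun s => (g1 s)%:C) (cir t th)) + nm (cp (fun s => (g2 s)%:C) (cir t th))) +
   (nm (cp (fun s => (g3 s)%:C) (cir t th)) + nm (cp (fun s => (g4 s)%:C) (cir t th))).
  have z1 : nm (cir t th) < 1 by rewrite nm_cir ?(ltW t0).
  rewrite {1}uE cpD//; [|exact: icD i1 (icZ _ i2)|exact: icD (icZ _ i3) (icZ _ i4)].
  rewrite (cpD i1 (icZ _ i2) z1) (cpD (icZ _ i3) (icZ _ i4) z1).
  rewrite (cpZ _ i2 z1) (cpZ _ i3 z1) (cpZ _ i4 z1).
  apply: le_trans (nmD _ _) _; apply: lerD; apply: le_trans (nmD _ _) _.
    by apply: lerD => //; rewrite nmM nmN nm1 mul1r.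
  by apply: lerD; rewrite nmM ?nmN nm_i mul1r.
have pw a b c d : 0 <= a -> 0 <= b -> 0 <= c -> 0 <= d ->
  ((a + b) + (c + d)) `^ p <= P * (P * ((a `^ p + b `^ p) + (c `^ p + d `^ p))).
  move=> a0 b0 c0 d0; apply: le_trans (powR_add_le p0 (addr_ge0 a0 b0) (addr_ge0 c0 d0)) _.
  apply: ler_wpM2l => //; rewrite [P * (_ + _)]mulrDr; apply: lerD; exact: powR_add_le.
have j (i : ic 0 tp u) := cp_t_pow p0 i ht.
have j1 := cp_t_pow p0 i1 ht; have j2 := cp_t_pow p0 i2 ht.
have j3 := cp_t_pow p0 i3 ht; have j4 := cp_t_pow p0 i4 ht.
have jj := iiD (iiD j1 j2) (iiD j3 j4).
apply: (@le_trans _ _ (Ir 0 tp (fun th => P * (P * (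
   (nm (cp (fun s => (g1 s)%:C) (cir t th)) `^ p + nm (cp (fun s => (g2 s)%:C) (cir t th)) `^ p) +
   (nm (cp (fun s => (g3 s)%:C) (cir t th)) `^ p + nm (cp (fun s => (g4 s)%:C) (cir t th)) `^ p)))))).
  apply: Ir_le; [exact: j (cbm_ic hu)|exact: iiZ (iiZ _ jj)|].
  move=> th _; apply: le_trans (pw _ _ _ _ (nm_ge0 _) (nm_ge0 _) (nm_ge0 _) (nm_ge0 _)).
  by rewrite ge0_ler_powR ?nnegrE ?addr_ge0 ?nm_ge0.
apply: le_trans (Ir_comb4 P0 j1 j2 j3 j4 k1 k2 k3 k4) _.
by rewrite le_eqVlt; apply/orP; left; apply/eqP; ring.
Qed.

Lemma cbm_conj u : cbm u -> cbm (fun x => conjc (u x)).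
Proof.
move=> [h1 h2 [M hM]]; split.
- by rewrite (_ : (fun x => _) = (fun x => complex.Re (u x)))//; apply/funext => x; rewrite Re_conj.
- rewrite (_ : (fun x => _) = (fun x => - complex.Im (u x))); first exact: measurableT_comp.
  by apply/funext => x; rewrite Im_conj.
- by exists M => x /hM; rewrite nm_conj.
Qed.

Lemma cir_split t th n : cir t th ^+ n = (t ^+ n)%:C * expi th ^+ n.
Proof. by rewrite /cir exprMn rmorphXn. Qed.

(** With partial sums in place of [cp], both sides equal the sum of 2 pi t^k times the k-th
    coefficient of [u] and the conjugate of that of [v]. *)
Lemma cp_dual u v t : cbm u -> cbm v -> 0 < t < 1 ->
  Ic 0 tp (fun th => cp u (cir t th) * conjc (v th)) =
  Ic 0 tp (fun th => u th * conjc (cp v (cir t th))).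
Proof.
move=> hu hv ht; have /andP[t0 t1] := ht.
have t01 : 0 <= t < 1 by rewrite (ltW t0).
have iu := cbm_ic hu; have iv := cbm_ic hv.
have cu := dholo_cbm (cp_dholo iu) t01; have cv := dholo_cbm (cp_dholo iv) t01.
pose U n th := \sum_(k < n) fc u k * cir t th ^+ k.
pose V n th := \sum_(k < n) fc v k * cir t th ^+ k.
have cc n x (a : nat -> C) : ccont (fun th => \sum_(k < n) a k * cir t th ^+ k) x.
  elim: n => [|n IH].
    have -> : (fun th => \sum_(k < 0) a k * cir t th ^+ k) = (fun=> 0).
      by apply/funext => th; rewrite big_ord0.
    exact: ccont_cst.
  have -> : (fun th => \sum_(k < n.+1) a k * cir t th ^+ k) =
    (fun th => \sum_(k < n) a k * cir t th ^+ k + a n * cir t th ^+ n).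
    by apply/funext => th; rewrite big_ord_recr.
  apply: ccontD => //; apply: ccontM; first exact: ccont_cst.
  exact/ccontX/ccont_cir.
have iU n : ic 0 tp (fun th => U n th * conjc (v th)).
  by apply: cbm_ic; apply: cbmM; [apply: cbm_cont => x _; exact: cc|exact: cbm_conj].
have iV n : ic 0 tp (fun th => u th * conjc (V n th)).
  by apply: cbm_ic; apply: cbmM => //; apply: cbm_conj; apply: cbm_cont => x _; exact: cc.
have EU n : Ic 0 tp (fun th => U n th * conjc (v th)) =
   \sum_(k < n) tp%:C * (t ^+ k)%:C * (fc u k * conjc (fc v k)).
  have ik k : ic 0 tp (fun th => fc u k * (t ^+ k)%:C * (expi th ^+ k * conjc (v th))).
    by apply: icZ; apply: ic_expi; apply: cbm_ic; exact: cbm_conj.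
  rewrite (@eq_Ic _ _ _ _ (fun th => \sum_(k < n) fc u k * (t ^+ k)%:C * (expi th ^+ k * conjc (v th)))).
    rewrite (Ic_sum n ik); apply: eq_bigr => k _.
    rewrite IcZ; last by apply: ic_expi; apply: cbm_ic; exact: cbm_conj.
    have -> : Ic 0 tp (fun th => expi th ^+ k * conjc (v th)) = conjc (tp%:C * fc v k).
      rewrite -IcfcE -Ic_conj; last exact: ic_expiN.
      by apply: eq_Ic => x _; rewrite conjM conjX conj_expi opprK.
    by rewrite conjM conjc_real; ring.
  by move=> th _; rewrite /U mulr_suml; apply: eq_bigr => k _; rewrite cir_split; ring.
have EV n : Ic 0 tp (fun th => u th * conjc (V n th)) =
   \sum_(k < n) tp%:C * (t ^+ k)%:C * (fc u k * conjc (fc v k)).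
  have ik k : ic 0 tp (fun th => conjc (fc v k) * (t ^+ k)%:C * (expi (- th) ^+ k * u th)).
    by apply: icZ; exact: ic_expiN.
  rewrite (@eq_Ic _ _ _ _ (fun th => \sum_(k < n) conjc (fc v k) * (t ^+ k)%:C * (expi (- th) ^+ k * u th))).
    rewrite (Ic_sum n ik); apply: eq_bigr => k _.
    by rewrite IcZ ?IcfcE; [ring|exact: ic_expiN].
  move=> th _; rewrite /V conj_sum mulr_sumr; apply: eq_bigr => k _.
  rewrite cir_split; have -> : conjc (fc v k * ((t ^+ k)%:C * expi th ^+ k)) =
    conjc (fc v k) * (t ^+ k)%:C * expi (- th) ^+ k.
    by rewrite (conjM (fc v k)) (conjM (t ^+ k)%:C) conjc_real conjX conj_expi mulrA.
  by ring.
have i1 : ic 0 tp (fun th => cp u (cir t th) * conjc (v th)).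
  by apply: cbm_ic; apply: cbmM => //; exact: cbm_conj.
have i2 : ic 0 tp (fun th => u th * conjc (cp v (cir t th))).
  by apply: cbm_ic; apply: cbmM => //; exact: cbm_conj.
apply/eqP; rewrite -subr_eq0 -nm_eq0 eq_le nm_ge0 andbT.
apply: (@le0_eps _ _ (Ir 0 tp (fun x => nm (v x)) + Ir 0 tp (fun x => nm (u x)))) => e e0.
have [N hN] := psum_tail (fc_pbd iu) t01 e0.
have [N' hN'] := psum_tail (fc_pbd iv) t01 e0.
pose n := maxn N N'.
have h1 : nm (Ic 0 tp (fun th => cp u (cir t th) * conjc (v th)) -
   Ic 0 tp (fun th => U n th * conjc (v th))) <= e * Ir 0 tp (fun x => nm (v x)).
  rewrite -(IcB i1 (iU n)); apply: le_trans (Ic_nm (icB i1 (iU n))) _.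
  rewrite -(IrZ _ (ii_nm iv)); apply: Ir_le; [exact: ii_nm (icB i1 (iU n))|exact: iiZ (ii_nm iv)|].
  move=> th _; rewrite -mulrBl nmM nm_conj; apply: ler_wpM2r; first exact: nm_ge0.
  by apply: hN; [exact: leq_maxl|rewrite nm_cir ?(ltW t0)].
have h2 : nm (Ic 0 tp (fun th => u th * conjc (cp v (cir t th))) -
   Ic 0 tp (fun th => u th * conjc (V n th))) <= e * Ir 0 tp (fun x => nm (u x)).
  rewrite -(IcB i2 (iV n)); apply: le_trans (Ic_nm (icB i2 (iV n))) _.
  rewrite -(IrZ _ (ii_nm iu)); apply: Ir_le; [exact: ii_nm (icB i2 (iV n))|exact: iiZ (ii_nm iu)|].
  move=> th _; rewrite -mulrBr nmM mulrC; apply: ler_wpM2r; first exact: nm_ge0.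
  rewrite -conjB nm_conj.
  by apply: hN'; [exact: leq_maxr|rewrite nm_cir ?(ltW t0)].
apply: le_trans (nm_tri _ (Ic 0 tp (fun th => U n th * conjc (v th))) _) _.
rewrite [leRHS]mulrC [leRHS]mulrDr; apply: lerD; first exact: h1.
by rewrite EU -EV nm_distC; exact: h2.
Qed.

Lemma Ic_real (a b : R) g : a <= b -> Ic a b (fun x => (g x)%:C) = (Ir a b g)%:C.
Proof.
by move=> ab; apply: complex_eqP; rewrite /Ic //=; rewrite (Ir_cst 0 ab) mul0r.
Qed.

Lemma young_scaled (a b L p q : R) : 0 < p -> 0 < q -> p^-1 + q^-1 = 1 -> 0 < L ->
  0 <= a -> 0 <= b -> a * b <= L `^ p / p * a `^ p + (L `^ q)^-1 / q * b `^ q.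
Proof.
move=> p0 q0 pq L0 a0 b0.
have := @conjugate_powR R (L * a) (L^-1 * b) p q.
rewrite !powRM ?mulr_ge0 ?invr_ge0 ?(ltW L0)//.
have -> : L^-1 `^ q = (L `^ q)^-1.
  by rewrite -powR_inv1 ?(ltW L0)// -powRrM mulN1r powRN.
move=> /(_ isT isT p0 q0 pq).
have -> : L * a * (L^-1 * b) = a * b by field; rewrite gt_eqF.
move/le_trans; apply; rewrite le_eqVlt; apply/orP; left; apply/eqP; ring.
Qed.

Lemma young_Ic u v (L p q : R) : 0 < p -> 0 < q -> p^-1 + q^-1 = 1 -> 0 < L ->
  ic 0 tp (fun x => u x * conjc (v x)) ->
  ii 0 tp (fun x => nm (u x) `^ p) -> ii 0 tp (fun x => nm (v x) `^ q) ->
  nm (Ic 0 tp (fun x => u x * conjc (v x))) <=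
  L `^ p / p * Ir 0 tp (fun x => nm (u x) `^ p) +
  (L `^ q)^-1 / q * Ir 0 tp (fun x => nm (v x) `^ q).
Proof.
move=> p0 q0 pq L0 huv hu hv; apply: le_trans (Ic_nm huv) _.
rewrite -(IrZ (L `^ p / p) hu) -(IrZ ((L `^ q)^-1 / q) hv).
rewrite -(IrD (iiZ (L `^ p / p) hu) (iiZ ((L `^ q)^-1 / q) hv)).
apply: Ir_le; [exact: ii_nm huv|exact: iiD (iiZ _ hu) (iiZ _ hv)|].
by move=> x _; rewrite nmM nm_conj; apply: young_scaled => //; exact: nm_ge0.
Qed.

Lemma absorb_half (A q X : R) : 0 <= A -> 0 < q -> 0 <= X ->
  (2 * (A / q) + 1)^-1 / q * (A * X) <= X / 2.
Proof.
move=> A0 q0 X0.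
have a0 : 0 <= A / q by rewrite divr_ge0// ltW.
have -> : (2 * (A / q) + 1)^-1 / q * (A * X) = (A / q) * X / (2 * (A / q) + 1) by ring.
move: (A / q) a0 => a a0; rewrite ler_pdivrMr; last by rewrite ltr_wpDl// mulr_ge0.
have -> : X / 2 * (2 * a + 1) = a * X + X / 2 by field.
by rewrite lerDl; lra.
Qed.

(** For q < 2 the real factor blows up near 0, yet the product has the positive exponent q - 1. The
    point 0 is treated apart since exponents of [powR] add only for a nonzero base. *)
Lemma nm_powZ q z : 1 < q -> nm ((nm z `^ (q - 2))%:C * z) = nm z `^ (q - 1).
Proof.
move=> q1; rewrite nmM nmR (ger0_norm (powR_ge0 _ _)).
have [->|zn] := eqVneq z 0.
  by rewrite nm0 mulr0 powR0// gt_eqF// subr_gt0.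
have zp : 0 < nm z by rewrite nm_gt0.
rewrite -{2}[nm z]powRr1 ?(ltW zp)// -powRD; last by rewrite (gt_eqF zp) implybT.
by congr (_ `^ _); ring.
Qed.

Lemma cbm_powZ q v : 1 < q -> cbm v -> cbm (fun x => (nm (v x) `^ (q - 2))%:C * v x).
Proof.
move=> q1 hv; have [h1 h2 [M hM]] := hv.
have mp : measurable_fun `[0, tp] (fun x => nm (v x) `^ (q - 2)) := meas_powR (q - 2) (cbm_nm hv).
split.
- rewrite (_ : (fun x => _) = (fun x => nm (v x) `^ (q - 2) * complex.Re (v x))).
    exact: measurable_funM.
  by apply/funext => x; rewrite ReM /= mul0r subr0.
- rewrite (_ : (fun x => _) = (fun x => nm (v x) `^ (q - 2) * complex.Im (v x))).
    exact: measurable_funM.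
  by apply/funext => x; rewrite ImM /= mul0r addr0.
exists (M `^ (q - 1)) => x /hM h; rewrite nm_powZ//.
by rewrite ge0_ler_powR ?nnegrE ?nm_ge0 ?subr_ge0 ?(ltW q1)// (le_trans (nm_ge0 _) h).
Qed.

Lemma pow_mul_conj q z : 1 < q -> (nm z `^ (q - 2))%:C * z * conjc z = (nm z `^ q)%:C :> C.
Proof.
move=> q1; rewrite -mulrA mul_conj -rmorphM; congr (_%:C) => /=.
have [z0|zn] := eqVneq (nm z) 0.
  by rewrite z0 expr0n /= mulr0 powR0// gt_eqF// (lt_trans _ q1).
rewrite -powR_mulrn ?nm_ge0// -powRD; first by congr (_ `^ _); ring.
by rewrite zn implybT.
Qed.

(* [cp] is self-adjoint; pair [cp u] with [k = |v| ^ (p - 2) v] and absorb by Young's inequality. *)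
Lemma riesz_gt2 p : 2 < p -> exists A, riesz_bound p A.
Proof.
move=> p2; have p0 : 0 < p by lra.
have p1 : 0 < p - 1 by lra.
pose q := p / (p - 1).
have q0 : 0 < q by rewrite divr_gt0.
have hq : 1 < q <= 2.
  by rewrite /q ltr_pdivlMr// ler_pdivrMr//; apply/andP; split; lra.
have pq : p^-1 + q^-1 = 1 by rewrite /q; field; rewrite !gt_eqF.
have [A [A0 hA]] := riesz_le2 hq.
(* The Young parameter is large enough that the term containing X is at most X / 2 ([absorb_half])
   and can be moved to the left. *)
pose L := (2 * (A / q) + 1) `^ q^-1.
have L1 : 0 < 2 * (A / q) + 1 by rewrite ltr_wpDl// mulr_ge0// divr_ge0// ltW.
have L0 : 0 < L by exact: powR_gt0.
have Lq : L `^ q = 2 * (A / q) + 1 by rewrite /L -powRrM mulVf ?gt_eqF// powRr1// ltW.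
have K0 : 0 <= 2 * (L `^ p / p) by rewrite mulr_ge0// divr_ge0 ?powR_ge0 ?ltW.
exists (2 * (L `^ p / p)); split => //.
move=> u t hu ht; have /andP[t0 t1] := ht.
have t01 : 0 <= t < 1 by rewrite (ltW t0).
have iu := cbm_ic hu.
pose v th := cp u (cir t th).
have hv : cbm v := dholo_cbm (cp_dholo iu) t01.
pose k th := (nm (v th) `^ (p - 2))%:C * v th.
have hk : cbm k by apply: cbm_powZ => //; lra.
have pp1 : 1 < p by lra.
have ik := cbm_ic hk.
have dual := cp_dual hu hk ht.
set X := Ir 0 tp (fun th => nm (cp u (cir t th)) `^ p).
set U := Ir 0 tp (fun x => nm (u x) `^ p).
have vX : Ic 0 tp (fun th => cp u (cir t th) * conjc (k th)) = X%:C.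
  have e th : cp u (cir t th) * conjc (k th) = (nm (v th) `^ p)%:C.
    by rewrite /k conjM conjc_real mulrCA mulrA; exact: pow_mul_conj.
  rewrite (eq_Ic (v := fun th => (nm (v th) `^ p)%:C)); first exact: (Ic_real _ tp_ge0).
  by move=> th _; exact: e.
have kq : Ir 0 tp (fun x => nm (k x) `^ q) = X.
  apply: eq_Ir => x _; rewrite /k (nm_powZ _ pp1).
  by rewrite -powRrM; congr (_ `^ _); rewrite /q mulrC divfK// gt_eqF.
have X0 : 0 <= X by apply: Ir_ge0 => x _; exact: powR_ge0.
have hAk := hA k t hk ht; rewrite kq in hAk.
have ip := cbm_pow (ltW p0) hu.
have iq := cp_t_pow (ltW q0) ik ht.
have ick : ic 0 tp (fun th => u th * conjc (cp k (cir t th))).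
  apply: cbm_ic; apply: cbmM; first exact: hu.
  apply: cbm_conj; exact: dholo_cbm (cp_dholo ik) t01.
have h1 : X <= L `^ p / p * U + (L `^ q)^-1 / q * (A * X).
  have yo := young_Ic p0 q0 pq L0 ick ip iq.
  rewrite -dual vX nmR (ger0_norm X0) in yo.
  apply: le_trans yo _.
  apply: lerD; first exact: lexx.
  apply: ler_wpM2l; last exact: hAk.
  by rewrite divr_ge0 ?invr_ge0 ?powR_ge0 ?(ltW q0).
have h2 : (L `^ q)^-1 / q * (A * X) <= X / 2.
  by rewrite Lq; exact: absorb_half A0 q0 X0.
have e : 2 * (L `^ p / p) * U = 2 * (L `^ p / p * U) by exact: esym (mulrA _ _ _).
rewrite e; move: h1 h2; move: (_ * U) (_ * (A * X)) => a b h1 h2; clear -h1 h2.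
by lra.
Qed.

Theorem riesz p : 1 < p -> exists A, riesz_bound p A.
Proof.
move=> p1; have [p2|p2] := leP p 2; last exact: riesz_gt2.
by apply: riesz_le2; rewrite p1.
Qed.

End RieszProjection.

(** * Boundary functions *)

Section UniformConvexity.
Context {R : realType}.
Local Notation C := R[i].
Implicit Types (p x y : R) (z w : C).

Lemma powR_le_id p x : 1 < p -> 0 <= x <= 1 -> x `^ p <= x.
Proof.
move=> p1 /andP[x0 x1].
have := @ger_powR R x; have [->|xn] := eqVneq x 0; first by rewrite powR0// gt_eqF// (lt_trans _ p1).
have xp : 0 < x <= 1 by rewrite lt0r xn x0.
by move=> /(_ xp 1 p (ltW p1)); rewrite powRr1.
Qed.

(** Tangents at 1 alone give only 1. Using for 1 + y the tangent at s = 1 + y0 / 2, steeper than at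
    1, gains p (s^(p-1) - 1)(y - y0 / 2), and y - y0 / 2 >= y0 / 2. *)
Lemma powR_midpoint_gap p y0 : 1 < p -> 0 < y0 -> exists2 k, 0 < k &
  forall y, y0 <= y <= 1 -> 1 + k <= ((1 + y) `^ p + (1 - y) `^ p) / 2.
Proof.
move=> p1 y00; pose s := 1 + y0 / 2.
have s1 : 1 < s by rewrite /s ltrDl divr_gt0.
have s0 : 0 <= s by rewrite ltW// (lt_trans _ s1).
pose k := p * (s `^ (p - 1) - 1) * (y0 / 2).
have e0 : 0 < s `^ (p - 1) - 1.
  have e1 : 1 `^ (p - 1) = 1 :> R by rewrite powR1.
  rewrite subr_gt0 -[ltLHS]e1; apply: gt0_ltr_powR => //.
  - by rewrite subr_gt0.
  - by rewrite nnegrE.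
have p0 : 0 < p by rewrite (lt_trans _ p1).
have k0 : 0 < k by rewrite !mulr_gt0 ?divr_gt0.
exists (k / 2); first by rewrite divr_gt0.
move=> y /andP[hy y1].
have yp : 0 <= 1 + y by lra.
have ym : 0 <= 1 - y by lra.
have h1 := powR_tangent p1 yp s0.
have h2 := powR_tangent p1 s0 (@ler01 R).
have h3 := powR_tangent p1 ym (@ler01 R).
rewrite !powR1 in h2 h3.
have h4 : 0 <= p * (s `^ (p - 1) - 1) * (y - y0).
  by apply: mulr_ge0; [rewrite mulr_ge0// ltW|rewrite subr_ge0].
move: h1 h2 h3 h4; rewrite /k.
move: (s `^ p) (s `^ (p - 1)) ((1 + y) `^ p) ((1 - y) `^ p) => a b u v.
rewrite /s; clear => h1 h2 h3 h4.
rewrite ler_pdivlMr//; nra.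
Qed.

(** Here [y] is the relative gap between two moduli and [x] the modulus of the midpoint over the
    mean modulus. A large y gives a deficit by the previous lemma; a large 1 - x^2 gives one because
    x^p <= x and 1 - x >= (1 - x^2) / 2. *)
Lemma uc_normalised p y0 : 1 < p -> 0 < y0 -> exists2 k, 0 < k & forall x y,
  0 <= x <= 1 -> 0 <= y <= 1 ->
  y ^+ 2 + (1 - x ^+ 2) <= 2 * y0 ^+ 2 \/ k <= ((1 + y) `^ p + (1 - y) `^ p) / 2 - x `^ p.
Proof.
move=> p1 y00; have [k k0 hk] := powR_midpoint_gap p1 y00.
have q0 : 0 < y0 ^+ 2 / 2 by rewrite divr_gt0// exprn_gt0.
exists (Num.min k (y0 ^+ 2 / 2)); first by rewrite lt_min k0.
move=> x y hx hy; have /andP[x0 x1] := hx; have /andP[y0' y1] := hy.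
have hxp := powR_le_id p1 hx.
have [yy|yy] := leP y0 y.
  right; rewrite ge_min; apply/orP; left.
  have := hk y; rewrite yy y1 => /(_ isT) h; move: h hxp; clear -x1; lra.
have [xx|xx] := leP (1 - x ^+ 2) (y0 ^+ 2).
  left; have : y ^+ 2 <= y0 ^+ 2 by rewrite ler_sqr ?nnegrE ?(ltW yy) ?(ltW y00).
  by move: xx; clear; lra.
right; rewrite ge_min; apply/orP; right.
have ym : 0 <= 1 - y by lra.
have yp : 0 <= 1 + y by lra.
have h2 := powR_tangent p1 yp (@ler01 R).
have h3 := powR_tangent p1 ym (@ler01 R).
rewrite !powR1 in h2 h3; move: h2 h3 xx hxp.
move: ((1 + y) `^ p) ((1 - y) `^ p) (x `^ p) => u v w; clear -x0 x1 => h2 h3 h4 h5.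
nra.
Qed.

(* After scaling [(a + b) / 2] to [1], either [d] is small or the convexity deficit is bounded below. *)
Lemma uc_real p eta : 1 < p -> 0 < eta -> exists2 K, 0 <= K & forall a b m d : R,
  0 <= a -> 0 <= b -> 0 <= m -> 0 <= d ->
  d ^+ 2 + 4 * m ^+ 2 = 2 * a ^+ 2 + 2 * b ^+ 2 -> m <= (a + b) / 2 ->
  d `^ p <= eta * (a `^ p + b `^ p) + K * ((a `^ p + b `^ p) / 2 - m `^ p).
Proof.
move=> p1 eta0; have p0 : 0 < p by rewrite (lt_trans _ p1).
(* In the small case d^2 <= 8 s^2 y0^2 <= (3 y0 s)^2, and (3 y0)^p is [eta]. *)
pose y0 := (eta `^ p^-1) / 3.
have y00 : 0 < y0 by rewrite divr_gt0// powR_gt0.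
have y0p : (3 * y0) `^ p = eta.
  by rewrite /y0 mulrC divfK ?gt_eqF// -powRrM mulVf ?gt_eqF// powRr1// ltW.
clearbody y0; have [k k0 hk] := uc_normalised p1 y00.
(* In the other case d^2 <= 8 s^2 <= (3 s)^2, while the deficit is at least k s^p. *)
exists (3 `^ p / k); first by rewrite divr_ge0 ?powR_ge0 ?ltW.
move=> a b m d; wlog ba : a b / b <= a.
  move=> W a0 b0; have [ba|/ltW ab] := leP b a; first exact: W.
  by rewrite [a `^ p + _]addrC [a + b]addrC [2 * a ^+ 2 + _]addrC; exact: W.
move=> a0 b0 m0 d0 par hm.
have [a00|an] := eqVneq a 0.
  have b00 : b = 0 by apply/le_anti; rewrite b0 -a00 ba.
  have d00 : d = 0.
    apply/eqP; rewrite -sqrf_eq0; apply/eqP; move: par (sqr_ge0 d) (sqr_ge0 m).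
    by rewrite a00 b00 expr0n /=; clear; move: (d ^+ 2) (m ^+ 2) => u v; lra.
  have m00 : m = 0 by move: m0 hm; rewrite a00 b00; clear; lra.
  by rewrite a00 b00 d00 m00 powR0 ?gt_eqF// !(addr0, mul0r, mulr0, subrr).
have ap : 0 < a by rewrite lt0r an.
pose s := (a + b) / 2; have s0 : 0 < s by rewrite divr_gt0// ltr_wpDr.
pose y := (a - b) / (2 * s); pose x := m / s.
have sn : s != 0 by rewrite gt_eqF.
have ys : y * s = (a - b) / 2 by rewrite /y; field.
have xs : x * s = m by rewrite /x divfK.
have hx : 0 <= x <= 1 by rewrite divr_ge0 ?(ltW s0)//= ler_pdivrMr// mul1r.
have hy : 0 <= y <= 1.
  apply/andP; split; rewrite /y.
    by apply: divr_ge0; [rewrite subr_ge0|rewrite mulr_ge0// ltW].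
  rewrite ler_pdivrMr /s; last exact: mulr_gt0 s0.
  by clear -b0; lra.
have /andP[y0' y1] := hy; have /andP[x0 x1] := hx.
have aE : a = s * (1 + y) by rewrite mulrDr mulr1 [s * y]mulrC ys /s; field.
have bE : b = s * (1 - y) by rewrite mulrBr mulr1 [s * y]mulrC ys /s; field.
have dE : d ^+ 2 = 4 * s ^+ 2 * (y ^+ 2 + (1 - x ^+ 2)).
  apply: (addIr (4 * m ^+ 2)); rewrite par -xs aE bE; ring.
clearbody x y s.
have yp : 0 <= 1 + y by clear -y0'; lra.
have ym : 0 <= 1 - y by rewrite subr_ge0.
have sp : 0 <= s := ltW s0.
have Sp : 0 < s `^ p by exact: powR_gt0.
have D0 : a `^ p + b `^ p = s `^ p * ((1 + y) `^ p + (1 - y) `^ p).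
  by rewrite [RHS]mulrDr -(powRM p sp yp) -(powRM p sp ym) -aE -bE.
have D : (a `^ p + b `^ p) / 2 - m `^ p = s `^ p * (((1 + y) `^ p + (1 - y) `^ p) / 2 - x `^ p).
  by rewrite D0 -{1}xs (powRM p x0 sp); ring.
have h2 := powR_tangent p1 yp (@ler01 R).
have h3 := powR_tangent p1 ym (@ler01 R).
rewrite !powR1 in h2 h3.
have hxp : x `^ p <= 1 by apply: le_trans x1; exact: powR_le_id.
rewrite D D0.
have T0 : 1 <= ((1 + y) `^ p + (1 - y) `^ p) / 2.
  by move: h2 h3; move: ((1 + y) `^ p) ((1 - y) `^ p) => u v; clear; lra.
have [small|big] := hk x y hx hy.
  have : d `^ p <= eta * s `^ p.
    rewrite -y0p -powRM ?mulr_ge0 ?(ltW y00)//.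
    rewrite ge0_ler_powR ?nnegrE ?(ltW p0) ?mulr_ge0 ?(ltW y00)//.
    rewrite -(@ler_pXn2r _ 2) ?nnegrE ?mulr_ge0 ?(ltW y00)// dE !exprMn.
    have := ler_wpM2l (mulr_ge0 (ler0n R 4) (sqr_ge0 s)) small.
    have := mulr_ge0 (sqr_ge0 s) (sqr_ge0 y0).
    clear; move: (s ^+ 2) (y0 ^+ 2) (y ^+ 2 + _) => u v w h1 h2; nra.
  move=> h; apply: le_trans h _.
  apply: (@le_trans _ _ (eta * (s `^ p * ((1 + y) `^ p + (1 - y) `^ p)))).
    apply: ler_wpM2l; first exact: ltW.
    apply: ler_peMr; first exact: ltW.
    by move: T0; clear; lra.
  rewrite lerDl mulr_ge0 ?divr_ge0 ?powR_ge0 ?(ltW k0)// mulr_ge0 ?powR_ge0//.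
  by move: T0 hxp; clear; lra.
have dS : d `^ p <= 3 `^ p * s `^ p.
  rewrite -powRM// ge0_ler_powR ?nnegrE ?(ltW p0) ?mulr_ge0//.
  rewrite -(@ler_pXn2r _ 2) ?nnegrE ?mulr_ge0// dE exprMn.
  have h : y ^+ 2 + (1 - x ^+ 2) <= 2.
    have := sqr_ge0 x; have : y ^+ 2 <= 1 by rewrite expr_le1.
    by clear; lra.
  have := ler_wpM2l (mulr_ge0 (ler0n R 4) (sqr_ge0 s)) h; have := sqr_ge0 s.
  by clear; move: (s ^+ 2) (y ^+ 2 + _) => u w; lra.
apply: le_trans dS _.
apply: (@le_trans _ _ (3 `^ p / k * (s `^ p * k))).
  by rewrite le_eqVlt; apply/orP; left; apply/eqP; field; rewrite gt_eqF.
rewrite -[leLHS]add0r; apply: lerD.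
  by rewrite mulr_ge0 ?(ltW eta0)// mulr_ge0 ?powR_ge0// addr_ge0 ?powR_ge0.
apply: ler_wpM2l; first by rewrite divr_ge0 ?powR_ge0 ?(ltW k0).
by apply: ler_wpM2l; first exact: powR_ge0.
Qed.

(** The parallelogram law provides the quadratic relation of [uc_real], so the plane geometry enters
    through moduli only. *)
Lemma uc_complex p eta : 1 < p -> 0 < eta -> exists2 K, 0 <= K & forall z w,
  nm (z - w) `^ p <= eta * (nm z `^ p + nm w `^ p) +
    K * ((nm z `^ p + nm w `^ p) / 2 - nm ((z + w) / 2) `^ p).
Proof.
move=> p1 e0; have [K K0 h] := uc_real p1 e0; exists K => // z w.
have n2 : nm ((z + w) / 2) = nm (z + w) / 2.
  by rewrite nmM nmV nm2.
apply: h; rewrite ?nm_ge0//; last by rewrite n2 ler_pM2r ?nmD.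
have -> : 4 * nm ((z + w) / 2) ^+ 2 = nm (z + w) ^+ 2 by rewrite n2; field.
rewrite !nm_sqr !ReD !ImD ReN ImN.
by move: (complex.Re z) (complex.Im z) (complex.Re w) (complex.Im w) => a b c d; ring.
Qed.

End UniformConvexity.

(** * Dilates form a Cauchy family in L^p *)

Section BoundaryCauchy.
Context {R : realType}.
Local Notation C := R[i].
Local Notation tp := (2 * pi : R).
Implicit Types (r s t x y th p q : R) (u v : R -> C) (z w : C) (F : C -> C).

Definition Np p F r := Ir 0 tp (fun th => nm (F (cir r th)) `^ p).

Lemma cpint_contract p t u v : 1 < p -> 0 < t < 1 -> cbm u -> cbm v ->
  (forall th, 0 <= th <= tp -> v th = cpint t u th) ->
  Ir 0 tp (fun th => nm (v th) `^ p) <= Ir 0 tp (fun th => nm (u th) `^ p).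
Proof.
move=> p1 t01 hu hv h; have p0 : 0 <= p by rewrite ltW// (lt_trans _ p1).
have t01' : 0 <= t < 1 by have /andP[/ltW -> ->] := t01.
have nu x : 0 <= x <= tp -> 0 <= nm (u x) by move=> _; exact: nm_ge0.
have [i1 l1] := pint_contract p1 t01' nu (ii_nm (cbm_ic hu)) (cbm_pow p0 hu).
apply: le_trans l1; apply: Ir_le; [exact: cbm_pow|exact: i1|].
move=> th hth; rewrite ge0_ler_powR ?nnegrE ?nm_ge0//; first exact: pint_ge0.
rewrite h//.
have ip : ic 0 tp (fun s => (pker t (th - s))%:C * u s).
  by apply: ic_mulcont; [move=> s _; apply: (@ccont_real _ (fun s => pker t (th - s))); exact: pker_shift_cont|exact: cbm_ic].
rewrite /cpint tpV nmM nmR ger0_norm ?invr_ge0 ?tp_ge0// /pint.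
apply: ler_wpM2l; first by rewrite invr_ge0 tp_ge0.
apply: le_trans (Ic_nm ip) _; rewrite le_eqVlt; apply/orP; left; apply/eqP.
by apply: eq_Ir => s _; rewrite nmM nmR ger0_norm// pker_ge0.
Qed.

End BoundaryCauchy.

Section BoundaryCauchySequence.
Context {R : realType}.
Local Notation C := R[i].
Local Notation tp := (2 * pi : R).
Implicit Types (r s t x y th p q : R) (u v : R -> C) (z w : C) (F : C -> C).

Lemma cbm_dil F r : dholo F -> 0 < r < 1 -> cbm (fun th => F (cir r th)).
Proof. by move=> hF /andP[r0 r1]; apply: dholo_cbm; rewrite ?(ltW r0). Qed.

Lemma cbmZ (c : C) u : cbm u -> cbm (fun x => c * u x).
Proof. by move=> hu; apply: cbmM; first exact: cbm_cst. Qed.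

Lemma cbmB u v : cbm u -> cbm v -> cbm (fun x => u x - v x).
Proof.
move=> hu hv; have := cbmD hu (cbmZ (-1) hv).
by congr cbm; apply/funext => x; rewrite mulN1r.
Qed.

Lemma cbm_half u v : cbm u -> cbm v -> cbm (fun x => (u x + v x) / 2).
Proof.
by move=> hu hv; apply: (@cbmM _ (fun x => u x + v x) (fun=> 2^-1)); [exact: cbmD|exact: cbm_cst].
Qed.

Lemma dil_lt r s : 0 < r < 1 -> 0 < s < 1 -> 0 < r * s < 1.
Proof. by move=> /andP[r0 r1] /andP[s0 s1]; rewrite mulr_gt0//= mulr_ilt1 ?ltW. Qed.

(** Dilation by t is a Poisson integral, hence linear and contractive, so it can be applied to the
    average of two dilates. *)
Lemma half_contract p F r s t : 1 < p -> dholo F -> 0 < r < 1 -> 0 < s < 1 -> 0 < t < 1 ->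
  Ir 0 tp (fun th => nm ((F (cir (t * r) th) + F (cir (t * s) th)) / 2) `^ p) <=
  Ir 0 tp (fun th => nm ((F (cir r th) + F (cir s th)) / 2) `^ p).
Proof.
move=> p1 hF hr hs ht.
apply: (cpint_contract (t := t) (u := fun th => (F (cir r th) + F (cir s th)) / 2)
  (v := fun th => (F (cir (t * r) th) + F (cir (t * s) th)) / 2) p1 ht).
- exact: cbm_half (cbm_dil hF hr) (cbm_dil hF hs).
- by apply: cbm_half; apply: cbm_dil => //; exact: dil_lt.
move=> th hth; rewrite -(cpint_dil hF ht hr hth) -(cpint_dil hF ht hs hth) /cpint.
have ht' : 0 <= t < 1 by have /andP[/ltW -> ->] := ht.
have ip u : cbm u -> ic 0 tp (fun x => (pker t (th - x))%:C * u x).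
  move=> hu; apply: ic_mulcont; last exact: cbm_ic.
  by move=> x _; apply: (@ccont_real _ (fun s => pker t (th - s))); exact: pker_shift_cont.
have i1 := ip _ (cbm_dil hF hr); have i2 := ip _ (cbm_dil hF hs).
rewrite -mulrDr -mulrA; congr (_ * _); rewrite -(IcD i1 i2) mulrC -(IcZ _ (icD i1 i2)).
by apply: eq_Ic => x _; ring.
Qed.

Lemma one_sub_expr_le r n : 0 <= r <= 1 -> 1 - r ^+ n <= n%:R * (1 - r).
Proof.
move=> /andP[r0 r1]; elim: n => [|n IH]; first by rewrite expr0 subrr mul0r.
have h : r ^+ n <= 1 by rewrite exprn_ile1.
have h0 : 0 <= r ^+ n by rewrite exprn_ge0.
rewrite exprS -natr1 mulrDl mul1r; move: (r ^+ n) h h0 IH => x; clear -r0 r1; nra.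
Qed.

Lemma dil_uniform F t e : dholo F -> 0 < t < 1 -> 0 < e ->
  exists2 rho, 0 <= rho < 1 & forall r, rho < r < 1 -> forall th, 0 <= th <= tp ->
    nm (F (cir (t * r) th) - F (cir t th)) <= e.
Proof.
move=> hF ht e0; have /andP[t0 t1] := ht; have ht' : 0 <= t < 1 by rewrite (ltW t0).
have e4 : 0 < e / 4 by rewrite divr_gt0.
have [N hN] := psum_tail (coef_pbd hF) ht' e4.
pose S := \sum_(k < N) nm (coef F k) * N%:R.
have S0 : 0 <= S by apply: sumr_ge0 => k _; rewrite mulr_ge0 ?nm_ge0.
have S1 : 0 < S + 1 by rewrite ltr_wpDl.
pose d := e / 4 / (S + 1); have d0 : 0 < d by rewrite divr_gt0.
exists (Num.max 0 (1 - d)).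
  by rewrite le_max lexx/= gt_max ltr01/= ltrBlDr ltrDl.
move=> r /andP[]; rewrite gt_max => /andP[r0 rd] r1 th hth.
have hr : 0 < r < 1 by rewrite r0.
have /andP[tr0 tr1] := dil_lt ht hr.
rewrite (holo_expansion hF (dil_lt ht hr) hth) (holo_expansion hF ht hth).
have n1 : nm (cir (t * r) th) <= t by rewrite (nm_cir _ (ltW tr0)) ler_piMr ?ltW.
have n2 : nm (cir t th) <= t by rewrite (nm_cir _ (ltW t0)).
have h1 := hN N (leqnn N) _ n1; have h2 := hN N (leqnn N) _ n2.
apply: le_trans (nm_tri _ (\sum_(k < N) coef F k * cir (t * r) th ^+ k) _) _.
apply: (@le_trans _ _ (e / 4 + (e / 4 + e / 4))); last by clear -e0; lra.
apply: lerD; first exact: h1.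
apply: le_trans (nm_tri _ (\sum_(k < N) coef F k * cir t th ^+ k) _) _.
apply: lerD; last by rewrite nm_distC; exact: h2.
rewrite -sumrB; apply: le_trans (nm_sum _ _ _) _.
apply: (@le_trans _ _ (\sum_(k < N) (nm (coef F k) * N%:R) * d)); last first.
  rewrite -mulr_suml -/S /d mulrA ler_pdivrMr// [leRHS]mulrC ler_wpM2r ?lerDl//.
  exact: ltW.
apply: ler_sum => k _.
have -> : coef F k * cir (t * r) th ^+ k - coef F k * cir t th ^+ k =
   coef F k * (((r ^+ k - 1)%:C) * cir t th ^+ k).
  rewrite mulrC [t * r]mulrC cirM exprMn rmorphB rmorphXn /=; ring.
rewrite nmM -mulrA; apply: ler_wpM2l; first exact: nm_ge0.
rewrite nmM nmX (nm_cir _ (ltW t0)) nmR distrC.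
have hr' : 0 <= r <= 1 by rewrite !ltW.
have rk : r ^+ k <= 1 by rewrite exprn_ile1 ?ltW.
rewrite ger0_norm ?subr_ge0//.
apply: (@le_trans _ _ (k%:R * (1 - r) * 1)).
  by apply: ler_pM; rewrite ?subr_ge0 ?exprn_ge0 ?(ltW t0)//; [exact: one_sub_expr_le|rewrite exprn_ile1 ?ltW].
rewrite mulr1; apply: ler_pM => //; first by rewrite subr_ge0 ltW.
  by rewrite ler_nat; exact: ltnW (ltn_ord k).
by move: rd; clear; lra.
Qed.

(** Both dilates tend to F_t uniformly; the tangent inequality at |F_t| turns this into a lower
    bound for the p-th power, with slope at most p B^(p-1). *)
Lemma half_lower p F t e : 1 < p -> dholo F -> 0 < t < 1 -> 0 < e ->
  exists2 rho, 0 <= rho < 1 & forall r s, rho < r < 1 -> rho < s < 1 ->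
    Np p F t - e <= Ir 0 tp (fun th => nm ((F (cir (t * r) th) + F (cir (t * s) th)) / 2) `^ p).
Proof.
move=> p1 hF ht e0; have p0 : 0 < p by rewrite (lt_trans _ p1).
have ht' : 0 <= t < 1 by have /andP[/ltW -> ->] := ht.
have [B hB] := dholo_bd hF ht'.
have B0 : 0 <= B.
  by apply: le_trans (nm_ge0 _) (hB 0 _); rewrite lexx tp_ge0.
have T0 := @tp_gt0 R.
have c0 : 0 <= p * B `^ (p - 1) * tp.
  by apply: mulr_ge0; [apply: mulr_ge0; [exact: ltW|exact: powR_ge0]|exact: ltW].
have c1 : 0 < p * B `^ (p - 1) * tp + 1 by rewrite ltr_wpDl.
pose d := e / (p * B `^ (p - 1) * tp + 1); have d0 : 0 < d by rewrite divr_gt0.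
have [rho rho1 hrho] := dil_uniform hF ht d0.
exists rho => // r s hr hs; have /andP[rho0 _] := rho1.
have hr' : 0 < r < 1 by have /andP[h ->] := hr; rewrite (le_lt_trans rho0 h).
have hs' : 0 < s < 1 by have /andP[h ->] := hs; rewrite (le_lt_trans rho0 h).
have cF := cbm_dil hF ht.
have cH := cbm_half (cbm_dil hF (dil_lt ht hr')) (cbm_dil hF (dil_lt ht hs')).
have iF := cbm_pow (ltW p0) cF; have iH := cbm_pow (ltW p0) cH.
have bd : p * B `^ (p - 1) * d * (tp - 0) <= e.
  rewrite subr0 /d; move: c0 c1; rewrite [p * _ * _ * tp]mulrAC.
  move: (p * _ * tp) => c c0 c1.
  by rewrite mulrA ler_pdivrMr// mulrC ler_wpM2l ?lerDl// ltW.
apply: (@le_trans _ _ (Np p F t - p * B `^ (p - 1) * d * (tp - 0))).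
  by rewrite lerD2l lerN2.
rewrite -(Ir_cst _ tp_ge0) /Np -(IrB iF (ii_cst _ _ _)).
apply: Ir_le; [exact: iiB iF (ii_cst _ _ _)|exact: iH|move=> th hth].
apply: le_trans (powR_tangent p1 (nm_ge0 _) (nm_ge0 (F (cir t th)))).
rewrite lerD2l lerNl -mulrN opprB.
have h : nm (F (cir t th)) - nm ((F (cir (t * r) th) + F (cir (t * s) th)) / 2) <= d.
  apply: le_trans (nm_lerB _ _) _; rewrite nm_distC.
  have -> : (F (cir (t * r) th) + F (cir (t * s) th)) / 2 - F (cir t th) =
    ((F (cir (t * r) th) - F (cir t th)) + (F (cir (t * s) th) - F (cir t th))) / 2.
    by field.
  rewrite nmM nmV nm2 ler_pdivrMr//; apply: le_trans (nmD _ _) _.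
  by have := hrho r hr th hth; have := hrho s hs th hth; clear; lra.
have k0 : 0 <= p * nm (F (cir t th)) `^ (p - 1) by rewrite mulr_ge0 ?powR_ge0 ?ltW.
apply: (@le_trans _ _ (p * nm (F (cir t th)) `^ (p - 1) * d)).
  by apply: ler_wpM2l.
apply: ler_wpM2r; first exact: ltW.
apply: ler_wpM2l; first exact: ltW.
by rewrite ge0_ler_powR ?nnegrE ?nm_ge0 ?subr_ge0 ?(ltW p1)//; exact: hB.
Qed.

(* By contractivity [|F_r + F_s|_p >= |F_(tr) + F_(ts)|_p], which tends to [2 |F_t|_p], close to
   twice the supremum of the norms; uniform convexity then forces [F_r - F_s] to be small. *)
Lemma Lp_cauchy p F M e : 1 < p -> dholo F -> (forall r, 0 < r < 1 -> Np p F r <= M) -> 0 < e ->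
  exists2 rho, 0 <= rho < 1 & forall r s, rho < r < 1 -> rho < s < 1 ->
    Ir 0 tp (fun th => nm (F (cir r th) - F (cir s th)) `^ p) <= e.
Proof.
move=> p1 hF hM e0; have p0 : 0 < p by rewrite (lt_trans _ p1).
have np0 r : 0 <= Np p F r by apply: Ir_ge0 => x _; exact: powR_ge0.
pose E := [set Np p F r | r in [set r | 0 < r < 1]].
have hE : has_sup E.
  split; last by exists M => _ [r hr <-]; exact: hM.
  by exists (Np p F (1 / 2)), (1 / 2) => //=; lra.
have hS r : 0 < r < 1 -> Np p F r <= sup E.
  by move=> hr; apply: sup_upper_bound => //; exists r.
set S := sup E in hS *.
have S0 : 0 <= S by apply: le_trans (np0 (1 / 2)) (hS _ _); lra.
pose eta := e / (4 * (S + 1)); have eta0 : 0 < eta by rewrite divr_gt0// mulr_gt0// ltr_wpDl.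
have [K K0 hK] := @uc_complex R p eta p1 eta0.
pose e1 := e / (4 * (K + 1)); have e10 : 0 < e1 by rewrite divr_gt0// mulr_gt0// ltr_wpDl.
have [_ [t ht <-] St] := sup_adherent e10 hE.
have [rho hrho h] := half_lower p1 hF ht e10.
exists rho => // r s hr hs; have /andP[rho0 _] := hrho.
have hr' : 0 < r < 1 by have /andP[h' ->] := hr; rewrite (le_lt_trans rho0 h').
have hs' : 0 < s < 1 by have /andP[h' ->] := hs; rewrite (le_lt_trans rho0 h').
have l1 := le_trans (h r s hr hs) (half_contract p1 hF hr' hs' ht).
have cr := cbm_dil hF hr'; have cs := cbm_dil hF hs'.
have ir := cbm_pow (ltW p0) cr; have is_ := cbm_pow (ltW p0) cs.
have ih := cbm_pow (ltW p0) (cbm_half cr cs); have id' := cbm_pow (ltW p0) (cbmB cr cs).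
pose f th := eta * (nm (F (cir r th)) `^ p + nm (F (cir s th)) `^ p) +
  K * (2^-1 * (nm (F (cir r th)) `^ p + nm (F (cir s th)) `^ p) -
       nm ((F (cir r th) + F (cir s th)) / 2) `^ p).
have i2 := iiB (iiZ 2^-1 (iiD ir is_)) ih.
have jf : ii 0 tp f := iiD (iiZ eta (iiD ir is_)) (iiZ K i2).
have fE : Ir 0 tp f = eta * (Np p F r + Np p F s) + K * (2^-1 * (Np p F r + Np p F s) -
    Ir 0 tp (fun th => nm ((F (cir r th) + F (cir s th)) / 2) `^ p)).
  rewrite /f (IrD (iiZ eta (iiD ir is_)) (iiZ K i2)) (IrZ K i2) (IrZ eta (iiD ir is_)).
  by rewrite (IrB (iiZ 2^-1 (iiD ir is_)) ih) (IrZ 2^-1 (iiD ir is_)) (IrD ir is_).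
apply: (@le_trans _ _ (Ir 0 tp f)).
  apply: Ir_le; [exact: id'|exact: jf|move=> th _].
  by rewrite /f [2^-1 * _]mulrC; exact: hK.
rewrite fE; have := hS r hr'; have := hS s hs'; move: l1 St; rewrite -/S.
move: (Ir _ _ _) (np0 r) (np0 s) (Np p F r) (Np p F s) (Np p F t) => H _ _ a b c l1 St hb ha.
have x1 : eta * (a + b) <= e / 2.
  apply: (@le_trans _ _ (eta * (2 * (S + 1)))).
    by rewrite ler_wpM2l ?ltW//; move: ha hb; clear; lra.
  rewrite le_eqVlt; apply/orP; left; apply/eqP; rewrite /eta; field.
  by rewrite gt_eqF// ltr_wpDl.
have x2 : K * (2^-1 * (a + b) - H) <= e / 2.
  apply: (@le_trans _ _ (K * (2 * e1))).
    by rewrite ler_wpM2l//; move: ha hb l1 St; clear; lra.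
  apply: (@le_trans _ _ ((K + 1) * (2 * e1))).
    by rewrite ler_wpM2r ?lerDl// mulr_ge0// ltW.
  rewrite le_eqVlt; apply/orP; left; apply/eqP; rewrite /e1; field.
  by rewrite gt_eqF// ltr_wpDl.
by move: x1 x2; clear; move: (eta * _) (K * _) => u v; lra.
Qed.

End BoundaryCauchySequence.

(** * Integrals of functions that agree off a null set *)

Section AlmostEverywhere.
Context d (T : measurableType d) (R : realType) (mu : {measure set T -> \bar R}).
Local Open Scope ereal_scope.
Import HBNNSimple.

(** The integral of [f] is a supremum over simple functions below it, which makes sense without
    measurability. Off [N] these lie below [g]; conversely [g] cut off to the complement of [N] lies
    below [f]. *)
Lemma ge0_integral_offnull (f g : T -> \bar R) (N : set T) :
  measurable N -> mu N = 0 -> measurable_fun setT g ->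
  (forall x, 0 <= f x) -> (forall x, 0 <= g x) -> (forall x, ~ N x -> f x = g x) ->
  \int[mu]_x f x = \int[mu]_x g x.
Proof.
move=> mN N0 mg f0 g0 fg; apply/eqP; rewrite eq_le; apply/andP; split.
  rewrite (ge0_integralTE _ f0); apply: ge_ereal_sup => _ [h /= hf <-].
  have <- : \int[mu]_x (h x)%:E = sintegral mu h.
    by rewrite integral_nnsfun// patch_setT.
  have h0 x : 0 <= (h x)%:E by rewrite lee_fin; exact: fun_ge0.
  have mh : measurable_fun setT (fun x : T => (h x)%:E) by apply/measurable_EFinP.
  rewrite (ge0_negligible_integral mN)// [leRHS](ge0_negligible_integral mN)//.
  apply: ge0_le_integral => //.
  - exact: measurableD.
  - by apply: measurable_funS mh.
  - by apply: measurable_funS mg.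
  by move=> x [_ /fg <-].
rewrite (ge0_negligible_integral mN)//.
rewrite (_ : \int[mu]_(x in _ `\` _) g x = \int[mu]_(x in setT `\` N) f x); last first.
  by apply: eq_integral => x; rewrite inE => -[_ /fg ->].
rewrite integral_mkcond.
have f0' x : 0 <= (f \_ (setT `\` N)) x by rewrite patchE; case: ifP.
rewrite (ge0_integralTE _ f0) (ge0_integralTE _ f0').
apply: ge_ereal_sup => _ [h /= hf <-]; apply: ereal_sup_ubound; exists h => //= x.
by apply: le_trans (hf x) _; rewrite patchE; case: ifP.
Qed.

(* [f] need not be measurable: it will involve [bv], whose measurability is never established. *)
Lemma integral_ae_any (D : set T) (f g : T -> \bar R) :
  measurable D -> measurable_fun D g ->
  {ae mu, forall x, D x -> f x = g x} ->
  \int[mu]_(x in D) f x = \int[mu]_(x in D) g x.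
Proof.
move=> mD mg [N [mN N0 fg]].
have mg' : measurable_fun setT (g \_ D) by apply/(measurable_restrictT _ _).1.
have fgN x : ~ N x -> (f \_ D) x = (g \_ D) x.
  move=> Nx; rewrite !patchE; case: ifPn => // /set_mem Dx.
  by apply/not_notP => h; apply: Nx; apply: fg => /= /(_ Dx).
rewrite integral_mkcond [RHS]integral_mkcond integralE [RHS]integralE.
congr (_ - _); apply: (ge0_integral_offnull mN N0) => //.
- exact: measurable_funepos.
- by move=> x /fgN e; rewrite !funeposE e.
- exact: measurable_funeneg.
- by move=> x /fgN e; rewrite !funenegE e.
Qed.

End AlmostEverywhere.

(** * Fatou, monotone convergence and series of bounded variation *)

Section BoundaryLimit.
Context {R : realType}.
Local Notation C := R[i].
Local Notation tp := (2 * pi : R).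
Local Notation mu := (@lebesgue_measure R).
Local Notation D := (`[(0 : R), tp]%classic).
Implicit Types (r s t x y th p q : R) (u v : R -> C) (z w : C) (F : C -> C).

Lemma limn_einf_le (a : (\bar R)^nat) (M : \bar R) : (forall k, (a k <= M)%E) -> (limn_einf a <= M)%E.
Proof.
move=> h; rewrite limn_einf_lim; apply: lime_le; first exact: is_cvg_einfs.
apply: nearW => n; apply: le_trans (h n); apply: ereal_inf_lbound.
by exists n => //=.
Qed.

Lemma fatou_Ir (f : nat -> R -> R) (g : R -> R) M : (forall k, ii 0 tp (f k)) ->
  (forall k x, 0 <= x <= tp -> 0 <= f k x) -> (forall k, Ir 0 tp (f k) <= M) ->
  (forall x, 0 <= x <= tp -> f ^~ x @ \oo --> g x) ->
  ii 0 tp g /\ Ir 0 tp g <= M.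
Proof.
move=> fi f0 fM fg.
have mD : measurable (`[0, tp]%classic : set (measurableTypeR R)) by exact: measurable_itv.
have mf k : measurable_fun `[0, tp] (EFin \o f k) by apply/measurable_EFinP; exact: ii_meas.
have mg : measurable_fun `[0, tp] g.
  apply: (@measurable_fun_cvg _ _ _ `[0, tp]%classic f).
    by move=> k; exact: ii_meas.
  by move=> x /=; rewrite in_itv /=; exact: fg.
have g0 x : 0 <= x <= tp -> 0 <= g x.
  move=> hx; rewrite -(cvg_lim _ (fg x hx))//; apply: limr_ge.
    by apply/cvg_ex; exists (g x); exact: fg.
  by apply: nearW => k; exact: f0.
have h : (\int[mu]_(x in D) (g x)%:E <= M%:E)%E.
  rewrite (@eq_integral _ _ _ mu D (fun x => limn_einf (fun k => (f k x)%:E))).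
    apply: le_trans (fatou mu mD mf _) _.
      by move=> k x /=; rewrite in_itv /= => hx; rewrite lee_fin; exact: f0.
    by apply: limn_einf_le => k; rewrite EFin_Ir// lee_fin.
  move=> x; rewrite inE /= in_itv /= => hx.
  have hc : (fun k => (f k x)%:E) @ \oo --> (g x)%:E by apply: cvg_EFin; [exact: nearW|exact: fg].
  by rewrite is_cvg_limn_einfE; [exact/esym/cvg_lim|apply/cvg_ex; exists (g x)%:E].
have gi : ii 0 tp g by apply: ii_ge0 => //; apply: le_lt_trans h _; rewrite ltry.
by split => //; rewrite -lee_fin -EFin_Ir.
Qed.

Lemma ae_bounded_series (g : nat -> R -> R) M : (forall k, ii 0 tp (g k)) ->
  (forall k x, 0 <= x <= tp -> 0 <= g k x) -> (forall n, \sum_(k < n) Ir 0 tp (g k) <= M) ->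
  {ae mu, forall x, 0 <= x <= tp -> exists b, forall n, \sum_(k < n) g k x <= b}.
Proof.
move=> gi g0 gM.
have mD : measurable (`[0, tp]%classic : set (measurableTypeR R)) by exact: measurable_itv.
have mg k : measurable_fun `[0, tp] (EFin \o g k) by apply/measurable_EFinP; exact: ii_meas.
have g0' k x : `[0, tp]%classic x -> (0 <= (g k x)%:E)%E.
  by rewrite /= in_itv /= => hx; rewrite lee_fin; exact: g0.
have G0 x : `[0, tp]%classic x -> (0 <= \sum_(k <oo) (g k x)%:E)%E.
  by move=> hx; apply: nneseries_ge0 => k _ _; exact: g0'.
have mG : measurable_fun `[0, tp] (fun x => \sum_(k <oo) (g k x)%:E)%E.
  by apply: ge0_emeasurable_sum => [k x hx _|k _]; [exact: g0'|exact: mg].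
have hI : (\int[mu]_(x in D) \sum_(k <oo) (g k x)%:E <= M%:E)%E.
  rewrite integral_nneseries//; apply: lime_le.
    by apply: is_cvg_nneseries => k _ _; apply: integral_ge0 => x; exact: g0'.
  apply: nearW => n; rewrite (eq_bigr (fun k => (Ir 0 tp (g k))%:E)).
    by rewrite sumEFin lee_fin big_mkord.
  by move=> k _; rewrite EFin_Ir.
have hint : mu.-integrable D (fun x => \sum_(k <oo) (g k x)%:E)%E.
  apply/integrableP; split => //.
  rewrite (@eq_integral _ _ _ mu D (fun x => \sum_(k <oo) (g k x)%:E)%E).
    by apply: le_lt_trans hI _; rewrite ltry.
  by move=> x; rewrite inE => hx; rewrite gee0_abs//; exact: G0.
apply: (ae_imp _ (integrable_ae mD hint)) => x h hx.
have hx' : `[0, tp]%classic x by rewrite /= in_itv.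
exists (fine (\sum_(k <oo) (g k x)%:E)%E) => n.
rewrite -lee_fin fineK; last exact: h.
rewrite -sumEFin -(big_mkord xpredT (fun k => (g k x)%:E)).
by apply: nneseries_lim_ge => k _ _; exact: g0'.
Qed.

Lemma cvg_of_bounded_var (a : R^nat) b : (forall n, \sum_(k < n) `|a k.+1 - a k| <= b) -> cvgn a.
Proof.
move=> h; have c1 : cvgn (series (telescope a)).
  apply: normed_cvg; apply: nondecreasing_is_cvgn.
    by apply: nondecreasing_series => k _ _; exact: normr_ge0.
  exists b => _ [n _ <-]; change (\sum_(0 <= k < n) `|telescope a k| <= b).
  by rewrite big_mkord; exact: h.
have : cvgn (fun n => a 0%N + series (telescope a) n).
  by apply: is_cvgD; [exact: is_cvg_cst|exact: c1].
by rewrite (_ : (fun n => _) = a)//; apply/funext => n; rewrite [RHS]eq_sum_telescope.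
Qed.

(** Either x <= c, or (x / c)^(p-1) >= 1. Applied with c = e to a function whose p-th power
    integrates to at most e^p, it bounds the L^1 norm by (2 pi + 1) e; this serves in place of
    Hoelder against a constant. *)
Lemma le_powR_split p (c x : R) : 1 < p -> 0 < c -> 0 <= x -> x <= c + (c `^ (p - 1))^-1 * x `^ p.
Proof.
move=> p1 c0 x0; have cp0 : 0 < c `^ (p - 1) by exact: powR_gt0.
have [xc|xc] := leP x c.
  by rewrite (le_trans xc)// lerDl mulr_ge0 ?invr_ge0 ?powR_ge0.
have xp : 0 < x by exact: lt_trans xc.
apply: (@le_trans _ _ ((c `^ (p - 1))^-1 * x `^ p)); last by rewrite lerDr ltW.
rewrite ler_pdivlMl//.
have -> : x `^ p = x `^ (p - 1) * x.
  rewrite -{3}[x]powRr1 ?ltW// -powRD; first by congr (_ `^ _); ring.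
  by apply/implyP => _; rewrite gt_eqF.
by rewrite ler_wpM2r ?(ltW xp)// ge0_ler_powR ?nnegrE ?subr_ge0 ?ltW.
Qed.

End BoundaryLimit.

Section BoundaryFunction.
Context {R : realType}.
Local Notation C := R[i].
Local Notation tp := (2 * pi : R).
Local Notation mu := (@lebesgue_measure R).
Local Notation D := (`[(0 : R), tp]%classic).
Implicit Types (r s t x y th p q : R) (u v : R -> C) (z w : C) (F : C -> C).

Definition cmeas u := measurable_fun D (fun x => complex.Re (u x)) /\
  measurable_fun D (fun x => complex.Im (u x)).

Lemma cmeas_nm u : cmeas u -> measurable_fun D (fun x => nm (u x)).
Proof. by move=> [h1 h2]; exact: ic_nm_meas. Qed.

Lemma cbm_cmeas u : cbm u -> cmeas u. Proof. by case. Qed.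

Lemma cmeasB u v : cmeas u -> cmeas v -> cmeas (fun x => u x - v x).
Proof.
move=> [h1 h2] [h3 h4]; split.
- rewrite (_ : (fun x => _) = (fun x => complex.Re (u x) - complex.Re (v x))).
    exact: measurable_funB.
  by apply/funext => x; rewrite ReD ReN.
- rewrite (_ : (fun x => _) = (fun x => complex.Im (u x) - complex.Im (v x))).
    exact: measurable_funB.
  by apply/funext => x; rewrite ImD ImN.
Qed.

Lemma ii_powD p u v : 1 < p -> cmeas u -> cmeas v -> ii 0 tp (fun x => nm (u x) `^ p) ->
  ii 0 tp (fun x => nm (v x) `^ p) -> ii 0 tp (fun x => nm (u x - v x) `^ p).
Proof.
move=> p1 mu_ mv hu hv; have p0 : 0 <= p by rewrite ltW// (lt_trans _ p1).
apply: (ii_le _ (iiZ (2 `^ p) (iiD hu hv))).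
  by apply: meas_powR; apply: cmeas_nm; exact: cmeasB.
move=> x _; rewrite ger0_norm ?powR_ge0//.
apply: le_trans (powR_add_le p0 (nm_ge0 _) (nm_ge0 _)).
by rewrite ge0_ler_powR ?nnegrE ?addr_ge0 ?nm_ge0 ?nmB.
Qed.

Lemma ic_of_pow p u : 1 < p -> cmeas u -> ii 0 tp (fun x => nm (u x) `^ p) -> ic 0 tp u.
Proof.
move=> p1 [m1 m2] hu.
have hi := iiD (ii_cst 0 tp 1) (iiZ ((1 `^ (p - 1))^-1) hu).
split; apply: ii_le hi _ => // x _.
- by apply: le_trans (Re_le_nm _) _; exact: le_powR_split (nm_ge0 _).
- by apply: le_trans (Im_le_nm _) _; exact: le_powR_split (nm_ge0 _).
Qed.

(* [r k] is one minus a product of the gaps, hence exceeds all earlier [rho]'s at once. *)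
Lemma radii_seq (rho : nat -> R) : (forall k, 0 <= rho k < 1) -> exists2 r : nat -> R,
  (forall k, [/\ 0 < r k < 1, rho k < r k & rho k < r k.+1]) &
  (forall k, 1 - 2^-1 ^+ k <= r k).
Proof.
move=> h; pose d k := (1 - rho k) / 2.
have hd k : 0 < d k <= 1 / 2 by have /andP[h1 h2] := h k; rewrite /d; apply/andP; split; lra.
pose P := fix P n := if n is m.+1 then P m * d n else d 0%N.
have hP k : 0 < P k <= 2^-1 ^+ k.
  elim: k => [|k /andP[h1 h2]] /=.
    by rewrite expr0; have /andP[-> h1] := hd 0%N; apply: le_trans h1 _; lra.
  have /andP[d0 d1] := hd k.+1; rewrite mulr_gt0//= exprS mulrC.
  by apply: ler_pM => //; [exact: ltW|exact: ltW|rewrite -div1r].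
have Pd k : P k <= d k.
  case: k => [|k] //=; have /andP[h1 h2] := hP k; have /andP[d0 _] := hd k.+1.
  by rewrite ler_piMl ?(ltW d0)// (le_trans h2)//; apply: exprn_ile1; lra.
have PS k : P k.+1 <= P k.
  have /andP[h1 _] := hP k; have /andP[_ h2] := hd k.+1.
  by rewrite /= ler_piMr ?(ltW h1)// (le_trans h2)//; lra.
have dr k : d k < 1 - rho k by have /andP[_ h2] := h k; rewrite /d; lra.
exists (fun k => 1 - P k) => k; last by have /andP[_ h2] := hP k; lra.
have /andP[h1 h2] := hP k; have h3 := Pd k; have h4 := PS k; have h5 := dr k.
have /andP[d0 d1] := hd k.
by split; [apply/andP; split|..]; lra.
Qed.

Lemma cvg_nm (a : nat -> C) z : (fun k => complex.Re (a k)) @ \oo --> complex.Re z ->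
  (fun k => complex.Im (a k)) @ \oo --> complex.Im z ->
  forall w, (fun k => nm (w - a k)) @ \oo --> nm (w - z).
Proof.
move=> h1 h2 w; apply/cvgrPdist_le => e e0.
have e2 : 0 < e / 2 by rewrite divr_gt0.
near=> k; apply: le_trans (nm_dist _ _) _.
have -> : w - z - (w - a k) = a k - z by ring.
apply: le_trans (nm_leD _) _; rewrite ReD ReN ImD ImN distrC.
rewrite [`|complex.Im _ - _|]distrC [leRHS](splitr e); apply: lerD.
  by near: k; move/cvgrPdist_le : h1; exact.
by near: k; move/cvgrPdist_le : h2; exact.
Unshelve. all: by end_near. Qed.

Lemma powR_lip p (B x y : R) : 1 < p -> 0 <= x <= B -> 0 <= y <= B ->
  `|x `^ p - y `^ p| <= p * B `^ (p - 1) * `|x - y|.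
Proof.
move=> p1; wlog xy : x y / y <= x.
  move=> W hx hy; have [xy|/ltW xy] := leP y x; first exact: W.
  by rewrite distrC [`|x - y|]distrC; exact: W.
move=> /andP[x0 xB] /andP[y0 yB]; have p0 : 0 < p by rewrite (lt_trans _ p1).
rewrite !ger0_norm ?subr_ge0//; last by rewrite ge0_ler_powR ?nnegrE ?(ltW p0).
have h := powR_tangent p1 y0 x0.
apply: (@le_trans _ _ (p * x `^ (p - 1) * (x - y))).
  by move: h; rewrite -[y - x]opprB mulrN; move: (_ * (x - y)) => v; lra.
apply: ler_wpM2r; first by rewrite subr_ge0.
apply: ler_wpM2l; first exact: ltW.
by rewrite ge0_ler_powR ?nnegrE ?(le_trans x0 xB) ?subr_ge0 ?(ltW p1).
Qed.

Lemma cvg_powR p (b : R^nat) l : 1 < p -> (forall k, 0 <= b k) -> b @ \oo --> l ->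
  (fun k => b k `^ p) @ \oo --> l `^ p.
Proof.
move=> p1 b0 bl; have p0 : 0 < p by rewrite (lt_trans _ p1).
have l0 : 0 <= l.
  by rewrite -(cvg_lim _ bl)//; apply: limr_ge; [apply/cvg_ex; exists l|exact: nearW].
have L0 : 0 < p * (l + 1) `^ (p - 1) by rewrite mulr_gt0// powR_gt0// ltr_wpDl.
apply/cvgrPdist_le => e e0.
have e1 : 0 < Num.min 1 (e / (p * (l + 1) `^ (p - 1))) by rewrite lt_min ltr01 divr_gt0.
near=> k.
have : `|l - b k| <= Num.min 1 (e / (p * (l + 1) `^ (p - 1))).
  by near: k; move/cvgrPdist_le : bl; exact.
rewrite le_min => /andP[h1 h2].
have bB : b k <= l + 1 by move: h1; rewrite ler_distl; lra.
apply: le_trans (powR_lip (B := l + 1) p1 _ _) _.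
- by rewrite l0 lerDl ler01.
- by rewrite b0.
by move: h2; rewrite ler_pdivlMr// mulrC.
Unshelve. all: by end_near. Qed.

(** The measurable substitute for [bv]: a limit of the dilates in L^p, with no pointwise statement.
    [boundary_rad] adds the radial limits. *)
Definition has_boundary p F u := [/\ cmeas u, ii 0 tp (fun x => nm (u x) `^ p) &
  forall e, 0 < e -> exists2 rho, 0 <= rho < 1 & forall r, rho < r < 1 ->
    Ir 0 tp (fun x => nm (F (cir r x) - u x) `^ p) <= e].

(** The Riesz-Fischer argument: along fast radii the increments are summable in L^1, hence almost
    everywhere, which gives [u]. Fatou carries over to [u] both the norm bound and the Cauchy
    estimate, the latter for all radii close to 1. *)
Theorem boundary_exists p F M : 1 < p -> dholo F ->
  (forall r, 0 < r < 1 -> Np p F r <= M) -> exists u, has_boundary p F u.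
Proof.
move=> p1 hF hM; have p0 : 0 < p by rewrite (lt_trans _ p1).
have mD : measurable (D : set (measurableTypeR R)) by exact: measurable_itv.
pose c k : R := 2^-1 ^+ k; have c0 k : 0 < c k by rewrite exprn_gt0.
(* The threshold is c_k^p, so that [le_powR_split] bounds the k-th increment in L^1 by (2 pi + 1)
   c_k. *)
have /choice[rho hrho] : forall k, exists rho, 0 <= rho < 1 /\ forall r s, rho < r < 1 -> rho < s < 1 ->
   Ir 0 tp (fun th => nm (F (cir r th) - F (cir s th)) `^ p) <= c k * c k `^ (p - 1).
  move=> k; have e0 : 0 < c k * c k `^ (p - 1) by rewrite mulr_gt0// powR_gt0.
  by have [rho h1 h2] := Lp_cauchy p1 hF hM e0; exists rho.
have [r hr rl] := radii_seq (fun k => (hrho k).1).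
have r01 k : 0 < r k < 1 by case: (hr k).
have bF k := cbm_dil hF (r01 k).
pose g k th := nm (F (cir (r k.+1) th) - F (cir (r k) th)).
have gb k := cbmB (bF k.+1) (bF k).
have gi k : ii 0 tp (g k) := ii_nm (cbm_ic (gb k)).
have gp k := cbm_pow (ltW p0) (gb k).
have gI k : Ir 0 tp (g k) <= (tp + 1) * c k.
  have cp0 : 0 < c k `^ (p - 1) by exact: powR_gt0.
  apply: (@le_trans _ _ (Ir 0 tp (fun x => c k + (c k `^ (p - 1))^-1 * g k x `^ p))).
    apply: Ir_le; [exact: gi|exact: iiD (ii_cst _ _ _) (iiZ _ (gp k))|].
    by move=> x _; exact: le_powR_split (nm_ge0 _).
  rewrite (IrD (ii_cst 0 tp (c k)) (iiZ _ (gp k))) (IrZ _ (gp k)) (Ir_cst _ tp_ge0) subr0.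
  rewrite [leRHS]mulrDl mul1r mulrC lerD2l mulrC ler_pdivrMr//.
  have [h1 h2 h3] := hr k; apply: (hrho k).2; last by rewrite h2; have /andP[] := h1.
  by rewrite h3; have /andP[] := r01 k.+1.
have gS n : \sum_(k < n) Ir 0 tp (g k) <= (tp + 1) * 2.
  apply: (@le_trans _ _ (\sum_(k < n) (tp + 1) * c k)); first by apply: ler_sum => k _; exact: gI.
  rewrite -mulr_sumr; apply: ler_wpM2l; first by rewrite addr_ge0 ?tp_ge0.
  have -> : \sum_(k < n) c k = 2 * (1 - c n).
    elim: n => [|n IH]; first by rewrite big_ord0 /c expr0 subrr mulr0.
    by rewrite big_ord_recr /= IH /c exprS; field.
  by have := c0 n; lra.
have [N [mN N0 hN]] := ae_bounded_series gi (fun k x _ => nm_ge0 _) gS.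
have hN' x : 0 <= x <= tp -> ~ N x -> exists b, forall n, \sum_(k < n) g k x <= b.
  by move=> hx Nx; apply/not_notP => h; apply: Nx; apply: hN => /= /(_ hx).
(* Killing the exceptional null set makes the sequence converge at every angle, so that its limit is
   measurable. *)
pose I x : R := \1_(~` N) x.
have I1 x : ~ N x -> I x = 1 by move=> Nx; rewrite /I indicE mem_set.
have I0 x : N x -> I x = 0 by move=> Nx; rewrite /I indicE memNset//=; apply.
pose a k x : C := (I x)%:C * F (cir (r k) x).
have Rea k x : complex.Re (a k x) = I x * complex.Re (F (cir (r k) x)) by rewrite /a ReM /= mul0r subr0.
have Ima k x : complex.Im (a k x) = I x * complex.Im (F (cir (r k) x)) by rewrite /a ImM /= mul0r addr0.
have ca x : 0 <= x <= tp -> cvgn (fun k => complex.Re (a k x)) /\ cvgn (fun k => complex.Im (a k x)).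
  move=> hx; have [Nx|Nx] := pselect (N x).
    split; apply/cvg_ex; exists 0.
      rewrite (_ : (fun k => _) = fun=> 0); first exact: cvg_cst.
      by apply/funext => k; rewrite Rea I0// mul0r.
    rewrite (_ : (fun k => _) = fun=> 0); first exact: cvg_cst.
    by apply/funext => k; rewrite Ima I0// mul0r.
  have [b hb] := hN' x hx Nx; split; apply: (@cvg_of_bounded_var _ _ b) => n; apply: le_trans (hb n).
    apply: ler_sum => k _; rewrite !Rea I1// !mul1r -ReN -ReD; exact: Re_le_nm.
  apply: ler_sum => k _; rewrite !Ima I1// !mul1r -ImN -ImD; exact: Im_le_nm.
pose u x : C := limn (fun k => complex.Re (a k x)) +i* limn (fun k => complex.Im (a k x)).
have mI : measurable_fun D I.
  by apply: measurable_funTS; apply: measurable_indic; exact: measurableC.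
have mu_ : cmeas u.
  split.
    apply: (@measurable_fun_cvg _ _ _ D (fun k x => complex.Re (a k x))) => [k|x].
      rewrite (_ : (fun x => _) = (fun x => I x * complex.Re (F (cir (r k) x)))); last exact/funext.
      by apply: measurable_funM => //; have [] := bF k.
    by rewrite /= in_itv /= => /ca[].
  apply: (@measurable_fun_cvg _ _ _ D (fun k x => complex.Im (a k x))) => [k|x].
    rewrite (_ : (fun x => _) = (fun x => I x * complex.Im (F (cir (r k) x)))); last exact/funext.
    by apply: measurable_funM => //; have [] := bF k.
  by rewrite /= in_itv /= => /ca[].
have pc w (f : nat -> nat) x : 0 <= x <= tp -> f @ \oo --> \oo ->
    (fun k => nm (w - a (f k) x) `^ p) @ \oo --> nm (w - u x) `^ p.
  move=> hx hf; have [h1 h2] := ca x hx.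
  apply: cvg_powR p1 _ _; first by move=> k; exact: nm_ge0.
  apply: (@cvg_comp _ _ _ f (fun k => nm (w - a k x)) _ _ _ hf).
  exact: (@cvg_nm (fun k => a k x) (u x) h1 h2 w).
have cI : cbm (fun x => (I x)%:C).
  apply: (@cbm_real _ I 1) => // x _; have [Nx|Nx] := pselect (N x).
    by rewrite I0// normr0.
  by rewrite I1// normr1.
have ba k : cbm (a k) := cbmM cI (bF k).
have nI z x : nm ((I x)%:C * z) <= nm z.
  have [Nx|Nx] := pselect (N x); first by rewrite I0// mul0r nm0 nm_ge0.
  by rewrite I1// mul1r.
have up : ii 0 tp (fun x => nm (u x) `^ p).
  have := @fatou_Ir R (fun k x => nm (0 - a k x) `^ p) (fun x => nm (0 - u x) `^ p) M.
  case.
  - by move=> k; apply: cbm_pow (ltW p0) (cbmB (cbm_cst 0) (ba k)).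
  - by move=> k x _; exact: powR_ge0.
  - move=> k; apply: le_trans (hM _ (r01 k)).
    apply: Ir_le; [exact: cbm_pow (ltW p0) (cbmB (cbm_cst 0) (ba k))|exact: cbm_pow (ltW p0) (bF k)|].
    by move=> x _; rewrite sub0r nmN ge0_ler_powR ?nnegrE ?nm_ge0 ?(ltW p0)//; exact: nI.
  - by move=> x hx; exact: (pc 0 id x hx cvg_id).
  by move=> h _; apply: eq_ii h => x _; rewrite sub0r nmN.
exists u; split => // e e0.
have [rh hrh h] := Lp_cauchy p1 hF hM e0.
exists rh => // s hs; have /andP[rh0 rh1] := hrh.
have hs' : 0 < s < 1 by have /andP[h' ->] := hs; rewrite (le_lt_trans rh0 h').
have bs := cbm_dil hF hs'.
have d0 : 0 < 1 - rh by rewrite subr_gt0.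
(* Shifting the sequence by [K] brings all its radii above [rh], thanks to r_k >= 1 - 2^(-k). *)
have [K hK] := @geo_small R 1 2^-1 (1 - rh) ltac:(apply/andP; split; lra) d0.
have rK k : rh < r (k + K)%N < 1.
  have /andP[_ ->] := r01 (k + K)%N; rewrite andbT.
  by have := hK (k + K)%N (leq_addl _ _); have := rl (k + K)%N; rewrite mul1r; lra.
have := @fatou_Ir R (fun k x => nm ((I x)%:C * F (cir s x) - a (k + K)%N x) `^ p)
   (fun x => nm ((I x)%:C * F (cir s x) - u x) `^ p) e.
case.
- by move=> k; exact: cbm_pow (ltW p0) (cbmB (cbmM cI bs) (ba (k + K)%N)).
- by move=> k x _; exact: powR_ge0.
- move=> k; apply: le_trans (h s (r (k + K)%N) hs (rK k)).
  apply: Ir_le; [exact: cbm_pow (ltW p0) (cbmB (cbmM cI bs) (ba _))|exact: cbm_pow (ltW p0) (cbmB bs (bF _))|].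
  move=> x _; rewrite ge0_ler_powR ?nnegrE ?nm_ge0 ?(ltW p0)//.
  by rewrite /a -mulrBr; exact: nI.
- by move=> x hx; exact: (pc _ (fun k => (k + K)%N) x hx (cvg_addnr _)).
move=> j1 j2.
(* The indicator is removed again: it equals 1 off the null set [N]. *)
apply: le_trans j2; rewrite le_eqVlt; apply/orP; left; apply/eqP.
rewrite /Ir /Rintegral; congr fine; apply: integral_ae_any => //.
  by apply/measurable_EFinP; exact: ii_meas.
exists N; split => // x /= /not_implyP[_ hx]; apply/not_notP => Nx; apply: hx.
by rewrite I1// mul1r.
Qed.

End BoundaryFunction.

(** * Radial limits almost everywhere *)

Section RadialLimits.
Context {R : realType}.
Local Notation C := R[i].
Local Notation tp := (2 * pi : R).
Local Notation mu := (@lebesgue_measure R).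
Local Notation D := (`[(0 : R), tp]%classic).
Implicit Types (r s t x y th p q : R) (u v : R -> C) (z w : C) (F : C -> C).

Lemma radius_above (r1 r2 : R) : 0 <= r1 < 1 -> 0 <= r2 < 1 ->
  exists r, [/\ r1 < r, r2 < r & 0 < r < 1].
Proof.
move=> /andP[a0 a1] /andP[b0 b1]; exists ((Num.max r1 r2 + 1) / 2).
have m1 : r1 <= Num.max r1 r2 by rewrite le_max lexx.
have m2 : r2 <= Num.max r1 r2 by rewrite le_max lexx orbT.
have m3 : Num.max r1 r2 < 1 by rewrite gt_max a1.
by split; [lra|lra|apply/andP; split; lra].
Qed.

Lemma ic_pker t u th : 0 <= t < 1 -> ic 0 tp u -> ic 0 tp (fun s => (pker t (th - s))%:C * u s).
Proof.
move=> t01 hu; apply: ic_mulcont => // x _.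
by apply: (@ccont_real _ (fun s => pker t (th - s))); exact: pker_shift_cont.
Qed.

Lemma cpintB t u v th : 0 <= t < 1 -> ic 0 tp u -> ic 0 tp v ->
  cpint t u th - cpint t v th = cpint t (fun s => u s - v s) th.
Proof.
move=> t01 hu hv; rewrite /cpint -mulrBr -(IcB (ic_pker _ t01 hu) (ic_pker _ t01 hv)).
by congr (_ * _); apply: eq_Ic => x _; rewrite mulrBr.
Qed.

Lemma cpint_nm t u th : 0 <= t < 1 -> ic 0 tp u ->
  nm (cpint t u th) <= (1 + t) / (1 - t) / tp * Ir 0 tp (fun x => nm (u x)).
Proof.
move=> t01 hu; rewrite /cpint tpV nmM nmR ger0_norm ?invr_ge0 ?tp_ge0//.
rewrite [leRHS]mulrAC [leRHS]mulrC; apply: ler_wpM2l; first by rewrite invr_ge0 tp_ge0.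
apply: le_trans (Ic_nm (ic_pker th t01 hu)) _.
rewrite -(IrZ _ (ii_nm hu)); apply: Ir_le; [exact: ii_nm (ic_pker _ t01 hu)|exact: iiZ (ii_nm hu)|].
move=> x _; rewrite nmM nmR (ger0_norm (pker_ge0 _ t01)).
apply: ler_wpM2r; first exact: nm_ge0.
exact: pker_le.
Qed.

(** F_(tr) is the Poisson integral of F_r. As r tends to 1 the left side converges uniformly, and
    for fixed t the kernel is bounded, so L^1 closeness of F_r to [u] suffices on the right. *)
Lemma boundary_poisson p F u t th : 1 < p -> dholo F -> has_boundary p F u -> 0 < t < 1 ->
  0 <= th <= tp -> F (cir t th) = cpint t u th.
Proof.
move=> p1 hF [hm hu hb] ht hth; have /andP[t0 t1] := ht.
have ht' : 0 <= t < 1 by rewrite (ltW t0).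
have iu := ic_of_pow p1 hm hu.
pose K := (1 + t) / (1 - t) / tp; have K0 : 0 <= K.
  apply: divr_ge0; last exact: tp_ge0.
  by apply: divr_ge0; [rewrite addr_ge0// ltW|rewrite subr_ge0 ltW].
apply/eqP; rewrite -subr_eq0 -nm_eq0 eq_le nm_ge0 andbT.
apply: (@le0_eps _ _ (1 + K * (tp + 1))) => e e0.
have ep : 0 < e `^ (p - 1) by exact: powR_gt0.
have [r1 hr1 h1] := dil_uniform hF ht e0.
have [r2 hr2 h2] := hb (e * e `^ (p - 1)) ltac:(exact: mulr_gt0).
have [r [rr1 rr2 hr]] := radius_above hr1 hr2.
have rl : r < 1 by have /andP[] := hr.
have bF := cbm_dil hF hr.
apply: le_trans (nm_tri _ (F (cir (t * r) th)) _) _.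
rewrite mulrDl mul1r; apply: lerD.
  by rewrite nm_distC; apply: h1 => //; rewrite rr1.
rewrite -(cpint_dil hF ht hr hth) (cpintB _ ht' (cbm_ic bF) iu).
have ib := icB (cbm_ic bF) iu.
apply: le_trans (cpint_nm th ht' ib) _; rewrite -/K -mulrA; apply: ler_wpM2l => //.
have ip := ii_powD p1 (cbm_cmeas bF) hm (cbm_pow (ltW (lt_trans ltr01 p1)) bF) hu.
apply: (@le_trans _ _ (Ir 0 tp (fun x => e + (e `^ (p - 1))^-1 * nm (F (cir r x) - u x) `^ p))).
  apply: Ir_le; [exact: ii_nm ib|exact: iiD (ii_cst _ _ _) (iiZ _ ip)|].
  by move=> x _; exact: le_powR_split (nm_ge0 _).
rewrite (IrD (ii_cst 0 tp e) (iiZ _ ip)) (IrZ _ ip) (Ir_cst _ tp_ge0) subr0.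
rewrite [leRHS]mulrDl mul1r [leRHS]addrC [leLHS]addrC [e * tp]mulrC lerD2r mulrC ler_pdivrMr//.
by apply: h2; rewrite rr2.
Qed.

Definition rlim F th z := forall e, 0 < e -> exists2 rho, rho < 1 &
  forall r, rho < r < 1 -> nm (F (cir r th) - z) <= e.

(** The endpoints are left out: they represent the boundary point 1, where [chol_phi] gives nothing.
    They form a null set, see [ae_interior]. *)
Definition rad F u := {ae mu, forall th, 0 < th < tp -> rlim F th (u th)}.

Theorem boundary_rad p F u : 1 < p -> dholo F -> has_boundary p F u -> rad F u.
Proof.
move=> p1 hF hb; have [hm hu _] := hb; have iu := ic_of_pow p1 hm hu.
have [i1 i2] := iu.
apply: (ae_imp _ (ae_and (ae_poisson i1) (ae_poisson i2))) => th [w1 w2] hth e e0.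
have [t0 t01 h] := cpoisson_lebesgue iu hth (w1 hth) (w2 hth) e0.
exists (Num.max 0 t0); first by rewrite gt_max ltr01.
move=> r /andP[]; rewrite gt_max => /andP[r0 rt] r1.
have hth' : 0 <= th <= tp by have /andP[/ltW -> /ltW ->] := hth.
by rewrite (boundary_poisson p1 hF hb)// ?r0//; apply: h; rewrite ?rt// ltW.
Qed.

Lemma rlim_lim F th z : rlim F th z ->
  lim ((fun r : R => F (r%:C * expi th) : (R[i])^o) @ 1^'-) = z.
Proof.
move=> h; apply: cvg_lim; first exact: norm_hausdorff.
apply/cvgrPdist_le => e e0.
have [er ei] : 0 < complex.Re e /\ complex.Im e = 0.
  by move: e0; rewrite ltcE /= => /andP[/eqP <- ->].
have [rho rho1 hr] := h _ er.
near=> r; rewrite distrC.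
have -> : e = (complex.Re e)%:C by apply: complex_eqP.
have hn : nm (F (cir r th) - z) <= complex.Re e.
  by apply: hr; apply/andP; split; near: r; [exact: nbhs_left_gt|exact: nbhs_left_lt].
by rewrite lecE /= eqxx.
Unshelve. all: by end_near. Qed.

End RadialLimits.

(** * Weighted Hardy spaces *)

Section Weight.
Context {R : realType}.
Local Notation C := R[i].
Local Notation tp := (2 * pi : R).
Local Notation mu := (@lebesgue_measure R).
Local Notation D := (`[(0 : R), tp]%classic).
Implicit Types (a r s t x y th p q : R) (u v : R -> C) (z w : C) (f F : C -> C).

Lemma holo_atP f z : @holo_at R f z <-> chol f z.
Proof.
split.
  move=> /cvg_ex[/= l hl]; exists l => e e0.
  have eC : 0 < (e%:C : C) by rewrite ltcR.
  move/cvgrPdist_le : hl => /(_ _ eC) [/= d d0 hd].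
  have [dr di] : 0 < complex.Re d /\ complex.Im d = 0.
    by move: d0; rewrite ltcE /= => /andP[/eqP <- ->].
  exists (complex.Re d) => // w wz.
  have [->|wn] := eqVneq w z; first by rewrite !subrr mulr0 subrr nm0 mulr0.
  have h0 : w - z != 0 by rewrite subr_eq0.
  have := hd (w - z); rewrite /ball_ /= sub0r normrN => /(_ _ h0).
  have h1 : `|w - z : (R[i])^o| < d by rewrite ltcE /= di eqxx.
  move=> /(_ h1); rewrite lecE /= => /andP[_ h2].
  have h3 : nm (l - (f w - f z) / (w - z)) <= e.
    by move: h2; rewrite [z + _]addrC subrK.
  rewrite -ler_pdivrMr ?nm_gt0// -nmV -nmM mulrBl mulfK// nm_distC; exact: h3.
move=> [l hl]; apply/cvg_ex; exists l; apply/cvgrPdist_le => e e0.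
have [er ei] : 0 < complex.Re e /\ complex.Im e = 0.
  by move: e0; rewrite ltcE /= => /andP[/eqP <- ->].
have [d d0 hd] := hl _ er.
have dC : 0 < (d%:C : C) by rewrite ltcR.
exists (d%:C : C) => //= h; rewrite /ball_ /= sub0r normrN => hh h0.
have hn : nm h < d by move: hh; rewrite ltcE /= => /andP[].
have := hd (z + h); rewrite [z + h - z]addrAC subrr add0r => /(_ hn).
rewrite -ler_pdivrMr ?nm_gt0// -nmV -nmM mulrBl mulfK// nm_distC => hle.
by rewrite lecE /= ei eqxx.
Qed.

(* Multiplication by [phi a] removes the weight, as [|phi a z| = |z - 1| ^ a] (lemma [nm_phi]). *)
Definition phi a z : C := cpow a (1 - z).

(** Valid at every [z], even outside the disc, because [cpow] is an exponential and never vanishes.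
    Multiplication by [phi (- a)] is thus inverted as an identity of functions. *)
Lemma phiNK a z : phi (- a) z * phi a z = 1.
Proof. by rewrite /phi cpowN mulVf// cpow_neq0. Qed.

Lemma chol_phi a z : 0 < complex.Re (1 - z) -> chol (phi a) z.
Proof.
move=> h; apply: (@chol_comp _ (fun z => 1 - z) (cpow a)); last exact: chol_cpow.
apply: (@cholD _ (fun=> 1) (fun w => - w)); first exact: chol_cst.
have -> : (fun w : C => - w) = (fun w => -1 * w) by apply/funext => w; rewrite mulN1r.
by apply: cholM; [exact: chol_cst|exact: chol_id].
Qed.

Lemma Re_disc z : nm z < 1 -> 0 < complex.Re (1 - z).
Proof.
move=> h; rewrite ReD ReN /= subr_gt0; apply: le_lt_trans h.
exact: le_trans (ler_norm _) (Re_le_nm z).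
Qed.

Lemma Re_circle th : 0 < th < tp -> 0 < complex.Re (1 - expi th : C).
Proof.
move=> /andP[t0 t1]; rewrite ReD ReN /= subr_gt0.
have h : 0 < sin (th / 2) by apply: sin_gt0_pi; apply/andP; split; lra.
have -> : cos th = cos ((th / 2) *+ 2) by rewrite mulr2n -splitr.
have s2 : 0 < sin (th / 2) ^+ 2 by rewrite exprn_gt0.
rewrite cos_mulr2n mulr2n; move: (cos2Dsin2 (th / 2)) s2.
by move: (cos _ ^+ 2) (sin _ ^+ 2) => x y; clear; lra.
Qed.

Lemma dholo_phi a : dholo (phi a). Proof. by move=> z /Re_disc; exact: chol_phi. Qed.

Lemma dholoM F f : dholo F -> dholo f -> dholo (fun z => F z * f z).
Proof. by move=> h1 h2 z z1; apply: cholM; [exact: h1|exact: h2]. Qed.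

Lemma nm_phi a z : z != 1 -> nm (phi a z) = wgt a z.
Proof.
by move=> z1; rewrite /phi nm_cpow ?subr_eq0 1?eq_sym// /wgt nm_distC.
Qed.

Lemma weightE a p f z : 0 <= p -> z != 1 ->
  cabs (f z) `^ p * wgt (a * p) z = nm (phi a z * f z) `^ p.
Proof.
move=> p0 z1; rewrite nmM (nm_phi a z1) /wgt powRM ?powR_ge0 ?nm_ge0// -powRrM mulrC.
by [].
Qed.

End Weight.

(** * Norm and pairing through unweighted boundary functions *)

Section HardyBoundary.
Context {R : realType}.
Local Notation C := R[i].
Local Notation tp := (2 * pi : R).
Local Notation mu := (@lebesgue_measure R).
Local Notation D := (`[(0 : R), tp]%classic).
Implicit Types (a r s t x y th p q : R) (u v : R -> C) (z w : C) (f F G : C -> C).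

Lemma Tint_circle a p f r : 0 < p -> dholo f -> 0 <= r < 1 ->
  Tint (fun t => cabs (f (r%:C * expi t)) `^ p * wgt (a * p) (r%:C * expi t)) =
  (Np p (fun z => phi a z * f z) r)%:E.
Proof.
move=> p0 hf hr.
have hF : dholo (fun z => phi a z * f z) by apply: dholoM => //; exact: dholo_phi.
have hi := cbm_pow (ltW p0) (dholo_cbm hF hr).
rewrite /Np -(EFin_Ir hi); apply: eq_integral => x _; congr (_%:E).
by apply: weightE; [exact: ltW|exact: cir_neq1].
Qed.

Lemma Hp_dholo a p f : 0 < p -> Hp p (a * p) f ->
  dholo (fun z => phi a z * f z) /\ exists M, forall r, 0 < r < 1 -> Np p (fun z => phi a z * f z) r <= M.
Proof.
move=> p0 [hf [M hM]].
have df : dholo f by move=> z z1; apply/holo_atP; exact: hf.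
split; first by apply: dholoM => //; exact: dholo_phi.
exists M => r /andP[r0 r1]; have hr : 0 <= r < 1 by rewrite ltW.
by rewrite -lee_fin -(Tint_circle a p0 df hr); exact: hM.
Qed.

Lemma Hp_phi a p F M : 0 < p -> dholo F -> (forall r, 0 < r < 1 -> Np p F r <= M) ->
  Hp p (a * p) (fun z => phi (- a) z * F z).
Proof.
move=> p0 hF hM.
have hf : dholo (fun z => phi (- a) z * F z) by apply: dholoM => //; exact: dholo_phi.
have FE : (fun z => phi a z * (phi (- a) z * F z)) = F.
  by apply/funext => z; rewrite mulrA [phi a z * _]mulrC phiNK mul1r.
split; first by move=> z z1; apply/holo_atP; exact: hf.
(* [M] covers positive radii, whereas [Hp] also includes r = 0. *)
exists (Num.max M (Np p F 0)) => r hr; rewrite (Tint_circle a p0 hf hr) FE lee_fin le_max.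
have /andP[r0 r1] := hr; move: r0; rewrite le_eqVlt => /predU1P[<-|r0].
  by rewrite lexx orbT.
by rewrite hM ?r0.
Qed.

Lemma Hp_boundary a p f : 1 < p -> Hp p (a * p) f ->
  exists u, has_boundary p (fun z => phi a z * f z) u.
Proof.
move=> p1 hf; have [hF [M hM]] := Hp_dholo (lt_trans ltr01 p1) hf.
exact: boundary_exists p1 hF hM.
Qed.

Lemma rlimD F G th z w : rlim F th z -> rlim G th w -> rlim (fun z => F z + G z) th (z + w).
Proof.
move=> h1 h2 e e0; have e2 : 0 < e / 2 by rewrite divr_gt0.
have [r1 r11 k1] := h1 _ e2; have [r2 r21 k2] := h2 _ e2.
exists (Num.max r1 r2); first by rewrite gt_max r11.
move=> r /andP[]; rewrite gt_max => /andP[a1 a2] a3.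
have -> : F (cir r th) + G (cir r th) - (z + w) = (F (cir r th) - z) + (G (cir r th) - w) by ring.
apply: le_trans (nmD _ _) _; rewrite [leRHS]splitr; apply: lerD.
  by apply: k1; rewrite a1.
by apply: k2; rewrite a2.
Qed.

Lemma rlimM F G th z w : rlim F th z -> rlim G th w -> rlim (fun z => F z * G z) th (z * w).
Proof.
move=> h1 h2 e e0.
have S0 : 0 < nm w + 1 + nm z by rewrite ltr_pwDl ?nm_ge0// ltr_wpDl ?nm_ge0.
have e2 : 0 < Num.min 1 (e / (nm w + 1 + nm z)) by rewrite lt_min ltr01 divr_gt0.
have [r1 r11 k1] := h1 _ e2; have [r2 r21 k2] := h2 _ e2.
exists (Num.max r1 r2); first by rewrite gt_max r11.
move=> r /andP[]; rewrite gt_max => /andP[a1 a2] a3.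
have := k1 r ltac:(by rewrite a1); have := k2 r ltac:(by rewrite a2).
rewrite !le_min => /andP[b1 b2] /andP[b3 b4].
have -> : F (cir r th) * G (cir r th) - z * w =
  (F (cir r th) - z) * G (cir r th) + z * (G (cir r th) - w) by ring.
have gw : nm (G (cir r th)) <= nm w + 1.
  have -> : G (cir r th) = w + (G (cir r th) - w) by ring.
  by apply: le_trans (nmD _ _) _; rewrite lerD2l.
apply: le_trans (nmD _ _) _; rewrite !nmM.
apply: (@le_trans _ _ (e / (nm w + 1 + nm z) * (nm w + 1) + nm z * (e / (nm w + 1 + nm z)))).
  by apply: lerD; [apply: ler_pM; rewrite ?nm_ge0|apply: ler_wpM2l; rewrite ?nm_ge0].
by rewrite [nm z * _]mulrC -mulrDr divfK// gt_eqF.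
Qed.

Lemma rlim_cst z th : rlim (fun _ : C => z) th z.
Proof. by move=> e e0; exists 0 => // r _; rewrite subrr nm0 ltW. Qed.

Lemma rlim_chol F th : chol F (expi th) -> rlim F th (F (expi th)).
Proof.
move=> [d /cder_cont h] e e0; have [dl dl0 hd] := h e e0.
exists (Num.max 0 (1 - dl)); first by rewrite gt_max ltr01 ltrBlDr ltrDl.
move=> r /andP[]; rewrite gt_max => /andP[r0 rd] r1; apply/ltW/hd.
have -> : cir r th - expi th = (r - 1)%:C * expi th by rewrite /cir rmorphB /=; ring.
by rewrite nmM nm_expi mulr1 nmR distrC ger0_norm ?subr_ge0 ?ltW// ltrBlDr addrC -ltrBlDr.
Qed.

Lemma radD F G u v : rad F u -> rad G v -> rad (fun z => F z + G z) (fun x => u x + v x).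
Proof.
by move=> h1 h2; apply: (ae_imp _ (ae_and h1 h2)) => th [k1 k2] hth; apply: rlimD; [exact: k1|exact: k2].
Qed.

Lemma radZ z F u : rad F u -> rad (fun w => z * F w) (fun x => z * u x).
Proof.
move=> h; apply: (ae_imp _ h) => th k hth.
by apply: rlimM; [exact: rlim_cst|exact: k].
Qed.

Lemma ae_neq x : {ae mu, forall y : R, y != x}.
Proof.
exists [set x]; split; first exact: measurable_set1.
  exact: lebesgue_measure_set1.
by move=> y /= /negP; rewrite negbK => /eqP.
Qed.

Lemma ae_interior (P : R -> Prop) : {ae mu, forall th, 0 < th < tp -> P th} ->
  {ae mu, forall th, D th -> P th}.
Proof.
move=> h; apply: (ae_imp _ (ae_and h (ae_and (ae_neq 0) (ae_neq tp)))) => th [k [n0 n1]].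
rewrite /= in_itv /= => /andP[t0 t1]; apply: k.
by rewrite !lt_neqAle t0 t1 n1 eq_sym n0.
Qed.

(** [phi (- a)] is holomorphic near every boundary point other than 1, so its radial limit there is
    its value and the limit defining [bv f] exists. *)
Lemma rad_bv a f u : rad (fun z => phi a z * f z) u ->
  {ae mu, forall th, D th -> 0 < th < tp /\ bv f th = phi (- a) (expi th) * u th}.
Proof.
move=> h; apply: ae_interior; apply: (ae_imp _ h) => th k hth; split => //.
apply: (@rlim_lim R f).
have -> : f = (fun z => phi (- a) z * (phi a z * f z)).
  by apply/funext => z; rewrite mulrA phiNK mul1r.
apply: rlimM; last exact: k.
by apply: rlim_chol; apply: chol_phi; exact: Re_circle.
Qed.

Lemma expi_neq1 th : 0 < th < tp -> expi th != 1 :> C.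
Proof.
by move=> /Re_circle h; apply/eqP => e; move: h; rewrite e subrr ltxx.
Qed.

Lemma Hnorm_rad a p f u : 0 < p -> cmeas u -> ii 0 tp (fun x => nm (u x) `^ p) ->
  rad (fun z => phi a z * f z) u ->
  Hnorm p (a * p) f = Ir 0 tp (fun x => nm (u x) `^ p) `^ p^-1.
Proof.
move=> p0 hm hu h; rewrite /Hnorm; congr (_ `^ _).
rewrite /Ir /Rintegral; congr fine.
apply: integral_ae_any; first exact: measurable_itv.
  by apply/measurable_EFinP; exact: ii_meas.
apply: (ae_imp _ (rad_bv h)) => th k hth; have [h1 h2] := k hth; congr (_%:E).
rewrite (weightE a (fun=> bv f th) (ltW p0) (expi_neq1 h1)) h2; congr (nm _ `^ _).
by rewrite mulrA [phi a _ * _]mulrC phiNK mul1r.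
Qed.

(** The weight |1 - z|^(2a) equals phi times its conjugate and cancels the two factors [phi (- a)]
    coming from [rad_bv]. *)
Lemma pairing_rad a f h u v : rad (fun z => phi a z * f z) u -> rad (fun z => phi a z * h z) v ->
  ic 0 tp (fun x => u x * conjc (v x)) ->
  pairing a f h = Ic 0 tp (fun x => u x * conjc (v x)).
Proof.
move=> hu hv [i1 i2].
have k : {ae mu, forall th, D th ->
    bv f th * conjc (bv h th) * (wgt (2 * a) (expi th))%:C = u th * conjc (v th)}.
  apply: (ae_imp _ (ae_and (rad_bv hu) (rad_bv hv))) => th [k1 k2] hth.
  have [h1 ->] := k1 hth; have [_ ->] := k2 hth.
  have -> : (wgt (2 * a) (expi th))%:C = phi a (expi th) * conjc (phi a (expi th)).
    rewrite mul_conj (nm_phi a (expi_neq1 h1)) /wgt; congr (_%:C).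
    by rewrite -powR_mulrn ?powR_ge0// -powRrM mulrC.
  rewrite conjM.
  have := phiNK a (expi th); move: (phi _ _) (phi _ _) => c b bc.
  have cc : conjc b * conjc c = 1 by rewrite -conjM bc; apply: complex_eqP; rewrite //= oppr0.
  have -> : b * u th * (conjc b * conjc (v th)) * (c * conjc c) =
    (b * c) * (conjc b * conjc c) * (u th * conjc (v th)) by ring.
  by rewrite bc cc !mul1r.
have e1 : Rintegral mu D (fun t => complex.Re (bv f t * conjc (bv h t) * (wgt (2 * a) (expi t))%:C)) =
   Ir 0 tp (fun x => complex.Re (u x * conjc (v x))).
  rewrite /Ir /Rintegral; congr fine; apply: integral_ae_any; first exact: measurable_itv.
    by apply/measurable_EFinP; exact: ii_meas.
  by apply: (ae_imp _ k) => th kk /kk ->.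
have e2 : Rintegral mu D (fun t => complex.Im (bv f t * conjc (bv h t) * (wgt (2 * a) (expi t))%:C)) =
   Ir 0 tp (fun x => complex.Im (u x * conjc (v x))).
  rewrite /Ir /Rintegral; congr fine; apply: integral_ae_any; first exact: measurable_itv.
    by apply/measurable_EFinP; exact: ii_meas.
  by apply: (ae_imp _ k) => th kk /kk ->.
rewrite /pairing /cint e1 e2 /Ic; apply: complex_eqP; rewrite ?ReD ?ImD ?ReM ?ImM /=; ring.
Qed.

End HardyBoundary.

(** * Every element of the dual exponent's space gives a bounded functional *)

Section PairingBounded.
Context {R : realType}.
Local Notation C := R[i].
Local Notation tp := (2 * pi : R).
Local Notation D := (`[(0 : R), tp]%classic).
Implicit Types (a b r s t x y th p q : R) (u v : R -> C) (z w : C) (f g h F G : C -> C).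

Lemma conjugate_gt1 p q : 1 < p -> p^-1 + q^-1 = 1 -> 1 < q.
Proof.
move=> p1 pq; have p0 : 0 < p by exact: lt_trans p1.
have pi1 : p^-1 < 1 by rewrite invf_lt1.
have pi0 : 0 < p^-1 by rewrite invr_gt0.
have q1 : 0 < q^-1 < 1 by apply/andP; split; lra.
by have /andP[q0 ql] := q1; rewrite -invf_lt1// -invr_gt0.
Qed.

Lemma cmeasM_conj u v : cmeas u -> cmeas v -> cmeas (fun x => u x * conjc (v x)).
Proof.
move=> [h1 h2] [h3 h4]; split.
- rewrite (_ : (fun x => _) = (fun x => complex.Re (u x) * complex.Re (v x) +
      complex.Im (u x) * complex.Im (v x))).
    by apply: measurable_funD; exact: measurable_funM.
  by apply/funext => x; rewrite ReM Re_conj Im_conj; ring.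
- rewrite (_ : (fun x => _) = (fun x => complex.Im (u x) * complex.Re (v x) -
      complex.Re (u x) * complex.Im (v x))).
    by apply: measurable_funB; exact: measurable_funM.
  by apply/funext => x; rewrite ImM Re_conj Im_conj; ring.
Qed.

Lemma ic_prod p q u v : 0 < p -> 0 < q -> p^-1 + q^-1 = 1 -> cmeas u -> cmeas v ->
  ii 0 tp (fun x => nm (u x) `^ p) -> ii 0 tp (fun x => nm (v x) `^ q) ->
  ic 0 tp (fun x => u x * conjc (v x)).
Proof.
move=> p0 q0 pq mu_ mv hu hv; have [m1 m2] := cmeasM_conj mu_ mv.
have hi := iiD (iiZ (1 `^ p / p) hu) (iiZ ((1 `^ q)^-1 / q) hv).
have hb x : nm (u x * conjc (v x)) <=
    1 `^ p / p * nm (u x) `^ p + (1 `^ q)^-1 / q * nm (v x) `^ q.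
  by rewrite nmM nm_conj; apply: young_scaled => //; exact: nm_ge0.
by split; apply: ii_le hi _ => // x _; apply: le_trans (hb x); [exact: Re_le_nm|exact: Im_le_nm].
Qed.

(** L = A^(-1/(pq)) makes both terms multiples of A^(1/p). The dependence on [B] is not homogeneous,
    which is harmless since [B] comes from the fixed factor. When A = 0 a large L gives N <= 0. *)
Lemma young_optimised p q (N A B : R) : 0 < p -> 0 < q -> p^-1 + q^-1 = 1 -> 0 <= A ->
  (forall L, 0 < L -> N <= L `^ p / p * A + (L `^ q)^-1 / q * B) ->
  N <= (p^-1 + q^-1 * B) * A `^ p^-1.
Proof.
move=> p0 q0 pq A0 young.
have [Az|An] := eqVneq A 0.
  rewrite Az powR0 ?invr_eq0 ?gt_eqF// mulr0; apply: (@le0_eps _ _ (q^-1 * B)) => e e0.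
  have := young (e `^ (- q^-1)) (powR_gt0 _ e0).
  rewrite Az mulr0 add0r -powRrM mulNr mulVf ?gt_eqF// powRN powRr1 ?(ltW e0)// invrK.
  by rewrite [q^-1 * B * e]mulrC mulrA.
have Ap : 0 < A by rewrite lt0r An.
have := young (A `^ (- (p^-1 * q^-1))) (powR_gt0 _ Ap).
have e1 : (A `^ (- (p^-1 * q^-1))) `^ p * A = A `^ p^-1.
  rewrite -powRrM mulNr mulrAC mulVf ?gt_eqF// mul1r -{2}[A]powRr1 ?(ltW Ap)//.
  rewrite -powRD; last by rewrite (gt_eqF Ap) implybT.
  by congr (_ `^ _); rewrite -pq addrC addrK.
have e2 : ((A `^ (- (p^-1 * q^-1))) `^ q)^-1 = A `^ p^-1.
  by rewrite -powRrM mulNr -mulrA mulVf ?gt_eqF// mulr1 powRN invrK.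
rewrite e2 mulrAC e1; move/le_trans; apply.
by rewrite le_eqVlt; apply/orP; left; apply/eqP; ring.
Qed.

Lemma holder_Ic p q u v : 0 < p -> 0 < q -> p^-1 + q^-1 = 1 ->
  ic 0 tp (fun x => u x * conjc (v x)) ->
  ii 0 tp (fun x => nm (u x) `^ p) -> ii 0 tp (fun x => nm (v x) `^ q) ->
  nm (Ic 0 tp (fun x => u x * conjc (v x))) <=
  (p^-1 + q^-1 * Ir 0 tp (fun x => nm (v x) `^ q)) * Ir 0 tp (fun x => nm (u x) `^ p) `^ p^-1.
Proof.
move=> p0 q0 pq huv hu hv.
apply: (young_optimised p0 q0 pq); first by apply: Ir_ge0 => x _; exact: powR_ge0.
by move=> L L0; exact: (@young_Ic _ u v L p q p0 q0 pq L0 huv hu hv).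
Qed.

Lemma pairing_linear a p q h : 1 < p -> p^-1 + q^-1 = 1 -> Hp q (a * q) h ->
  linear_on (Hp p (a * p)) (fun f => pairing a f h).
Proof.
move=> p1 pq hh f g c d hf hg; have q1 := conjugate_gt1 p1 pq.
have p0 : 0 < p by exact: lt_trans p1.
have q0 : 0 < q by exact: lt_trans q1.
have [v bv_] := Hp_boundary q1 hh; have [dv _] := Hp_dholo q0 hh.
have [u1 b1] := Hp_boundary p1 hf; have [d1 _] := Hp_dholo p0 hf.
have [u2 b2] := Hp_boundary p1 hg; have [d2 _] := Hp_dholo p0 hg.
have rv := boundary_rad q1 dv bv_; have r1 := boundary_rad p1 d1 b1.
have r2 := boundary_rad p1 d2 b2.
have [m1 i1 _] := b1; have [m2 i2 _] := b2; have [mv iv _] := bv_.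
have c1 := ic_prod p0 q0 pq m1 mv i1 iv; have c2 := ic_prod p0 q0 pq m2 mv i2 iv.
rewrite (pairing_rad r1 rv c1) (pairing_rad r2 rv c2).
rewrite -(IcZ c c1) -(IcZ d c2) -(IcD (icZ c c1) (icZ d c2)).
have r3 : rad (fun z => phi a z * (c * f z + d * g z)) (fun x => c * u1 x + d * u2 x).
  have -> : (fun z => phi a z * (c * f z + d * g z)) =
     (fun z => c * (phi a z * f z) + d * (phi a z * g z)) by apply/funext => z; ring.
  by apply: radD; exact: radZ.
have E x : (c * u1 x + d * u2 x) * conjc (v x) =
    c * (u1 x * conjc (v x)) + d * (u2 x * conjc (v x)) by ring.
have c3 : ic 0 tp (fun x => (c * u1 x + d * u2 x) * conjc (v x)).
  by apply: eq_ic (icD (icZ c c1) (icZ d c2)) => x _; rewrite E.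
by rewrite (pairing_rad r3 rv c3); apply: eq_Ic => x _; exact: E.
Qed.

Lemma pairing_bounded a p q h : 1 < p -> p^-1 + q^-1 = 1 -> Hp q (a * q) h ->
  bounded_on (Hp p (a * p)) (Hnorm p (a * p)) (fun f => pairing a f h).
Proof.
move=> p1 pq hh; have q1 := conjugate_gt1 p1 pq.
have p0 : 0 < p by exact: lt_trans p1.
have q0 : 0 < q by exact: lt_trans q1.
have [v bv_] := Hp_boundary q1 hh; have [dv _] := Hp_dholo q0 hh.
have rv := boundary_rad q1 dv bv_; have [mv iv _] := bv_.
exists (p^-1 + q^-1 * Ir 0 tp (fun x => nm (v x) `^ q)) => f hf.
have [u1 b1] := Hp_boundary p1 hf; have [d1 _] := Hp_dholo p0 hf.
have r1 := boundary_rad p1 d1 b1; have [m1 i1 _] := b1.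
have c1 := ic_prod p0 q0 pq m1 mv i1 iv.
rewrite (pairing_rad r1 rv c1) (Hnorm_rad p0 m1 i1 r1).
exact: holder_Ic.
Qed.

End PairingBounded.

(** * Representing functionals *)

Section Representation.
Context {R : realType}.
Local Notation C := R[i].
Local Notation tp := (2 * pi : R).
Local Notation D := (`[(0 : R), tp]%classic).
Implicit Types (a r s t x y th p q e : R) (u v : R -> C) (z w : C) (f g h F G : C -> C) (b c d : nat -> C).

Definition pol b n z := \sum_(k < n) b k * z ^+ k.

Lemma pol_recr b n z : pol b n.+1 z = pol b n z + b n * z ^+ n.
Proof. by rewrite /pol big_ord_recr. Qed.

Lemma pol0 b z : pol b 0 z = 0. Proof. by rewrite /pol big_ord0. Qed.

Lemma chol_pol b n z : chol (pol b n) z.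
Proof.
elim: n => [|n IH].
  have -> : pol b 0 = (fun=> 0) by apply/funext => w; exact: pol0.
  exact: chol_cst.
have -> : pol b n.+1 = (fun w => pol b n w + b n * w ^+ n) by apply/funext => w; exact: pol_recr.
by apply: cholD => //; apply: cholM; [exact: chol_cst|exact: cholX].
Qed.

Lemma pol_bd b n z : nm z <= 1 -> nm (pol b n z) <= \sum_(k < n) nm (b k).
Proof.
move=> z1; apply: le_trans (nm_sum _ _ _) _; apply: ler_sum => k _.
by rewrite nmM nmX ler_piMr ?nm_ge0// exprn_ile1 ?nm_ge0.
Qed.

Lemma Np_bounded p F (B r : R) : 0 < p -> dholo F -> (forall z, nm z < 1 -> nm (F z) <= B) -> 0 < r < 1 ->
  Np p F r <= B `^ p * tp.
Proof.
move=> p0 hF hB hr; have /andP[r0 r1] := hr.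
rewrite -[leRHS](_ : Ir 0 tp (fun=> B `^ p) = _); last by rewrite Ir_cst ?tp_ge0// subr0.
apply: Ir_le; [exact: cbm_pow (ltW p0) (cbm_dil hF hr)|exact: ii_cst|move=> th _].
have h : nm (F (cir r th)) <= B by apply: hB; rewrite nm_cir ?ltW.
by rewrite ge0_ler_powR ?nnegrE ?nm_ge0 ?(ltW p0)// (le_trans (nm_ge0 _) h).
Qed.

Lemma Hp_phi_bounded a p F (B : R) : 0 < p -> dholo F -> (forall z, nm z < 1 -> nm (F z) <= B) ->
  Hp p (a * p) (fun z => phi (- a) z * F z).
Proof. by move=> p0 hF hB; apply: Hp_phi p0 hF (fun r hr => Np_bounded p0 hF hB hr). Qed.

Lemma Hp_pol a p b n : 0 < p -> Hp p (a * p) (fun z => phi (- a) z * pol b n z).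
Proof.
move=> p0; apply: (Hp_phi_bounded a (B := \sum_(k < n) nm (b k)) p0).
  by move=> z _; exact: chol_pol.
by move=> z /ltW; exact: pol_bd.
Qed.

Lemma Hp_monomial a p n : 0 < p -> Hp p (a * p) (fun z => phi (- a) z * z ^+ n).
Proof.
move=> p0; apply: (Hp_phi_bounded a (B := 1) p0); first by move=> z _; exact: cholX.
by move=> z z1; rewrite nmX exprn_ile1 ?nm_ge0// ltW.
Qed.

Lemma cbm_pol b n : cbm (fun x => pol b n (expi x)).
Proof.
apply: cbm_cont => x _.
exact: (@ccont_chol _ (@expi R) x (pol b n) (ccont_expi x) (chol_pol b n _)).
Qed.

Lemma rad_phi_pol a b n : rad (fun z => phi a z * (phi (- a) z * pol b n z)) (fun x => pol b n (expi x)).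
Proof.
have -> : (fun z => phi a z * (phi (- a) z * pol b n z)) = pol b n.
  by apply/funext => z; rewrite mulrA [phi a z * _]mulrC phiNK mul1r.
apply: (ae_imp _ (@ae_neq R 0)) => th _ _; apply: rlim_chol; exact: chol_pol.
Qed.

Definition monomial_value a (L : (C -> C) -> C) n : C := L (fun z => phi (- a) z * z ^+ n).

Section Functional.
Context (a p K : R) (L : (C -> C) -> C) (p0 : 0 < p)
  (Llin : linear_on (Hp p (a * p)) L)
  (Lbd : forall f, Hp p (a * p) f -> nm (L f) <= K * Hnorm p (a * p) f).
Local Notation c := (monomial_value a L).

Lemma functional_pol b n : L (fun z => phi (- a) z * pol b n z) = \sum_(k < n) b k * c k.
Proof.
elim: n => [|n IH].
  (* Linearity with both coefficients 0 shows that [L] vanishes at the zero function. *)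
  have h := Hp_pol a b 0 p0; have := Llin 0 0 h h.
  rewrite !mul0r addr0 big_ord0 => <-; congr L; apply/funext => z.
  by rewrite pol0 mulr0 !mul0r addr0.
have := Llin 1 (b n) (Hp_pol a b n p0) (Hp_monomial a n p0).
rewrite [X in _ = X + _]mul1r IH => e.
rewrite big_ord_recr; apply: etrans e; congr L; apply/funext => z.
by rewrite pol_recr mul1r /=; ring.
Qed.

Lemma functional_pol_bd b n : nm (\sum_(k < n) b k * c k) <=
  K * Ir 0 tp (fun x => nm (pol b n (expi x)) `^ p) `^ p^-1.
Proof.
rewrite -functional_pol; apply: le_trans (Lbd (Hp_pol a b n p0)) _.
have hb := cbm_pol b n.
by rewrite (Hnorm_rad p0 (cbm_cmeas hb) (cbm_pow (ltW p0) hb) (rad_phi_pol a b n)).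
Qed.

Lemma functional_coef_bd n : nm (c n) <= K * tp `^ p^-1.
Proof.
pose b k : C := (k == n)%:R.
have pE z : pol b n.+1 z = z ^+ n.
  rewrite pol_recr /b eqxx mul1r /pol big1 ?add0r// => k _.
  by rewrite (ltn_eqF (ltn_ord k)) mul0r.
have := functional_pol_bd b n.+1; rewrite -functional_pol /monomial_value.
have -> : (fun z => phi (- a) z * pol b n.+1 z) = (fun z => phi (- a) z * z ^+ n).
  by apply/funext => z; rewrite pE.
have -> : Ir 0 tp (fun x => nm (pol b n.+1 (expi x)) `^ p) = tp; last by [].
rewrite (@eq_Ir _ _ _ _ (fun=> 1)); first by rewrite Ir_cst ?tp_ge0// subr0 mul1r.
by move=> x _; rewrite pE nmX nm_expi expr1n powR1.
Qed.

End Functional.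

(** Parseval for [u] against a power series on the circle of radius r, kept as an approximation by
    partial sums so that no infinite sum of products appears. *)
Lemma Ic_conj_psum d u r e : pbd d -> cbm u -> 0 < r < 1 -> 0 < e -> exists N, forall n, (N <= n)%N ->
  nm (Ic 0 tp (fun x => u x * conjc (psum d (cir r x))) -
      \sum_(k < n) conjc (d k) * (r ^+ k)%:C * (tp%:C * fc u k)) <= e * Ir 0 tp (fun x => nm (u x)).
Proof.
move=> hd hu hr e0; have /andP[r0 r1] := hr; have hr' : 0 <= r < 1 by rewrite (ltW r0).
have [N hN] := psum_tail hd hr' e0; exists N => n Nn.
have iu := cbm_ic hu.
have cH : cbm (fun x => psum d (cir r x)).
  by apply: (@dholo_cbm _ (psum d)) => // z z1; exact: psum_cder.
have i1 : ic 0 tp (fun x => u x * conjc (psum d (cir r x))).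
  by apply: cbm_ic; apply: cbmM; [exact: hu|exact: cbm_conj].
have cP : cbm (fun x => pol d n (cir r x)).
  apply: cbm_cont => x _.
  exact: (@ccont_chol _ (cir r) x (pol d n) (ccont_cir r x) (chol_pol d n _)).
have i2 : ic 0 tp (fun x => u x * conjc (pol d n (cir r x))).
  by apply: cbm_ic; apply: cbmM; [exact: hu|exact: cbm_conj].
have ik k : ic 0 tp (fun x => conjc (d k) * (r ^+ k)%:C * (expi (- x) ^+ k * u x)).
  by apply: icZ; exact: ic_expiN.
have -> : \sum_(k < n) conjc (d k) * (r ^+ k)%:C * (tp%:C * fc u k) =
   Ic 0 tp (fun x => u x * conjc (pol d n (cir r x))).
  rewrite (@eq_Ic _ _ _ _ (fun x => \sum_(k < n) conjc (d k) * (r ^+ k)%:C * (expi (- x) ^+ k * u x))).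
    rewrite (Ic_sum n ik); apply: eq_bigr => k _.
    by rewrite (IcZ _ (ic_expiN k iu)) IcfcE.
  move=> x _; rewrite /pol conj_sum mulr_sumr; apply: eq_bigr => k _.
  rewrite cir_split (conjM (d k)) (conjM (r ^+ k)%:C) conjc_real conjX conj_expi.
  by ring.
rewrite -(IcB i1 i2); apply: le_trans (Ic_nm (icB i1 i2)) _.
rewrite -(IrZ _ (ii_nm iu)); apply: Ir_le; [exact: ii_nm (icB i1 i2)|exact: iiZ (ii_nm iu)|].
move=> x _; rewrite -mulrBr nmM mulrC; apply: ler_wpM2r; first exact: nm_ge0.
by rewrite -conjB nm_conj; apply: hN => //; rewrite nm_cir ?(ltW r0).
Qed.

End Representation.

(** * The candidate lies in H^q *)

Section RepresentingFunction.
Context {R : realType}.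
Local Notation C := R[i].
Local Notation tp := (2 * pi : R).
Local Notation D := (`[(0 : R), tp]%classic).
Implicit Types (a r s t x y th p q e : R) (u v : R -> C) (z w : C) (f g h F G : C -> C) (b c d : nat -> C).

(** The right side grows like X^(1/p), slower than X. [le_powR_split] linearises it with a slope at
    most 1/2, so the bound depends on the constants only and not on the radius behind X. *)
Lemma self_bound p (K A T : R) : 1 < p -> 0 <= K -> 0 <= A -> 0 <= T ->
  exists M, forall X, 0 <= X -> X <= K * (2 `^ p * (A * X + T)) `^ p^-1 + 1 -> X <= M.
Proof.
move=> p1 K0 A0 T0; pose P := 2 `^ p : R; have P0 : 0 <= P by exact: powR_ge0.
have p0 : 0 < p by exact: lt_trans p1.
pose E := 2 * (K * P * A) + 1; have E0 : 0 < E by rewrite ltr_wpDl// !mulr_ge0.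
pose c := E `^ (p - 1)^-1; have c0 : 0 < c by exact: powR_gt0.
have cE : c `^ (p - 1) = E.
  by rewrite /c -powRrM mulVf ?powRr1 ?(ltW E0)// gt_eqF// subr_gt0.
exists (2 * (K * c + K * (E^-1 * (P * T)) + 1)) => X X0 hX.
have Y0 : 0 <= P * (A * X + T) by rewrite mulr_ge0// addr_ge0// mulr_ge0.
have h := le_powR_split p1 c0 (powR_ge0 (P * (A * X + T)) p^-1).
rewrite cE -powRrM mulVf ?gt_eqF// powRr1// in h.
have h2 := ler_wpM2l K0 h.
have e : K * (c + E^-1 * (P * (A * X + T))) =
   K * c + K * (E^-1 * (P * T)) + (K * P * A) / E * X by ring.
rewrite e in h2.
have h3 : (K * P * A) / E * X <= 2^-1 * X.
  apply: ler_wpM2r => //; rewrite ler_pdivrMr// /E.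
  have : 0 <= K * P * A by rewrite !mulr_ge0.
  by move: (K * P * A) => k; clear; lra.
move: hX h2 h3; rewrite -/P.
move: (K * _ `^ _) (_ / E * X) (K * c + _) => a1 a2 a3; clear; lra.
Qed.

Lemma powR_mono (e x y : R) : 0 <= e -> 0 <= x -> x <= y -> x `^ e <= y `^ e.
Proof. by move=> e0 x0 xy; rewrite ge0_ler_powR ?nnegrE ?(le_trans x0 xy). Qed.

Lemma inv_succ_mul (J : R) : 0 <= J -> (J + 1)^-1 * J <= 1.
Proof. by move=> J0; rewrite mulrC ler_pdivrMr ?ltr_wpDl// mul1r lerDl ler01. Qed.

Section Functional.
Context (a p q K : R) (L : (C -> C) -> C) (p1 : 1 < p) (q1 : 1 < q) (pq : p^-1 + q^-1 = 1)
  (K0 : 0 <= K) (Llin : linear_on (Hp p (a * p)) L)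
  (Lbd : forall f, Hp p (a * p) f -> nm (L f) <= K * Hnorm p (a * p) f).
Local Notation c := (monomial_value a L).

(** The conjugate offsets the conjugate-linearity of the pairing in its second argument, and [tp^-1]
    the unnormalised measure. *)
Definition rep_coef n : C := conjc (monomial_value a L n) * (tp^-1)%:C.

Lemma rep_coefE n : conjc (rep_coef n) * tp%:C = c n.
Proof.
rewrite /rep_coef conjM conjc_real conjcK -mulrA -rmorphM mulVf ?mulr1//.
by rewrite gt_eqF// tp_gt0.
Qed.

Lemma rep_pbd : pbd rep_coef.
Proof.
have p0 : 0 < p by exact: lt_trans p1.
move=> r /andP[r0 r1]; exists (K * tp `^ p^-1 * `|tp^-1|) => n.
rewrite /rep_coef nmM nm_conj nmR -[leRHS]mulr1; apply: ler_pM.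
- by rewrite mulr_ge0 ?nm_ge0.
- exact: exprn_ge0.
- by apply: ler_wpM2r; [exact: normr_ge0|exact: functional_coef_bd].
- by rewrite exprn_ile1// ltW.
Qed.

Lemma rep_dholo : dholo (psum rep_coef).
Proof. by move=> z z1; apply: psum_cder => //; exact: rep_pbd. Qed.

Lemma rep_pairing u r n : \sum_(k < n) conjc (rep_coef k) * (r ^+ k)%:C * (tp%:C * fc u k) =
  \sum_(k < n) (fc u k * (r ^+ k)%:C) * c k.
Proof. by apply: eq_bigr => k _; rewrite -rep_coefE; ring. Qed.

(* With [v = H_r] and [k = |v| ^ (q - 2) v], the integral of [|v| ^ q] is the value of the functional
   on (a partial sum of) the Riesz projection of [k]. *)
Lemma rep_bounded : exists M, forall r, 0 < r < 1 -> Np q (psum rep_coef) r <= M.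
Proof.
have p0 : 0 < p by exact: lt_trans p1.
have q0 : 0 < q by exact: lt_trans q1.
have [A [A0 hA]] := @riesz R p p1.
have [M hM] := self_bound p1 K0 A0 (@tp_ge0 R).
exists M => r hr; have /andP[r0 r1] := hr; have hr' : 0 <= r < 1 by rewrite (ltW r0).
pose v x := psum rep_coef (cir r x).
have hv : cbm v := cbm_dil rep_dholo hr.
pose k x := (nm (v x) `^ (q - 2))%:C * v x.
have hk : cbm k := cbm_powZ q1 hv.
have ik := cbm_ic hk.
pose X := Np q (psum rep_coef) r.
have X0 : 0 <= X by apply: Ir_ge0 => x _; exact: powR_ge0.
apply: hM; first exact: X0.
(* |k|^p = |v|^((q-1)p) and (q - 1) p = q by conjugacy: the test function has the same integral as
   the quantity to be bounded. *)
have kX : Ir 0 tp (fun x => nm (k x) `^ p) = X.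
  apply: eq_Ir => x _; rewrite /k nm_powZ// -powRrM; congr (_ `^ _).
  have e : q = p * (q - 1); last by rewrite mulrC -e.
  have : (p^-1 + q^-1) * (p * q) = p * q by rewrite pq mul1r.
  have -> : (p^-1 + q^-1) * (p * q) = q + p by field; rewrite !gt_eqF.
  by move=> e; rewrite mulrBr mulr1 -e addrK.
have IX : Ic 0 tp (fun x => k x * conjc (v x)) = X%:C.
  rewrite (eq_Ic (v := fun x => (nm (v x) `^ q)%:C)); first exact: (Ic_real _ tp_ge0).
  by move=> x _; exact: pow_mul_conj.
have J0 : 0 <= Ir 0 tp (fun x => nm (k x)) by apply: Ir_ge0 => x _; exact: nm_ge0.
have J1 : 0 < Ir 0 tp (fun x => nm (k x)) + 1 by rewrite ltr_wpDl.
have J2 : 0 < (Ir 0 tp (fun x => nm (k x)) + 1)^-1 by rewrite invr_gt0.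
(* The tolerance 1 / (J + 1), with J the L^1 norm of [k], keeps the truncation error below 1. *)
have [N hN] := Ic_conj_psum rep_pbd hk hr J2.
have [N' hN'] := psum_tail (fc_pbd ik) hr' ltr01.
pose n := maxn N N'.
have h1 := hN n (leq_maxl _ _); rewrite rep_pairing in h1.
pose b j := fc k j * (r ^+ j)%:C.
have h2 := functional_pol_bd p0 Llin Lbd b n.
have h3 : Np q (psum rep_coef) r <= nm (\sum_(j < n) b j * c j) + 1.
  apply: (@le_trans _ _ (nm (Ic 0 tp (fun x => k x * conjc (v x))))).
    rewrite IX nmR (ger0_norm X0); exact: lexx.
  rewrite -lerBlDl; apply: le_trans (nm_lerB _ _) _; apply: le_trans h1 _.
  exact: inv_succ_mul J0.
apply: le_trans h3 _; rewrite lerD2r; apply: le_trans h2 _; apply: ler_wpM2l; first exact: K0.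
have bE x : pol b n (expi x) = \sum_(j < n) fc k j * cir r x ^+ j.
  by apply: eq_bigr => j _; rewrite cir_split /b mulrA.
have ic_ := cp_t_pow (ltW p0) ik hr.
have hb := cbm_pow (ltW p0) (cbm_pol b n).
have P0 : 0 <= 2 `^ p :> R by exact: powR_ge0.
have B0 : 0 <= Ir 0 tp (fun x => nm (pol b n (expi x)) `^ p).
  by apply: Ir_ge0 => x _; exact: powR_ge0.
have pi0 : 0 <= p^-1 by rewrite invr_ge0 ltW.
apply: (powR_mono pi0 B0).
(* The polynomial is uniformly within 1 of the projection [cp k] on the circle of radius r; this 1
   integrates to the term T = 2 pi of [self_bound]. *)
apply: (@le_trans _ _ (Ir 0 tp (fun x => 2 `^ p * (nm (cp k (cir r x)) `^ p + 1)))).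
  apply: Ir_le; [exact: hb|exact: iiZ (iiD ic_ (ii_cst _ _ _))|move=> x _].
  have e1 : (1 : R) = 1 `^ p by rewrite powR1.
  rewrite [X in _ * (_ + X)]e1; apply: le_trans (powR_add_le (ltW p0) (nm_ge0 _) ler01).
  apply: (powR_mono (ltW p0) (nm_ge0 _)).
  have := hN' n (leq_maxr _ _) (cir r x); rewrite (nm_cir _ (ltW r0)) lexx => /(_ isT).
  rewrite -bE nm_distC => h; rewrite -lerBlDl; apply: le_trans h; exact: nm_lerB.
rewrite (IrZ _ (iiD ic_ (ii_cst 0 tp 1))) (IrD ic_ (ii_cst 0 tp 1)) (Ir_cst _ tp_ge0) subr0 mul1r.
apply: (ler_wpM2l P0); rewrite lerD2r.
apply: le_trans (hA k r hk hr) _; rewrite kX; exact: lexx.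
Qed.

End Functional.
End RepresentingFunction.

(** * The functional agrees with the pairing *)

Section Duality.
Context {R : realType}.
Local Notation C := R[i].
Local Notation tp := (2 * pi : R).
Local Notation D := (`[(0 : R), tp]%classic).
Implicit Types (a r s t x y th p q e : R) (u v w : R -> C) (z : C) (f g h F G : C -> C) (b c d : nat -> C).

Lemma fc_expi m k : fc (fun x => expi x ^+ m : C) k = (k == m)%:R.
Proof.
have ee x : expi (- x) * expi x = 1 :> C by rewrite -expiD addNr expi0.
rewrite /fc; have [km|mk|->] := ltngtP k m.
- rewrite (@eq_Ic _ _ _ _ (fun x => expi x ^+ (m - k).-1.+1)); first by rewrite Ic_expi mulr0.
  move=> x _; rewrite prednK ?subn_gt0// -{1}(subnKC (ltnW km)) exprD mulrA -exprMn ee.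
  by rewrite expr1n mul1r.
- rewrite (@eq_Ic _ _ _ _ (fun x => expi (- x) ^+ (k - m).-1.+1)); first by rewrite Ic_expiN mulr0.
  move=> x _; rewrite prednK ?subn_gt0// -{1}(subnKC (ltnW mk)) exprD mulrC mulrA -exprMn.
  by rewrite [expi x * _]mulrC ee expr1n mul1r.
rewrite (@eq_Ic _ _ _ _ (fun=> 1)); last by move=> x _; rewrite -exprMn ee expr1n.
by rewrite Ic_cst ?tp_ge0// subr0 mul1r mulVf ?tpC_neq0.
Qed.

Lemma cbm_expiX m : cbm (fun x => expi x ^+ m : C).
Proof. by apply: cbm_cont => x _; exact/ccontX/ccont_expi. Qed.

Lemma Ic_conj_near p u v w e : 1 < p -> 0 < e -> cbm u -> (forall x, nm (u x) <= 1) ->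
  cmeas v -> cmeas w -> ii 0 tp (fun x => nm (v x) `^ p) -> ii 0 tp (fun x => nm (w x) `^ p) ->
  Ir 0 tp (fun x => nm (v x - w x) `^ p) <= e * e `^ (p - 1) ->
  ic 0 tp (fun x => u x * conjc (v x)) -> ic 0 tp (fun x => u x * conjc (w x)) ->
  nm (Ic 0 tp (fun x => u x * conjc (v x)) - Ic 0 tp (fun x => u x * conjc (w x))) <= (tp + 1) * e.
Proof.
move=> p1 e0 hu u1 mv mw hv hw hvw i1 i2.
have ep : 0 < e `^ (p - 1) by exact: powR_gt0.
have ip := ii_powD p1 mv mw hv hw.
rewrite -(IcB i1 i2); apply: le_trans (Ic_nm (icB i1 i2)) _.
apply: (@le_trans _ _ (Ir 0 tp (fun x => e + (e `^ (p - 1))^-1 * nm (v x - w x) `^ p))).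
  apply: Ir_le; [exact: ii_nm (icB i1 i2)|exact: iiD (ii_cst _ _ _) (iiZ _ ip)|move=> x _].
  apply: le_trans (le_powR_split p1 e0 (nm_ge0 _)).
  by rewrite -mulrBr -conjB nmM nm_conj ler_piMl ?nm_ge0.
rewrite (IrD (ii_cst 0 tp e) (iiZ _ ip)) (IrZ _ ip) (Ir_cst _ tp_ge0) subr0.
rewrite [leRHS]mulrDl mul1r [e * tp]mulrC lerD2l mulrC ler_pdivrMr//.
Qed.

Section Functional.
Context (a p q K : R) (L : (C -> C) -> C) (p1 : 1 < p) (q1 : 1 < q) (pq : p^-1 + q^-1 = 1)
  (K0 : 0 <= K) (Llin : linear_on (Hp p (a * p)) L)
  (Lbd : forall f, Hp p (a * p) f -> nm (L f) <= K * Hnorm p (a * p) f).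
Local Notation c := (monomial_value a L).
Local Notation H := (psum (rep_coef a L)).

Lemma rep_Ic_monomial m r : 0 < r < 1 ->
  Ic 0 tp (fun x => expi x ^+ m * conjc (H (cir r x))) = (r ^+ m)%:C * c m.
Proof.
move=> hr; apply/eqP; rewrite -subr_eq0 -nm_eq0 eq_le nm_ge0 andbT.
apply: (@le0_eps _ _ (Ir 0 tp (fun x => nm (expi x ^+ m : C)))) => e e0.
have [N hN] := Ic_conj_psum (rep_pbd p1 Llin Lbd) (cbm_expiX m) hr e0.
have := hN (maxn N m.+1) (leq_maxl _ _); rewrite rep_pairing.
have nm_ : (m < maxn N m.+1)%N by rewrite leq_max ltnSn orbT.
rewrite (bigD1 (Ordinal nm_))//= big1 ?addr0; last first.
  by move=> k km; rewrite fc_expi (_ : (_ == _) = false) ?mul0r//; apply: negbTE.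
by rewrite fc_expi eqxx mul1r [leRHS]mulrC.
Qed.

(** Let r tend to 1 in [rep_Ic_monomial]. Replacing H_r by [w] costs (2 pi + 1) e, and replacing r^m
    by 1 costs m (1 - r) |c_m|, with 1 - r <= e. *)
Lemma rep_boundary_monomial w m : has_boundary q H w ->
  Ic 0 tp (fun x => expi x ^+ m * conjc (w x)) = c m.
Proof.
move=> [mw hw hb]; have p0 : 0 < p by exact: lt_trans p1.
have q0 : 0 < q by exact: lt_trans q1.
have hu := cbm_expiX m; have pu := cbm_pow (ltW p0) hu.
have dH := rep_dholo p1 Llin Lbd.
have i1 := ic_prod p0 q0 pq (cbm_cmeas hu) mw pu hw.
apply/eqP; rewrite -subr_eq0 -nm_eq0 eq_le nm_ge0 andbT.
apply: (@le0_eps _ _ (tp + 1 + m%:R * nm (c m))) => e e0.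
have eq0 : 0 < e * e `^ (q - 1) by rewrite mulr_gt0// powR_gt0.
have [rho hrho h] := hb _ eq0.
have hm : 0 <= Num.max 0 (1 - e) < 1 by rewrite le_max lexx/= gt_max ltr01 ltrBlDr ltrDl.
have [r [r1 r2 hr]] := radius_above hrho hm; have /andP[r3 r4] := hr.
have bH := cbm_dil dH hr.
have i2 : ic 0 tp (fun x => expi x ^+ m * conjc (H (cir r x))).
  by apply: cbm_ic; apply: cbmM; [exact: hu|exact: cbm_conj].
have u1 x : nm (expi x ^+ m : C) <= 1 by rewrite nmX nm_expi expr1n.
have hr' : Ir 0 tp (fun x => nm (H (cir r x) - w x) `^ q) <= e * e `^ (q - 1) by apply: h; rewrite r1.
have k1 := Ic_conj_near q1 e0 hu u1 (cbm_cmeas bH) mw (cbm_pow (ltW q0) bH) hw hr' i2 i1.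
rewrite (rep_Ic_monomial m hr) nm_distC in k1.
apply: le_trans (nm_tri _ ((r ^+ m)%:C * c m) _) _.
rewrite [leRHS]mulrDl; apply: lerD; first exact: k1.
have -> : (r ^+ m)%:C * c m - c m = (r ^+ m - 1)%:C * c m by rewrite rmorphB /= mulrBl mul1r.
rewrite nmM nmR distrC.
have rm : r ^+ m <= 1 by rewrite exprn_ile1 ?ltW.
rewrite ger0_norm ?subr_ge0// mulrAC; apply: ler_wpM2r; first exact: nm_ge0.
have h01 : 0 <= r <= 1 by rewrite !ltW.
apply: le_trans (one_sub_expr_le m h01) _; apply: ler_wpM2l => //.
by move: r2; rewrite gt_max => /andP[_ /ltW]; rewrite lerBlDr lerBlDl.
Qed.

Lemma rep_boundary_pol w b n : has_boundary q H w ->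
  Ic 0 tp (fun x => pol b n (expi x) * conjc (w x)) = \sum_(k < n) b k * c k.
Proof.
move=> hw; have [mw iw _] := hw; have p0 : 0 < p by exact: lt_trans p1.
have q0 : 0 < q by exact: lt_trans q1.
have ik k : ic 0 tp (fun x => expi x ^+ k * conjc (w x)).
  exact: ic_prod p0 q0 pq (cbm_cmeas (cbm_expiX k)) mw (cbm_pow (ltW p0) (cbm_expiX k)) iw.
rewrite (@eq_Ic _ _ _ _ (fun x => \sum_(k < n) b k * (expi x ^+ k * conjc (w x)))).
  rewrite (Ic_sum n (fun k => icZ (b k) (ik k))); apply: eq_bigr => k _.
  by rewrite (IcZ _ (ik k)) (rep_boundary_monomial k hw).
by move=> x _; rewrite /pol mulr_suml; apply: eq_bigr => k _; rewrite mulrA.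
Qed.

(** A dilate F_r is close to [u] in L^p, and a Taylor polynomial is uniformly close to F_r;
    absorbing r^k into the coefficients makes it a polynomial on the unit circle. *)
Lemma pol_dense F u e : dholo F -> has_boundary p F u -> 0 < e -> exists b n,
  Ir 0 tp (fun x => nm (u x - pol b n (expi x)) `^ p) `^ p^-1 <= 2 * (tp + 1) `^ p^-1 * e.
Proof.
move=> hF [mu_ hu hb] e0; have p0 : 0 < p by exact: lt_trans p1.
have ep : 0 < e `^ p by exact: powR_gt0.
have [rho hrho h] := hb _ ep.
have [r [r1 _ hr]] := radius_above hrho hrho; have /andP[r3 r4] := hr.
have hr' : 0 <= r < 1 by rewrite (ltW r3).
have [n hn] := psum_tail (coef_pbd hF) hr' e0.
exists (fun k => coef F k * (r ^+ k)%:C), n.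
have pE x : pol (fun k => coef F k * (r ^+ k)%:C) n (expi x) = \sum_(k < n) coef F k * cir r x ^+ k.
  by apply: eq_bigr => k _; rewrite cir_split mulrA.
have hq x : 0 <= x <= tp -> nm (F (cir r x) - pol (fun k => coef F k * (r ^+ k)%:C) n (expi x)) <= e.
  move=> hx; rewrite pE (holo_expansion hF hr hx); apply: (hn n (leqnn n)).
  by rewrite (nm_cir _ (ltW r3)).
have hP := cbm_pol (fun k => coef F k * (r ^+ k)%:C) n.
move: (pol _ n) hP hq => Q hP hq; clear pE.
have bF := cbm_dil hF hr.
have i0 := ii_powD p1 mu_ (cbm_cmeas hP) hu (cbm_pow (ltW p0) hP).
have i1 := ii_powD p1 (cbm_cmeas bF) mu_ (cbm_pow (ltW p0) bF) hu.
have i2 := ii_cst 0 tp (e `^ p).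
have P0 : 0 <= 2 `^ p :> R by exact: powR_ge0.
have k1 : Ir 0 tp (fun x => nm (u x - Q (expi x)) `^ p) <= 2 `^ p * ((tp + 1) * e `^ p).
  apply: (@le_trans _ _ (Ir 0 tp (fun x => 2 `^ p * (nm (F (cir r x) - u x) `^ p + e `^ p)))).
    apply: Ir_le; [exact: i0|exact: iiZ (iiD i1 i2)|move=> x hx].
    apply: le_trans (powR_add_le (ltW p0) (nm_ge0 _) (ltW e0)).
    apply: (powR_mono (ltW p0) (nm_ge0 _)).
    apply: le_trans (nm_tri _ (F (cir r x)) _) _; rewrite nm_distC lerD2l; exact: hq.
  rewrite (IrZ _ (iiD i1 i2)) (IrD i1 i2) (Ir_cst _ tp_ge0) subr0.
  apply: (ler_wpM2l P0); rewrite [leRHS]mulrDl mul1r [leRHS]addrC [e `^ p * tp]mulrC lerD2r.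
  by apply: h; rewrite r1.
have T0 : 0 <= tp + 1 by rewrite addr_ge0 ?tp_ge0.
have -> : 2 * (tp + 1) `^ p^-1 * e = (2 `^ p * ((tp + 1) * e `^ p)) `^ p^-1.
  rewrite !powRM ?mulr_ge0 ?powR_ge0// -!powRrM !mulfV ?gt_eqF// !powRr1 ?ltW//.
  by rewrite mulrA.
apply: powR_mono k1; first by rewrite invr_ge0 ltW.
by apply: Ir_ge0 => x _; exact: powR_ge0.
Qed.

(** Written with the coefficients 1 and -1 to match [linear_on], so that the bound on [L] applies to
    the difference. *)
Lemma Hp_subl_pol f b n : Hp p (a * p) f ->
  Hp p (a * p) (fun z => 1 * f z + -1 * (phi (- a) z * pol b n z)).
Proof.
move=> hf; have p0 : 0 < p by exact: lt_trans p1.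
have [hF [M hM]] := Hp_dholo p0 hf.
have dQ : dholo (pol b n) by move=> z _; exact: chol_pol.
have dG : dholo (fun z => phi a z * f z + -1 * pol b n z).
  by move=> z z1; apply: cholD; [exact: hF|apply: cholM; [exact: chol_cst|exact: dQ]].
have -> : (fun z => 1 * f z + -1 * (phi (- a) z * pol b n z)) =
  (fun z => phi (- a) z * (phi a z * f z + -1 * pol b n z)).
  by apply/funext => z; rewrite mulrDr mulrA phiNK; ring.
pose B := \sum_(k < n) nm (b k).
apply: (Hp_phi a p0 dG (M := 2 `^ p * (M + B `^ p * tp))) => r hr.
have k1 := hM r hr.
have k2 : Np p (pol b n) r <= B `^ p * tp.
  by apply: Np_bounded => // z /ltW; exact: pol_bd.
have j1 := cbm_pow (ltW p0) (cbm_dil hF hr); have j2 := cbm_pow (ltW p0) (cbm_dil dQ hr).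
apply: (@le_trans _ _ (Ir 0 tp (fun x => 2 `^ p * (nm (phi a (cir r x) * f (cir r x)) `^ p +
    nm (pol b n (cir r x)) `^ p)))).
  apply: Ir_le; [exact: cbm_pow (ltW p0) (cbm_dil dG hr)|exact: iiZ (iiD j1 j2)|move=> x _].
  apply: le_trans (powR_add_le (ltW p0) (nm_ge0 _) (nm_ge0 _)).
  apply: (powR_mono (ltW p0) (nm_ge0 _)).
  by apply: le_trans (nmD _ _) _; rewrite lerD2l nmM nmN nm1 mul1r.
rewrite (IrZ _ (iiD j1 j2)) (IrD j1 j2); apply: ler_wpM2l; first exact: powR_ge0.
exact: lerD.
Qed.

Theorem representation : exists h, Hp q (a * q) h /\
  forall f, Hp p (a * p) f -> L f = pairing a f h.
Proof.
have p0 : 0 < p by exact: lt_trans p1.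
have q0 : 0 < q by exact: lt_trans q1.
have dH := rep_dholo p1 Llin Lbd.
have [M hM] := rep_bounded p1 q1 pq K0 Llin Lbd.
exists (fun z => phi (- a) z * H z); split; first exact: Hp_phi q0 dH hM.
have [w hw] := boundary_exists q1 dH hM; have [mw iw _] := hw.
have rw : rad (fun z => phi a z * (phi (- a) z * H z)) w.
  have -> : (fun z => phi a z * (phi (- a) z * H z)) = H.
    by apply/funext => z; rewrite mulrA [phi a z * _]mulrC phiNK mul1r.
  exact: boundary_rad q1 dH hw.
move=> f hf; have [hF _] := Hp_dholo p0 hf; have [u hu] := Hp_boundary p1 hf.
have ru := boundary_rad p1 hF hu; have [mu_ iu _] := hu.
have iuw := ic_prod p0 q0 pq mu_ mw iu iw.
rewrite (pairing_rad ru rw iuw).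
pose K2 := p^-1 + q^-1 * Ir 0 tp (fun x => nm (w x) `^ q).
have K20 : 0 <= K2.
  rewrite addr_ge0 ?mulr_ge0 ?invr_ge0 ?(ltW p0) ?(ltW q0)//.
  by apply: Ir_ge0 => x _; exact: powR_ge0.
apply/eqP; rewrite -subr_eq0 -nm_eq0 eq_le nm_ge0 andbT.
(* [K] bounds [L] and [K2] bounds the pairing with [w]; both act on [f] minus its polynomial
   approximation, on which the two functionals already agree. *)
apply: (@le0_eps _ _ ((K + K2) * (2 * (tp + 1) `^ p^-1))) => e e0.
have [b [n hb]] := pol_dense hF hu e0.
have hQ := cbm_pol b n; have mQ := cbm_cmeas hQ; have jQ := cbm_pow (ltW p0) hQ.
have mD := cmeasB mu_ mQ; have jD := ii_powD p1 mu_ mQ iu jQ.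
have iQw := ic_prod p0 q0 pq mQ mw jQ iw.
have h1 : nm (L f - \sum_(k < n) b k * c k) <= K * (2 * (tp + 1) `^ p^-1 * e).
  have hG := Hp_subl_pol b n hf.
  have lG := Llin 1 (-1) hf (Hp_pol a b n p0).
  rewrite (functional_pol p0 Llin) mul1r mulN1r in lG.
  rewrite -lG; apply: le_trans (Lbd hG) _; apply: ler_wpM2l; first exact: K0.
  have rG : rad (fun z => phi a z * (1 * f z + -1 * (phi (- a) z * pol b n z)))
      (fun x => u x - pol b n (expi x)).
    have -> : (fun z => phi a z * (1 * f z + -1 * (phi (- a) z * pol b n z))) =
      (fun z => phi a z * f z + -1 * (phi a z * (phi (- a) z * pol b n z))).
      by apply/funext => z; ring.
    have -> : (fun x => u x - pol b n (expi x)) = (fun x => u x + -1 * pol b n (expi x)).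
      by apply/funext => x; rewrite mulN1r.
    by apply: radD => //; apply: radZ; exact: rad_phi_pol.
  by rewrite (Hnorm_rad p0 mD jD rG).
have iDw := ic_prod p0 q0 pq mD mw jD iw.
have h2 : nm (\sum_(k < n) b k * c k - Ic 0 tp (fun x => u x * conjc (w x))) <=
    K2 * (2 * (tp + 1) `^ p^-1 * e).
  rewrite -(rep_boundary_pol b n hw) nm_distC -(IcB iuw iQw).
  rewrite (@eq_Ic _ _ _ _ (fun x => (u x - pol b n (expi x)) * conjc (w x))); last first.
    by move=> x _; rewrite mulrBl.
  by apply: le_trans (holder_Ic p0 q0 pq iDw jD iw) _; apply: ler_wpM2l.
apply: le_trans (nm_tri _ (\sum_(k < n) b k * c k) _) _.
rewrite -[leRHS]mulrA [leRHS]mulrDl; exact: lerD h1 h2.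
Qed.

End Functional.
End Duality.

Theorem theorem5 (R : realType) (alpha p q : R) :
  0 <= alpha -> 1 < p -> p^-1 + q^-1 = 1 ->
  (forall h : (R[i])^o -> (R[i])^o, Hp q (alpha * q) h ->
     linear_on (Hp p (alpha * p)) (fun f => pairing alpha f h) /\
     bounded_on (Hp p (alpha * p)) (Hnorm p (alpha * p))
       (fun f => pairing alpha f h)) /\
  (forall L : ((R[i])^o -> (R[i])^o) -> (R[i])^o,
     linear_on (Hp p (alpha * p)) L ->
     bounded_on (Hp p (alpha * p)) (Hnorm p (alpha * p)) L ->
     exists h : (R[i])^o -> (R[i])^o, Hp q (alpha * q) h /\
       forall f, Hp p (alpha * p) f -> L f = pairing alpha f h).
Proof.
move=> _ p1 pq; have q1 := conjugate_gt1 p1 pq; split.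
  by move=> h hh; split; [exact: pairing_linear hh|exact: pairing_bounded hh].
(* [bounded_on] allows a negative constant, whereas the estimates use [0 <= K]; hence the absolute
   value. *)
move=> L Llin [K hK]; apply: (@representation R alpha p q `|K| L) => // f hf.
by apply: le_trans (hK f hf) _; rewrite ler_wpM2r ?ler_norm ?powR_ge0.
Qed.
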